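(* Let $p\ge 5$ be a prime, $m\ge 1$ an integer, and $q=p^m$ with $q\equiv 2\pmod 3$. Let $d_3(q)$ be the number of simple directed cycles in the cubic AGM graph over $\mathbb{F}_q$. Then $$d_3(q)\ge\frac{16}{15}\sqrt q-1.$$
   Context: Since $q\equiv 2\pmod 3$, every element of $\mathbb{F}_q$ has a unique cube root in $\mathbb{F}_q$. The cubic AGM graph over $\mathbb{F}_q$ is the directed graph with vertex set $V_{\mathrm{AGM}}=\{(u,v)\in\mathbb{F}_q^2\mid v\ne 0,\ u^3\ne v^3\}$ and with a directed edge $(u,v)\to(u',v')$ between vertices exactly when $u'=\frac{u+2v}{3}$ and $v'^3=\frac{v(u^2+uv+v^2)}{3}$; each vertex has exactly one outgoing edge. Cycles that differ only in their starting vertex are identified, and loops are counted as cycles of length $1$. *)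

(* Defs.v *)
From mathcomp Require Import all_boot all_order all_algebra.

Set Implicit Arguments.
Unset Strict Implicit.
Unset Printing Implicit Defensive.

Import Order.TTheory GRing.Theory Num.Theory.

Local Open Scope ring_scope.

Section SimpleCycles.

Variables (T : finType) (e : rel T).

(* [ucycleb e] accepts the one-vertex sequence [:: x] exactly when [e x x],
   so loops are cycles of length 1; it also accepts the empty sequence, hence
   only lengths n >= 1 are used below. *)
Definition simple_cycles (n : nat) : {set n.-tuple T} :=
  [set c : n.-tuple T | ucycleb e c].

Definition same_cycle (n : nat) : rel (n.-tuple T) :=
  [rel c d : n.-tuple T | [exists k : 'I_n, rot k c == d :> seq T]].

(* The vertices of a simple cycle are distinct, so its length is at most
   #|T|. *)
Definition num_simple_cycles : nat :=
  (\sum_(1 <= n < #|T|.+1)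
     #|equivalence_partition (same_cycle (n := n)) (simple_cycles n)|)%N.

End SimpleCycles.

Section CubicAGM.

Variable F : finFieldType.

Definition is_agm_vertex (x : F * F) : bool :=
  (x.2 != 0) && (x.1 ^+ 3 != x.2 ^+ 3).

Definition agm_vertex : finType := {x : F * F | is_agm_vertex x}.

Definition agm_edge : rel agm_vertex :=
  [rel x y : agm_vertex |
     let: (u, v) := val x in
     let: (u', v') := val y in
     (u' == (u + 2 * v) / 3) &&
     (v' ^+ 3 == v * (u ^+ 2 + u * v + v ^+ 2) / 3)].

Definition d3 : nat := num_simple_cycles agm_edge.

End CubicAGM.

(* Main.v *)
Require Import Defs.
From Stdlib Require BinInt.
From HB Require Import structures.
From mathcomp Require Import all_boot all_order all_algebra all_field.
From mathcomp Require Import finmap.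
From mathcomp Require Import boolp classical_sets.
From mathcomp Require Import Rstruct.
From mathcomp Require Import reals topology normedtype sequences derive exp trigo.
From mathcomp Require Import complex.
From mathcomp Require Import ring lra.
From mathcomp Require Import zify ssrZ.

Set Implicit Arguments.
Unset Strict Implicit.
Unset Printing Implicit Defensive.

Import Order.TTheory GRing.Theory Num.Theory.
Import numFieldNormedType.Exports.

Local Open Scope ring_scope.
Local Notation Re := (@complex.Re _).
Local Notation Im := (@complex.Im _).

(* The cubic AGM is the reduction of a 3-isogeny correspondence.  Let y and B be
   the two Eisenstein series of weight 3 with the quadratic character mod 3; the
   Fricke involution t |-> -1/(3t) exchanges them up to t^3 and a constant.  The
   polynomial whose roots are the p+1 transforms of B (or of y) under p-isogenies
   has coefficients that are forms in B and y over the integers, and modulo p it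
   is Z^(p+1) - F Z.  Reading off a coefficient gives a form alpha over F_p of
   degree p-1 with alpha(B,y) = 1.  The cubic relations between B, y and their
   3-sections are those of one AGM step, so that
   I(u,v) = alpha(v^3, (u^3-v^3)/27) is constant along the edges of the graph.

   For 3 | t and 0 < t^2 < 4p, a point with complex multiplication by an element
   lambda of trace t and norm p is fixed by one of the p-isogenies, which yields a
   common root of the two polynomials; reducing lambda to t modulo p gives a vertex
   where I = -t^3.  Cubing is injective, so there are at least 2 floor(2 sqrt p/3)
   values of I, hence as many cycles (the edge map being a permutation).  This is
   the case q = p.  As q = 2 mod 3, otherwise m >= 3, and counting the values of
   the invariant v^(p-1) on the vertices with u/v in F_p suffices. *)

(** * Unconditional sums of complex numbers *)

(** Why two polynomials: in [x = y/B] they give [H_B] and [H_y], with a common complex root at the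
    CM point. Their resultant, an integer polynomial in the conjugate of lambda, vanishes there and
    hence, modulo [p], at [t]. A common factor modulo [p] might have its roots in an extension; but
    then [H_B = mu^2 - mu A(x)] and [H_y = mu^2 x^(p+1) - mu x^2 A(x)] with [mu = -t^3], so
    [H_y - x^2 H_B = mu^2 x (x^p - x)] splits over [F_p]. A resultant commutes with reduction only
    if leading coefficients survive, whence the separate computation of the top coefficient of
    alpha, and [mu] is kept away from 0 and -1. Writing a form in terms of [B] and [y] takes
    divisions by [y] and, on the Fricke side, by [B], so [1/B] and [X/y] must converge in the whole
    disc. This comes from [B(x) B(wx) B(w^2 x) = B(x^3)^3] ([w] a cube root of unity) and an
    analogue for [y]: the cubic relations serve twice. They rest on a vanishing criterion that uses
    only translation and the Fricke involution. *)

Local Notation nc := (@Normc.normc _).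

Section ComplexNorm.
Variable R : rcfType.
Implicit Types x y z : R[i].

Lemma nc_ge0 x : 0 <= nc x.
Proof. by case: x => a b /=; rewrite sqrtr_ge0. Qed.

Lemma nc0 : nc (0 : R[i]) = 0.
Proof. exact: Normc.normc0. Qed.

Lemma nc1 : nc (1 : R[i]) = 1.
Proof. exact: Normc.normc1. Qed.

Lemma ncM x y : nc (x * y) = nc x * nc y.
Proof. exact: Normc.normcM. Qed.

Lemma ncV x : nc x^-1 = (nc x)^-1.
Proof. exact: Normc.normcV. Qed.

Lemma ncX x n : nc (x ^+ n) = nc x ^+ n.
Proof. by elim: n => [|n IH]; rewrite ?expr0 ?nc1 // !exprS ncM IH. Qed.

Lemma ncD x y : nc (x + y) <= nc x + nc y.
Proof. exact: (@le_normcD R). Qed.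

Lemma ncN x : nc (- x) = nc x.
Proof. exact: (@normcN R). Qed.

Lemma ncB x y : nc (x - y) <= nc x + nc y.
Proof. by rewrite -[nc y]ncN ncD. Qed.

Lemma ncBC x y : nc (x - y) = nc (y - x).
Proof. by rewrite -ncN opprB. Qed.

Lemma nc_eq0 x : (nc x == 0) = (x == 0).
Proof. by apply/eqP/eqP => [/Normc.eq0_normc|->]; rewrite ?nc0. Qed.

Lemma nc_gt0 x : (0 < nc x) = (x != 0).
Proof. by rewrite lt_def nc_ge0 andbT nc_eq0. Qed.

Lemma nc_sum (T : Type) (r : seq T) (P : pred T) (F : T -> R[i]) :
  nc (\sum_(i <- r | P i) F i) <= \sum_(i <- r | P i) nc (F i).
Proof.
elim/big_rec2: _ => [|i y z _ le]; first by rewrite nc0.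
by rewrite (le_trans (ncD _ _)) ?lerD2l.
Qed.

Lemma nc_real (a : R) : nc (a%:C%C) = `|a|.
Proof. by rewrite /= expr0n addr0 sqrtr_sqr. Qed.

Lemma nc_nat n : nc (n%:R : R[i]) = n%:R.
Proof. by rewrite -(rmorph_nat (real_complex R)) nc_real normr_nat. Qed.

Lemma nc_ReIm x : nc x <= `|Re x| + `|Im x|.
Proof.
case: x => a b /=; have h : 0 <= `|a| + `|b| by rewrite addr_ge0.
rewrite -(ger0_norm h) -(sqrtr_sqr (`|a| + `|b|)) ler_wsqrtr //.
rewrite sqrrD !real_normK ?num_real // lerD2r lerDl mulrn_wge0 // mulr_ge0 //.
Qed.

Lemma ReD x y : Re (x + y) = Re x + Re y. Proof. by case: x; case: y. Qed.
Lemma ImD x y : Im (x + y) = Im x + Im y. Proof. by case: x; case: y. Qed.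
Lemma ImN x : Im (- x) = - Im x. Proof. by case: x. Qed.

Lemma nc_Re x : `|Re x| <= nc x.
Proof. by case: x => a b /=; rewrite -sqrtr_sqr ler_wsqrtr // lerDl sqr_ge0. Qed.

Lemma nc_Im x : `|Im x| <= nc x.
Proof. by case: x => a b /=; rewrite -sqrtr_sqr ler_wsqrtr // lerDr sqr_ge0. Qed.

Lemma nc_sqr x : nc x ^+ 2 = Re x ^+ 2 + Im x ^+ 2.
Proof. by case: x => a b /=; rewrite sqr_sqrtr // addr_ge0 ?sqr_ge0. Qed.

End ComplexNorm.

Section UnconditionalSums.
Variable R : realType.
Local Notation C := R[i].

(** Convergence along the finite subsets of the index type: no order is chosen, so regrouping and
    reindexing are available over [nat], [int] and lattices alike. *)
Definition has_sum (T : choiceType) (f : T -> C) (s : C) :=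
  forall e : R, 0 < e -> exists A : {fset T}, forall B : {fset T},
    (A `<=` B)%fset -> nc (\sum_(x <- B) f x - s) < e.

Definition sums_le (T : choiceType) (u : T -> R) (M : R) :=
  forall A : {fset T}, \sum_(x <- A) u x <= M.

Lemma has_sum_uniq (T : choiceType) (f : T -> C) s t :
  has_sum f s -> has_sum f t -> s = t.
Proof.
move=> hs ht; apply/eqP; rewrite -subr_eq0 -nc_eq0 eq_le nc_ge0 andbT.
apply/ler_addgt0Pl => e e0; rewrite addr0.
have e2 : 0 < e / 2 by rewrite divr_gt0.
have [A hA] := hs _ e2; have [B hB] := ht _ e2.
have h1 := hA _ (fsubsetUl A B); have h2 := hB _ (fsubsetUr A B).
have -> : s - t = (\sum_(x <- (A `|` B)%fset) f x - t) - (\sum_(x <- (A `|` B)%fset) f x - s) by ring.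
by rewrite (le_trans (ncB _ _)) // (splitr e) lerD ?ltW.
Qed.

Lemma has_sumD (T : choiceType) (f g : T -> C) s t :
  has_sum f s -> has_sum g t -> has_sum (fun x => f x + g x) (s + t).
Proof.
move=> hs ht e e0; have e2 : 0 < e / 2 by rewrite divr_gt0.
have [A hA] := hs _ e2; have [B hB] := ht _ e2.
exists (A `|` B)%fset => D; rewrite fsubUset => /andP[AD BD].
rewrite big_split /= opprD addrACA (le_lt_trans (ncD _ _)) // (splitr e).
by rewrite ltrD ?hA ?hB.
Qed.

Lemma has_sumZ (T : choiceType) (f : T -> C) s c :
  has_sum f s -> has_sum (fun x => c * f x) (c * s).
Proof.
move=> hs e e0.
have c0 : 0 < nc c + 1 by rewrite ltr_wpDl ?nc_ge0.
have [A hA] := hs _ (divr_gt0 e0 c0); exists A => B /hA h.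
rewrite -mulr_sumr -mulrBr ncM.
rewrite (le_lt_trans (ler_wpM2r (nc_ge0 _) (_ : _ <= nc c + 1))) ?lerDl //.
by rewrite -ltr_pdivlMl // mulrC.
Qed.

Lemma eq_has_sum (T : choiceType) (f g : T -> C) s :
  f =1 g -> has_sum f s -> has_sum g s.
Proof.
move=> fg h e e0; have [A hA] := h e e0; exists A => B /hA.
by rewrite (eq_bigr _ (fun x _ => fg x)).
Qed.

Lemma has_sum_fin (T : choiceType) (f : T -> C) (A : {fset T}) :
  (forall x, x \notin A -> f x = 0) -> has_sum f (\sum_(x <- A) f x).
Proof.
move=> h0 e e0; exists A => B AB.
by rewrite -(big_fset_incl _ AB) ?subrr ?nc0 // => x _ /h0.
Qed.

Lemma has_sum1 (T : choiceType) (f : T -> C) (t : T) :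
  (forall x, x != t -> f x = 0) -> has_sum f (f t).
Proof.
move=> h; have := @has_sum_fin T f [fset t]%fset; rewrite big_seq_fset1; apply.
by move=> x; rewrite inE => /h.
Qed.

Lemma sum_avg (U : Type) (B : seq U) (e : R) : 0 <= e ->
  \sum_(u <- B) (e / (size B).+1%:R) <= e.
Proof.
move=> e0; rewrite big_const_seq count_predT iter_addr_0 -[leLHS]mulr_natr -mulrA.
by rewrite ler_piMr // mulrC ler_pdivrMr // mul1r ler_nat.
Qed.

(** Regrouping along the fibres of [h]; reindexing and Cauchy products come from it. Given a finite
    [B], half of [e] is shared among its fibres, which are all summed over one common finite set
    [Z]. *)
Lemma has_sum_fiber (T U : choiceType) (f : T -> C) (h : T -> U) (g : U -> C) s :
  has_sum f s ->
  (forall u, has_sum (fun x => if h x == u then f x else 0) (g u)) ->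
  has_sum g s.
Proof.
move=> hf hg e e0; have e2 : 0 < e / 2 by rewrite divr_gt0.
have [A hA] := hf _ e2.
exists [fset h x | x in A]%fset => B AB.
pose d := e / 2 / (size B).+1%:R.
have d0 : 0 < d by rewrite divr_gt0.
have [D hD] := choice (fun u => hg u d d0).
pose Z := (A `|` \bigcup_(u <- B) D u)%fset.
pose ZB := [fset x in Z | h x \in B]%fset.
have AZ : (A `<=` ZB)%fset.
  apply/fsubsetP => x xA; rewrite !inE /= xA /=.
  by apply: (fsubsetP AB); apply: in_imfset.
have EQ : \sum_(u <- B) \sum_(x <- Z) (if h x == u then f x else 0) =
          \sum_(x <- ZB) f x.
  rewrite exchange_big /= [RHS]big_fset /=.
  rewrite (eq_bigr (fun x => if h x \in B then f x else 0)) => [|x _].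
    by rewrite -big_mkcond.
  case: ifPn => [hB|hB].
    rewrite (big_fsetD1 (h x)) //= eqxx big1_seq ?addr0 // => u.
    by rewrite !inE => /andP[_ /andP[/negPf]]; rewrite eq_sym => ->.
  rewrite big1_seq // => u /andP[_ uB]; case: eqP => // E.
  by rewrite E uB in hB.
have -> : \sum_(u <- B) g u - s =
   (\sum_(x <- ZB) f x - s) - \sum_(u <- B) (\sum_(x <- Z) (if h x == u then f x else 0) - g u).
  by rewrite sumrB EQ; ring.
rewrite (le_lt_trans (ncB _ _)) // (splitr e) ltr_leD ?hA //.
rewrite (le_trans (nc_sum _ _ _)) //.
apply: (@le_trans _ _ (\sum_(u <- B) d)).
  rewrite big_seq [leRHS]big_seq ler_sum // => u uB; apply/ltW/hD.
  by rewrite fsubsetU // bigfcup_sup ?orbT.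
exact: sum_avg (ltW e2).
Qed.

Lemma has_sum_push (T U : choiceType) (g : U -> C) (h : T -> U) s :
  injective h -> (forall u, g u != 0 -> exists t, h t = u) ->
  has_sum (g \o h) s -> has_sum g s.
Proof.
move=> hi hs hg; apply: (has_sum_fiber hg) => u.
have [/hs [t <-]|] := boolP (g u != 0).
  have := @has_sum1 T (fun x => if h x == h t then (g \o h) x else 0) t.
  by rewrite eqxx /=; apply=> x xt; rewrite (inj_eq hi) (negPf xt).
rewrite negbK => /eqP gu; rewrite gu.
apply: (@eq_has_sum _ (fun=> 0)).
  by move=> x /=; case: eqP => // ->.
have := @has_sum_fin T (fun=> 0) fset0; rewrite big_seq_fset0; exact.
Qed.

Lemma has_sum_le (T : choiceType) (f : T -> C) s M :
  has_sum f s -> sums_le (fun x => nc (f x)) M -> nc s <= M.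
Proof.
move=> hs hM; apply/ler_addgt0Pl => e e0; have [A hA] := hs e e0.
have -> : s = \sum_(x <- A) f x - (\sum_(x <- A) f x - s) by ring.
rewrite (le_trans (ncB _ _)) // addrC lerD ?(ltW (hA _ _)) //.
by rewrite (le_trans (nc_sum _ _ _)).
Qed.

Lemma sums_le_cmp (T : choiceType) (u v : T -> R) M :
  (forall x, u x <= v x) -> sums_le v M -> sums_le u M.
Proof. by move=> uv hv A; rewrite (le_trans _ (hv A)) // ler_sum. Qed.

Lemma sums_leZ (T : choiceType) (u : T -> R) M c :
  0 <= c -> sums_le u M -> sums_le (fun x => c * u x) (c * M).
Proof. by move=> c0 h A; rewrite -mulr_sumr ler_wpM2l. Qed.

Lemma sums_leD (T : choiceType) (u v : T -> R) M N :
  sums_le u M -> sums_le v N -> sums_le (fun x => u x + v x) (M + N).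
Proof. by move=> h k A; rewrite big_split lerD. Qed.

Lemma sums_le_nat (u : nat -> R) M :
  (forall n, 0 <= u n) -> (forall n, \sum_(i < n) u i <= M) -> sums_le u M.
Proof.
move=> u0 h A.
pose n := (\max_(i <- A) i).+1.
rewrite (le_trans _ (h n)) // -(big_mkord predT).
have sub : {subset A <= iota 0 n}.
  move=> x xA; rewrite mem_iota /= add0n ltnS.
  by apply: (leq_bigmax_seq (F := id)).
rewrite /index_iota subn0; move: (iota_uniq 0 n) sub; move: (iota 0 n) => r ur sub.
have sub' : {subset enum_fset A <= r} := sub.
have us : uniq (enum_fset A) := fset_uniq A.
rewrite [leRHS](perm_big (enum_fset A ++ [seq x <- r | x \notin enum_fset A])) /=.
  by rewrite big_cat /= lerDl sumr_ge0.
apply: uniq_perm; rewrite ?cat_uniq ?us ?filter_uniq //=.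
  by rewrite andbT; apply/hasPn => x; rewrite mem_filter /= => /andP[].
move=> x; rewrite mem_cat mem_filter /=.
by case: (boolP (x \in enum_fset A)) => [/sub' ->|].
Qed.

Lemma geo_sum_le (r : R) n : 0 <= r -> r < 1 -> \sum_(i < n) r ^+ i <= (1 - r)^-1.
Proof.
move=> r0 r1.
rewrite -(@ler_pM2l _ (1 - r)) ?subr_gt0 // divff ?subr_eq0 ?gt_eqF //.
have := subrX1 r n; rewrite -[r - 1]opprB -[_ ^+ n - 1]opprB mulNr => /oppr_inj <-.
by rewrite gerBl exprn_ge0.
Qed.

Lemma sums_le_geo (r : R) : 0 <= r -> r < 1 -> sums_le (fun n : nat => r ^+ n) (1 - r)^-1.
Proof.
by move=> r0 r1; apply: sums_le_nat => n; [apply: exprn_ge0|apply: geo_sum_le].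
Qed.

Lemma sums_le_prod (T U : choiceType) (u : T -> R) (v : U -> R) M N :
  (forall x, 0 <= u x) -> (forall x, 0 <= v x) -> 0 <= N ->
  sums_le u M -> sums_le v N -> sums_le (fun z : T * U => u z.1 * v z.2) (M * N).
Proof.
move=> u0 v0 N0 hu hv A.
pose A1 := [fset z.1 | z in A]%fset; pose A2 := [fset z.2 | z in A]%fset.
have sub : (A `<=` A1 `*` A2)%fset.
  apply/fsubsetP => z zA; rewrite in_fsetM; apply/andP; split; exact: in_imfset.
have le1 : \sum_(z <- A) u z.1 * v z.2 <= \sum_(z <- (A1 `*` A2)%fset) u z.1 * v z.2.
  have -> : \sum_(z <- A) u z.1 * v z.2 =
     \sum_(z <- (A1 `*` A2)%fset) (if z \in A then u z.1 * v z.2 else 0).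
    rewrite -[RHS](big_fset_incl _ sub) /=; last by move=> z _ /negPf ->.
    by rewrite big_seq [RHS]big_seq; apply: eq_bigr => z ->.
  by rewrite ler_sum // => z _; case: ifP => // _; rewrite mulr_ge0.
rewrite (le_trans le1) //.
have -> : \sum_(z <- (A1 `*` A2)%fset) u z.1 * v z.2 =
          (\sum_(x <- A1) u x) * (\sum_(y <- A2) v y).
  rewrite mulr_suml [LHS]big_imfset2 /=; last by move=> [? ?] [? ?] _ _ /= [-> ->].
  by apply: eq_bigr => x _; rewrite mulr_sumr.
by rewrite ler_pM ?sumr_ge0.
Qed.

Lemma nneg_sup (T : choiceType) (u : T -> R) M :
  (forall x, 0 <= u x) -> sums_le u M ->
  exists s, forall e, 0 < e -> exists A : {fset T}, forall B : {fset T},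
    (A `<=` B)%fset -> `|\sum_(x <- B) u x - s| < e.
Proof.
move=> u0 hM; pose E := [set r | exists A : {fset T}, r = \sum_(x <- A) u x]%classic.
have hE : has_sup E.
  split; first by exists (\sum_(x <- fset0) u x); exists fset0.
  by exists M => _ [A ->].
exists (sup E) => e e0; have [_ [A ->] hA] := sup_adherent e0 hE.
exists A => B AB.
have le1 : \sum_(x <- A) u x <= \sum_(x <- B) u x.
  have -> : \sum_(x <- A) u x = \sum_(x <- B) (if x \in A then u x else 0).
    rewrite -[RHS](big_fset_incl _ AB) /=; last by move=> z _ /negPf ->.
    by rewrite big_seq [RHS]big_seq; apply: eq_bigr => z ->.
  by rewrite ler_sum // => x _; case: ifP.
have le2 : \sum_(x <- B) u x <= sup E by apply: ub_le_sup; [case: hE|exists B].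
rewrite ltr_norml (lt_le_trans _ (_ : \sum_(x <- A) u x - sup E <= _)) ?lerB //.
  by rewrite (le_lt_trans _ e0) // subr_le0.
by rewrite ltrBrDl -[_ + - e]/(_ - e).
Qed.

(** A real family is the difference of [|a| + a] and [|a|], two nonnegative families with bounded
    partial sums; the complex case follows through real and imaginary parts. *)
Lemma has_sum_ex (T : choiceType) (f : T -> C) M :
  sums_le (fun x => nc (f x)) M -> exists s, has_sum f s.
Proof.
move=> hM.
have real (a : T -> R) : (forall x, `|a x| <= nc (f x)) ->
  exists s, has_sum (fun x => (a x)%:C%C) s%:C%C.
  move=> ha.
  have h1 : sums_le (fun x => `|a x|) M by apply: sums_le_cmp hM.
  have [s hs] := nneg_sup (fun x => normr_ge0 (a x)) h1.
  have h2 : sums_le (fun x => `|a x| + a x) (M + M).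
    by apply: sums_leD => // A; rewrite (le_trans _ (h1 A)) // ler_sum // => x _; rewrite ler_norm.
  have [|t ht] := nneg_sup _ h2.
    by move=> x; rewrite -lerBlDr sub0r lerNl; have := lerNnormlW (lexx `|a x|).
  exists (t - s) => e e0; have e2 : 0 < e / 2 by rewrite divr_gt0.
  have [A hA] := hs _ e2; have [B hB] := ht _ e2.
  exists (A `|` B)%fset => D; rewrite fsubUset => /andP[AD BD].
  rewrite -rmorph_sum -rmorphB nc_real.
  have -> : \sum_(x <- D) a x - (t - s) = (\sum_(x <- D) (`|a x| + a x) - t) - (\sum_(x <- D) `|a x| - s).
    by rewrite big_split /=; ring.
  by rewrite (le_lt_trans (ler_normB _ _)) // (splitr e) ltrD ?hA ?hB.
have [s hs] := real _ (fun x => nc_Re (f x)).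
have [t ht] := real _ (fun x => nc_Im (f x)).
exists (s%:C%C + 'i%C * t%:C%C).
apply: eq_has_sum (has_sumD hs (has_sumZ 'i%C ht)) => x /=.
by rewrite -complexE.
Qed.

Definition csum (T : choiceType) (f : T -> C) : C :=
  if pselect (exists s, has_sum f s) is left h then projT1 (cid h) else 0.

Lemma csumP (T : choiceType) (f : T -> C) s : has_sum f s -> csum f = s.
Proof.
rewrite /csum; case: pselect => [h|h] hs; last by case: h; exists s.
exact: has_sum_uniq (projT2 (cid h)) hs.
Qed.

Lemma csum_has (T : choiceType) (f : T -> C) M :
  sums_le (fun x => nc (f x)) M -> has_sum f (csum f).
Proof. by move=> /has_sum_ex[s hs]; rewrite (csumP hs). Qed.

Definition clim (u : nat -> C) (l : C) :=
  forall e : R, 0 < e -> exists N, forall n, (N <= n)%N -> nc (u n - l) < e.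

(** Dominated convergence: one finite [D] carries the majorant up to [e / 4], uniformly in [n], and
    pointwise convergence is used on [D] only. *)
Lemma tannery (T : choiceType) (f : nat -> T -> C) (g : T -> C) (u : T -> R) M
   (s : nat -> C) (l : C) :
  (forall n x, nc (f n x) <= u x) -> sums_le u M ->
  (forall x, clim (f^~ x) (g x)) ->
  (forall n, has_sum (f n) (s n)) -> has_sum g l -> clim s l.
Proof.
move=> fu hu fg hs hg e e0.
have e4 : 0 < e / 4 by rewrite divr_gt0.
have u0 x : 0 <= u x by rewrite (le_trans (nc_ge0 (f 0%N x))).
have [S hS] := nneg_sup u0 hu.
have [A hA] := hS _ (divr_gt0 e4 (ltr0n _ 2)); have [A' hA'] := hg _ e4.
pose D := (A `|` A')%fset.
pose d := e / 4 / (size D).+1%:R.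
have d0 : 0 < d by rewrite divr_gt0.
have [N hN] := choice (fun x => fg x d d0).
exists (\max_(x <- D) N x)%N => n nN.
have tail (B : {fset T}) : (D `<=` B)%fset ->
  nc (\sum_(x <- B) f n x - \sum_(x <- D) f n x) < e / 4.
  move=> DB.
  have sp (K : zmodType) (F : T -> K) : \sum_(x <- B) F x = \sum_(x <- D) F x + \sum_(x <- (B `\` D)%fset) F x.
    rewrite (big_fsetID _ (mem D)) /=; congr (_ + _); apply: eq_fbigl => x; rewrite !inE /=.
      by rewrite andb_idl // => xD; apply: (fsubsetP DB); rewrite !inE.
    by rewrite andbC.
  rewrite sp addrC addKr (le_lt_trans (nc_sum _ _ _)) //.
  apply: (@le_lt_trans _ _ (\sum_(x <- (B `\` D)%fset) u x)); first by rewrite ler_sum.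
  have -> : \sum_(x <- (B `\` D)%fset) u x = (\sum_(x <- B) u x - S) - (\sum_(x <- D) u x - S).
    by rewrite (sp _ u); ring.
  have AD : (A `<=` D)%fset by apply: fsubsetUl.
  have h1 := hA _ (fsubset_trans AD DB); have h2 := hA _ AD.
  rewrite (le_lt_trans (ler_norm _)) // (le_lt_trans (ler_normB _ _)) //.
  by rewrite (splitr (e / 4)) ltrD.
have h1 : nc (s n - \sum_(x <- D) f n x) <= e / 4.
  have [B hB] := hs n _ e4.
  apply/ler_addgt0Pl => e' e'0; have [B' hB'] := hs n _ e'0.
  have hh := hB' _ (fsubsetUl B' D); have hh' := tail _ (fsubsetUr B' D).
  have -> : s n - \sum_(x <- D) f n x = (\sum_(x <- (B' `|` D)%fset) f n x - \sum_(x <- D) f n x) -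
     (\sum_(x <- (B' `|` D)%fset) f n x - s n) by ring.
  by rewrite (le_trans (ncB _ _)) // addrC lerD // ltW.
have h2 : nc (\sum_(x <- D) f n x - \sum_(x <- D) g x) <= e / 4.
  rewrite -sumrB (le_trans (nc_sum _ _ _)) //.
  apply: (@le_trans _ _ (\sum_(x <- D) d)).
    rewrite big_seq [leRHS]big_seq ler_sum // => x xD; apply/ltW/hN.
    by rewrite (leq_trans _ nN) // (leq_bigmax_seq (F := N)).
  exact: sum_avg (ltW e4).
have h3 := hA' _ (fsubsetUr A A').
have -> : s n - l = (s n - \sum_(x <- D) f n x) + ((\sum_(x <- D) f n x - \sum_(x <- D) g x) +
   (\sum_(x <- D) g x - l)) by ring.
rewrite (le_lt_trans (ncD _ _)) //.
apply: (@le_lt_trans _ _ (e / 4 + (e / 4 + e / 4))); last lra.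
by rewrite lerD // (le_trans (ncD _ _)) // lerD // ltW.
Qed.

End UnconditionalSums.

(** * Formal power series *)

Record fps (k : Type) := FPS { fcoef :> nat -> k }.

Lemma fpsP (k : Type) (f g : fps k) : (forall n, f n = g n) <-> f = g.
Proof.
split=> [|->//]; case: f => f; case: g => g /= h.
by congr FPS; apply: funext.
Qed.

HB.instance Definition _ (k : Type) := gen_eqMixin (fps k).
HB.instance Definition _ (k : Type) := gen_choiceMixin (fps k).

Section FpsRing.
Variable k : comNzRingType.
Implicit Types f g h : fps k.

Definition fps_add f g := FPS (fun n => f n + g n).
Definition fps_opp f := FPS (fun n => - f n).
Definition fps_const (c : k) := FPS (fun n => if n == 0%N then c else 0).
Definition fps_mul := locked (fun f g => FPS (fun n => \sum_(i < n.+1) f i * g (n - i)%N)).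

Lemma fps_mul_coef f g n : fps_mul f g n = \sum_(i < n.+1) f i * g (n - i)%N.
Proof. by rewrite /fps_mul -lock. Qed.

Definition fps_trunc n f : {poly k} := \poly_(i < n.+1) f i.

Lemma coef_fps_trunc n f i : (i <= n)%N -> (fps_trunc n f)`_i = f i.
Proof. by move=> i_n; rewrite coef_poly ltnS i_n. Qed.

Lemma coef_mul_eq (p q p' q' : {poly k}) n :
  (forall i, (i <= n)%N -> p`_i = p'`_i) -> (forall i, (i <= n)%N -> q`_i = q'`_i) ->
  (p * q)`_n = (p' * q')`_n.
Proof.
move=> hp hq; rewrite !coefM; apply: eq_bigr => i _.
by rewrite hp ?hq ?leq_subr // -ltnS.
Qed.

Lemma fps_mulE f g n m : (n <= m)%N ->
  fps_mul f g n = (fps_trunc m f * fps_trunc m g)`_n.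
Proof.
move=> nm; rewrite fps_mul_coef coefM; apply: eq_bigr => i _.
by rewrite !coef_fps_trunc // (leq_trans _ nm) ?leq_subr // -ltnS.
Qed.

Lemma fps_addA : associative fps_add.
Proof. by move=> f g h; apply/fpsP => n /=; rewrite addrA. Qed.
Lemma fps_addC : commutative fps_add.
Proof. by move=> f g; apply/fpsP => n /=; rewrite addrC. Qed.
Lemma fps_add0 : left_id (fps_const 0) fps_add.
Proof. by move=> f; apply/fpsP => n /=; rewrite if_same add0r. Qed.
Lemma fps_addN : left_inverse (fps_const 0) fps_opp fps_add.
Proof. by move=> f; apply/fpsP => n /=; rewrite if_same addNr. Qed.

HB.instance Definition _ :=
  GRing.isZmodule.Build (fps k) fps_addA fps_addC fps_add0 fps_addN.

Lemma fps_mulC : commutative fps_mul.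
Proof. by move=> f g; apply/fpsP => n; rewrite !(@fps_mulE _ _ n n) // mulrC. Qed.

Lemma fps_mulA : associative fps_mul.
Proof.
move=> f g h; apply/fpsP => n.
rewrite (@fps_mulE f _ n n) // (@fps_mulE _ h n n) //.
transitivity ((fps_trunc n f * (fps_trunc n g * fps_trunc n h))`_n).
  apply: coef_mul_eq => // i i_n.
  by rewrite coef_fps_trunc // (@fps_mulE _ _ i n).
rewrite mulrA; apply: coef_mul_eq => // i i_n.
by rewrite coef_fps_trunc // (@fps_mulE _ _ i n).
Qed.

Lemma fps_mul1 : left_id (fps_const 1) fps_mul.
Proof.
move=> f; apply/fpsP => n; rewrite fps_mul_coef /=.
by rewrite big_ord_recl /= mul1r subn0 big1 ?addr0 // => i _; rewrite mul0r.
Qed.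

Lemma fps_mulDl : left_distributive fps_mul fps_add.
Proof.
move=> f g h; apply/fpsP => n; rewrite /= !fps_mul_coef.
by rewrite -big_split; apply: eq_bigr => i _; rewrite /= mulrDl.
Qed.

Lemma fps_1neq0 : fps_const 1 != 0.
Proof. by apply/eqP => /fpsP /(_ 0%N) /eqP; rewrite /= oner_eq0. Qed.

HB.instance Definition _ :=
  GRing.Zmodule_isComNzRing.Build (fps k) fps_mulA fps_mulC fps_mul1 fps_mulDl fps_1neq0.

Lemma fps0E n : (0 : fps k) n = 0. Proof. exact: if_same. Qed.
Lemma fps1E n : (1 : fps k) n = (n == 0%N)%:R. Proof. by rewrite /=; case: eqP. Qed.
Lemma fpsDE f g n : (f + g) n = f n + g n. Proof. by []. Qed.
Lemma fpsNE f n : (- f) n = - f n. Proof. by []. Qed.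
Lemma fpsBE f g n : (f - g) n = f n - g n. Proof. by []. Qed.
Lemma fpsME f g n : (f * g) n = \sum_(i < n.+1) f i * g (n - i)%N. Proof. exact: fps_mul_coef. Qed.
Lemma fpsM0 f g : (f * g) 0%N = f 0%N * g 0%N.
Proof. by rewrite fpsME big_ord_recl big_ord0 addr0. Qed.
Lemma fpsX0 f m : (f ^+ m) 0%N = f 0%N ^+ m.
Proof. by elim: m => [|m IH]; rewrite ?expr0 // !exprS fpsM0 IH. Qed.
Lemma fps_sumE (I : Type) (r : seq I) (P : pred I) (F : I -> fps k) n :
  (\sum_(i <- r | P i) F i) n = \sum_(i <- r | P i) F i n.
Proof. by elim/big_rec2: _ => [|i y z _ <-]; rewrite ?fps0E. Qed.

Lemma fps_const_is_zmod : zmod_morphism fps_const.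
Proof. by move=> a b; apply/fpsP => n; rewrite fpsBE /=; case: eqP; rewrite ?subr0. Qed.
Lemma fps_const_is_monoid : monoid_morphism fps_const.
Proof.
split=> // a b; apply/fpsP => n; rewrite fpsME big_ord_recl subn0 /=.
rewrite big1 ?addr0; first by case: eqP => //; rewrite mulr0.
by move=> i _; rewrite mul0r.
Qed.
HB.instance Definition _ := GRing.isZmodMorphism.Build k (fps k) fps_const fps_const_is_zmod.
HB.instance Definition _ := GRing.isMonoidMorphism.Build k (fps k) fps_const fps_const_is_monoid.

Lemma fps_constM c f n : (fps_const c * f) n = c * f n.
Proof.
rewrite fpsME big_ord_recl /= subn0 big1 ?addr0 // => i _; exact: mul0r.
Qed.

Definition fps_X (i : nat) : fps k := FPS (fun n => (n == i)%:R).

Lemma fps_XM i f n : (fps_X i * f) n = if (i <= n)%N then f (n - i)%N else 0.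
Proof.
rewrite fpsME; case: leqP => i_n.
  have i_n1 : (i < n.+1)%N by [].
  rewrite (bigD1 (Ordinal i_n1)) //= eqxx mul1r big1 ?addr0 // => j.
  by rewrite -val_eqE /= => /negPf ->; rewrite mul0r.
rewrite big1 // => j _ /=; case: eqP => [E|]; last by rewrite mul0r.
by have := ltn_ord j; rewrite E ltnS leqNgt i_n.
Qed.

Lemma fps_X0 : fps_X 0 = 1.
Proof. by apply/fpsP => n; rewrite fps1E. Qed.

Lemma fps_XD i j : fps_X i * fps_X j = fps_X (i + j).
Proof.
apply/fpsP => n; rewrite fps_XM /=; case: leqP => h.
  by rewrite -(eqn_add2l i) subnKC.
by case: eqP h => // ->; rewrite ltnNge leq_addr.
Qed.

Lemma fps_XX i n : fps_X i ^+ n = fps_X (i * n).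
Proof. by elim: n => [|n IH]; rewrite ?muln0 ?fps_X0 ?expr0 // exprS IH fps_XD mulnS. Qed.

Lemma fps_order0 f m n : f 0%N = 0 -> (n < m)%N -> (f ^+ m) n = 0.
Proof.
move=> f0; elim: m n => // m IH n; rewrite ltnS => n_m.
rewrite exprS fpsME big_ord_recl f0 mul0r add0r big1 // => i _.
rewrite IH ?mulr0 // /= (leq_trans _ n_m) // /bump add1n subnS prednK ?leq_subr //.
by rewrite subn_gt0.
Qed.

(** The geometric series in [1 - f]. When [f] has constant coefficient 1, the powers beyond the
    [n]-th do not reach coefficient [n], so the truncation is exact. *)
Definition fps_inv f : fps k := FPS (fun n => (\sum_(j < n.+1) (1 - f) ^+ j) n).

Lemma fps_invP f : f 0%N = 1 -> f * fps_inv f = 1.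
Proof.
move=> f0; apply/fpsP => n.
pose S := \sum_(j < n.+1) (1 - f) ^+ j.
have z : (1 - f) 0%N = 0 by rewrite fpsBE f0 subrr.
have -> : (f * fps_inv f) n = (f * S) n.
  rewrite !fpsME; apply: eq_bigr => i _; congr (_ * _).
  rewrite /S fps_sumE /= fps_sumE.
  rewrite (big_ord_widen n.+1 (fun j => ((1 - f) ^+ j) (n - i)%N)) ?ltnS ?leq_subr //.
  rewrite [RHS](bigID (fun j : 'I_n.+1 => (j < (n - i).+1)%N)) /=.
  rewrite [X in _ = _ + X]big1 ?addr0 // => j; rewrite -leqNgt => h.
  exact: fps_order0.
have -> : f * S = 1 - (1 - f) ^+ n.+1.
  have := subrX1 (1 - f) n.+1; rewrite -/S => E.
  by rewrite -opprB E -mulNr; congr (_ * S); ring.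
by rewrite fpsBE (fps_order0 z) // subr0.
Qed.

Lemma fps_inv0 f : f 0%N = 1 -> fps_inv f 0%N = 1.
Proof. by move=> f0; rewrite /= big_ord_recl big_ord0 addr0 expr0. Qed.

(** The series [f(X^p)]. *)
Definition fps_subst (p : nat) f : fps k :=
  FPS (fun n => if (p %| n)%N then f (n %/ p)%N else 0).

Lemma fps_subst_is_zmod p : zmod_morphism (fps_subst p).
Proof. by move=> f g; apply/fpsP => n; rewrite fpsBE /=; case: ifP; rewrite ?subr0. Qed.

HB.instance Definition _ p := GRing.isZmodMorphism.Build (fps k) (fps k) (fps_subst p)
  (fps_subst_is_zmod p).

Lemma fps_substM p f g : (0 < p)%N -> fps_subst p (f * g) = fps_subst p f * fps_subst p g.
Proof.
move=> p0; apply/fpsP => n.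
rewrite [RHS](@fps_mulE _ _ n n) //.
transitivity (((fps_trunc n f \Po 'X^p) * (fps_trunc n g \Po 'X^p))`_n).
  rewrite -comp_polyM coef_comp_poly_Xn //=; case: ifP => // pn.
  by rewrite -[LHS]/(fps_mul f g _) (@fps_mulE _ _ _ n) // leq_div.
apply: coef_mul_eq => i i_n; rewrite coef_comp_poly_Xn // [RHS]coef_fps_trunc //=;
  by case: ifP => // _; rewrite coef_fps_trunc // (leq_trans (leq_div _ _)).
Qed.

Lemma fps_subst1 p : (0 < p)%N -> fps_subst p 1 = 1.
Proof.
move=> p0; apply/fpsP => n; rewrite fps1E /=.
case: ifP => [/dvdnP[m ->]|]; last by case: n => //; rewrite dvdn0.
by rewrite mulnK // muln_eq0 orbC (gtn_eqF p0); case: eqP.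
Qed.

Lemma fps_substX p f m : (0 < p)%N -> fps_subst p (f ^+ m) = fps_subst p f ^+ m.
Proof. by move=> p0; elim: m => [|m IH]; rewrite ?fps_subst1 // !exprS fps_substM ?IH. Qed.

(** The [p]-sections [f_i], for which [f = sum_i X^i f_i(X^p)]. *)
Definition fps_sec (p i : nat) f : fps k := FPS (fun n => f (p * n + i)%N).

Lemma fps_secE p f : (0 < p)%N ->
  f = \sum_(i < p) fps_X i * fps_subst p (fps_sec p i f).
Proof.
move=> p0; apply/fpsP => n; rewrite fps_sumE.
have m_p : (n %% p < p)%N by rewrite ltn_mod.
rewrite (bigD1 (Ordinal m_p)) //= fps_XM leq_mod /=.
have E : (n - n %% p = n %/ p * p)%N by rewrite {1}(divn_eq n p) addnK.
rewrite E dvdn_mull // mulnK // mulnC -divn_eq big1 ?addr0 // => i.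
rewrite -val_eqE /= => i_n; rewrite fps_XM; case: leqP => // i_le /=.
case: ifP => // /dvdnP[m Em]; case/negP: i_n.
by rewrite -(subnK i_le) Em modnMDl modn_small.
Qed.

Lemma fps_sec_uniq p (a b : 'I_p -> fps k) : 
  \sum_(i < p) fps_X i * fps_subst p (a i) = \sum_(i < p) fps_X i * fps_subst p (b i) ->
  a =1 b.
Proof.
have main (c : 'I_p -> fps k) (j : 'I_p) n :
  (\sum_(i < p) fps_X i * fps_subst p (c i)) (p * n + j)%N = c j n.
  have p0 : (0 < p)%N by apply: leq_ltn_trans (ltn_ord j).
  rewrite fps_sumE (bigD1 j) //= fps_XM leq_addl addnK /= dvdn_mulr // mulKn //.
  rewrite big1 ?addr0 // => i; rewrite -val_eqE /= => ij.
  rewrite fps_XM; case: leqP => // i_le /=; case: ifP => // /dvdnP[m Em]; case/negP: ij.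
  have := congr1 (modn^~ p) (subnK i_le); rewrite Em /= modnMDl mulnC modnMDl.
  by rewrite !modn_small // => ->.
by move=> E j; apply/fpsP => n; rewrite -(main a) E main.
Qed.

(** The series [f(c X)]. *)
Definition fps_scale (c : k) f : fps k := FPS (fun n => c ^+ n * f n).

Lemma fps_scale_is_zmod c : zmod_morphism (fps_scale c).
Proof. by move=> f g; apply/fpsP => n; rewrite !fpsBE /= mulrBr. Qed.
Lemma fps_scale_is_monoid c : monoid_morphism (fps_scale c).
Proof.
split=> [|f g]; apply/fpsP => n.
  by rewrite fps1E /=; case: eqP => [->|]; rewrite ?expr0 ?mulr1 // mulr0.
rewrite [RHS]fpsME /= fpsME mulr_sumr; apply: eq_bigr => i _.
by rewrite mulrACA -exprD subnKC // -ltnS.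
Qed.
HB.instance Definition _ c := GRing.isZmodMorphism.Build (fps k) (fps k) (fps_scale c) (fps_scale_is_zmod c).
HB.instance Definition _ c := GRing.isMonoidMorphism.Build (fps k) (fps k) (fps_scale c) (fps_scale_is_monoid c).

End FpsRing.

Arguments fps_X {k} i.

Section FpsMap.
Variables (k k' : comNzRingType) (phi : {rmorphism k -> k'}).

Definition fps_map (f : fps k) : fps k' := FPS (fun n => phi (f n)).

Lemma fps_map_is_zmod : zmod_morphism fps_map.
Proof. by move=> f g; apply/fpsP => n; rewrite fpsBE /= rmorphB. Qed.
Lemma fps_map_is_monoid : monoid_morphism fps_map.
Proof.
split=> [|f g]; apply/fpsP => n; first by rewrite fps1E /=; case: eqP; rewrite ?rmorph1 ?rmorph0.
by rewrite [RHS]fpsME /= fpsME rmorph_sum; apply: eq_bigr => i _; rewrite rmorphM.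
Qed.
HB.instance Definition _ := GRing.isZmodMorphism.Build (fps k) (fps k') fps_map fps_map_is_zmod.
HB.instance Definition _ := GRing.isMonoidMorphism.Build (fps k) (fps k') fps_map fps_map_is_monoid.

Lemma fps_map_X i : fps_map (fps_X i) = fps_X i.
Proof. by apply/fpsP => n /=; rewrite rmorph_nat. Qed.
Lemma fps_map_subst p f : fps_map (fps_subst p f) = fps_subst p (fps_map f).
Proof. by apply/fpsP => n /=; case: ifP; rewrite ?rmorph0. Qed.
Lemma fps_map_const c : fps_map (fps_const c) = fps_const (phi c).
Proof. by apply/fpsP => n /=; case: ifP; rewrite ?rmorph0. Qed.
Lemma fps_map_sec p i f : fps_map (fps_sec p i f) = fps_sec p i (fps_map f).
Proof. by apply/fpsP => n. Qed.

End FpsMap.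

Section FpsDomain.
Variable k : idomainType.
Implicit Types f g : fps k.

Lemma fps_mul_eq0 f g : f * g = 0 -> f = 0 \/ g = 0.
Proof.
have low (h : fps k) : h <> 0 -> exists2 n, h n != 0 & forall m, (m < n)%N -> h m = 0.
  move=> h0; have ex : exists n, h n != 0.
    apply: contrapT => /forallNP H; apply: h0; apply/fpsP => n; rewrite fps0E.
    by have /negP := H n; rewrite negbK => /eqP.
  case: (ex_minnP ex) => n hn mn; exists n => // m m_n; apply/eqP.
  by apply: contraTT m_n => /mn; rewrite -leqNgt.
move=> fg; apply: contrapT => /not_orP[/low[i fi li] /low[j gj lj]].
have /fpsP/(_ (i + j)%N) := fg; rewrite fps0E fpsME.
have ij : (i < (i + j).+1)%N by rewrite ltnS leq_addr.
rewrite (bigD1 (Ordinal ij)) //= addKn big1 ?addr0.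
  by move/eqP; rewrite mulf_eq0 (negPf fi) (negPf gj).
move=> m; rewrite -val_eqE /= neq_ltn => /orP[/li -> //|im]; first by rewrite mul0r.
rewrite lj ?mulr0 // ltn_subLR; last by rewrite -ltnS.
by rewrite ltn_add2r.
Qed.

Lemma fps_mulI f g h : f <> 0 -> f * g = f * h -> g = h.
Proof.
move=> f0 E; have /fps_mul_eq0[//|/eqP] : f * (g - h) = 0 by rewrite mulrBr E subrr.
by rewrite subr_eq0 => /eqP.
Qed.
End FpsDomain.

(** Frobenius is additive on polynomials and fixes the elements of [F_p]; a coefficient of [f ^+ p]
    only sees a truncation of [f]. *)
Lemma fps_Frobenius (p : nat) (F : finFieldType) (f : fps F) :
  prime p -> #|F| = p -> f ^+ p = fps_subst p f.
Proof.
move=> pp cF.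
have pch : p \in [pchar F] by apply: (@card_finPcharP F p 1); rewrite ?expn1.
have pchP : p \in [pchar {poly F}] by rewrite pchar_poly.
have p0 := prime_gt0 pp.
have fp (a : F) : a ^+ p = a by rewrite -cF expf_card.
apply/fpsP => n; have tr m : (f ^+ m) n = (fps_trunc n f ^+ m)`_n.
  have H j : (j <= n)%N -> (f ^+ m) j = (fps_trunc n f ^+ m)`_j.
    elim: m j => [|m IH] j jn; first by rewrite !expr0 fps1E coef1.
    rewrite !exprS -[LHS]/(fps_mul f (f ^+ m) j) (@fps_mulE _ _ _ j j) //.
    apply: coef_mul_eq => i ij; rewrite !coef_fps_trunc ?(leq_trans ij) //.
    by rewrite IH // (leq_trans ij).
  exact: H.
rewrite tr -(pFrobenius_autE pchP) /fps_trunc poly_def rmorph_sum /= coef_sum.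
under eq_bigr => i _ do rewrite pFrobenius_autE exprZn -exprM coefZ coefXn fp.
case: ifP => [/dvdnP[m Em]|pn].
  have mn : (m < n.+1)%N by rewrite Em ltnS leq_pmulr.
  have -> : (n %/ p = m)%N by rewrite Em mulnK.
  rewrite (bigD1 (Ordinal mn)) //= -Em eqxx mulr1 big1 ?addr0 // => i.
  rewrite -val_eqE /= => im; case: eqP => [E|]; last by rewrite mulr0.
  by case/negP: im; rewrite -(eqn_pmul2r p0) -E -Em.
rewrite big1 // => i _; case: eqP => [E|]; last by rewrite mulr0.
by rewrite E dvdn_mull in pn.
Qed.

(** * Power series converging in the unit disc *)

Section Evaluation.
Variable R : realType.
Local Notation C := R[i].
Implicit Types (f g : fps C) (q : C) (r : R).

Lemma has_sum_finT (T : finType) (f : T -> C) : has_sum f (\sum_x f x).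
Proof.
move=> e e0; exists [fset x in enum T]%fset => B AB.
rewrite big_uniq ?fset_uniq //= (eq_bigl xpredT) ?subrr ?nc0 // => x.
by apply: (fsubsetP AB); rewrite inE /= mem_enum.
Qed.

(** Radius of convergence at least 1, expressed by Cauchy bounds on the coefficients. Stability
    under products, sections and substitutions is then a matter of coefficients alone. *)
Definition tame f := forall r, 0 <= r -> r < 1 ->
  exists M, forall n, nc (f n) * r ^+ n <= M.

Lemma tame_pos f : (forall r, 0 < r -> r < 1 -> exists M, forall n, nc (f n) * r ^+ n <= M) ->
  tame f.
Proof.
move=> h r r0 r1; have h2 : (0 : R) < 1 / 2 by lra.
have [||M hM] := h (Num.max r (1 / 2)).
- by rewrite lt_max h2 orbT.
- by rewrite gt_max r1 /=; lra.
exists M => n; rewrite (le_trans _ (hM n)) // ler_wpM2l ?nc_ge0 //.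
by rewrite lerXn2r ?nnegrE // le_max ?r0 ?lexx.
Qed.

Lemma pow_lt1 r n : 0 <= r -> r < 1 -> (0 < n)%N -> r ^+ n < 1.
Proof. by move=> r0 r1 n0; rewrite exprn_ilt1 // -lt0n. Qed.

Lemma pow_lt1_mul r n : 0 <= r -> r < 1 -> n.+1%:R * r ^+ n <= (1 - r)^-1.
Proof.
move=> r0 r1.
apply: (le_trans _ (geo_sum_le n.+1 r0 r1)).
rewrite -[n.+1 in X in X <= _]card_ord mulr_natl -sumr_const ler_sum // => i _.
by rewrite ler_wiXn2l // ?ltW // -ltnS.
Qed.

Lemma tame_growth f k c : (forall n, nc (f n) <= c * n.+1%:R ^+ k) -> tame f.
Proof.
move=> h r r0 r1.
have [M hM] : exists M, forall n, n.+1%:R ^+ k * r ^+ n <= M.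
  elim: k r r0 r1 {h} => [|k IH] r r0 r1.
    by exists 1 => n; rewrite expr0 mul1r exprn_ile1 // ltW.
  (* Of the two factors [sqrt r ^+ n] of [r ^+ n], one absorbs a power of [n.+1] by [pow_lt1_mul],
     and the other is left to the induction. *)
  have s0 : 0 <= Num.sqrt r by apply: sqrtr_ge0.
  have s1 : Num.sqrt r < 1 by rewrite -sqrtr1 ltr_sqrt.
  have [M hM] := IH _ s0 s1.
  exists ((1 - Num.sqrt r)^-1 * M) => n.
  have -> : r ^+ n = Num.sqrt r ^+ n * Num.sqrt r ^+ n.
    by rewrite -exprMn -expr2 sqr_sqrtr.
  rewrite exprS mulrACA ler_pM ?pow_lt1_mul //; by rewrite mulr_ge0 ?exprn_ge0.
exists (c * M) => n.
have c0 : 0 <= c by have := h 0%N; rewrite expr1n mulr1; apply: le_trans; apply: nc_ge0.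
by rewrite (le_trans (ler_wpM2r _ (h n))) ?exprn_ge0 // -mulrA ler_wpM2l.
Qed.

Lemma tame_const c : tame (fps_const c).
Proof.
apply: (@tame_growth _ 0 (nc c)) => n; rewrite expr0 mulr1 /=.
by case: eqP => // _; rewrite nc0 nc_ge0.
Qed.

Lemma tame0 : tame 0. Proof. exact: tame_const 0. Qed.
Lemma tame1 : tame 1. Proof. exact: tame_const 1. Qed.

Lemma tame_X i : tame (fps_X i).
Proof.
apply: (@tame_growth _ 0 1) => n; rewrite expr0 mulr1 /= nc_nat.
by case: eqP => _; rewrite ?ler01.
Qed.

Lemma tameD f g : tame f -> tame g -> tame (f + g).
Proof.
move=> hf hg r r0 r1; have [M hM] := hf r r0 r1; have [N hN] := hg r r0 r1.
exists (M + N) => n; rewrite fpsDE (le_trans (ler_wpM2r _ (ncD _ _))) ?exprn_ge0 //.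
by rewrite mulrDl lerD.
Qed.

Lemma tameN f : tame f -> tame (- f).
Proof. by move=> hf r r0 r1; have [M hM] := hf r r0 r1; exists M => n; rewrite fpsNE ncN. Qed.

Lemma tameB f g : tame f -> tame g -> tame (f - g).
Proof. by move=> hf /tameN; apply: tameD. Qed.

Lemma mul_bound f g (M N r : R) : 0 <= r -> r < 1 ->
  (forall n, nc (f n) * r ^+ n <= M) -> (forall n, nc (g n) * r ^+ n <= N) ->
  forall s, 0 <= s -> s < r -> exists K, forall n, nc ((f * g) n) * s ^+ n <= K.
Proof.
move=> r0 r1 hM hN s s0 sr; have rp : 0 < r by apply: le_lt_trans sr.
exists ((1 - s / r)^-1 * (M * N)) => n.
have M0 : 0 <= M by rewrite (le_trans _ (hM 0%N)) ?mulr_ge0 ?nc_ge0 ?exprn_ge0.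
have N0 : 0 <= N by rewrite (le_trans _ (hN 0%N)) ?mulr_ge0 ?nc_ge0 ?exprn_ge0.
have h1 : nc ((f * g) n) * r ^+ n <= n.+1%:R * (M * N).
  rewrite fpsME (le_trans (ler_wpM2r _ (nc_sum _ _ _))) ?exprn_ge0 //.
  rewrite mulr_suml -[n.+1 in X in _ <= X]card_ord mulr_natl -sumr_const ler_sum // => i _.
  rewrite ncM -[n in r ^+ n](@subnKC i n) ?exprD -1?ltnS // mulrACA.
  by rewrite ler_pM // ?mulr_ge0 ?nc_ge0 ?exprn_ge0.
have -> : s ^+ n = r ^+ n * (s / r) ^+ n.
  by rewrite -exprMn mulrC divfK ?gt_eqF.
rewrite mulrA (le_trans (ler_wpM2r _ h1)) ?exprn_ge0 ?divr_ge0 //.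
rewrite mulrAC ler_wpM2r ?mulr_ge0 // pow_lt1_mul ?divr_ge0 //.
by rewrite ltr_pdivrMr ?mul1r.
Qed.

Lemma tameM f g : tame f -> tame g -> tame (f * g).
Proof.
move=> hf hg; apply: tame_pos => r r0 r1.
have [t [t0 t1 rt]] : exists t, [/\ 0 <= t, t < 1 & r < t] by exists ((1 + r) / 2); split; lra.
have [M hM] := hf t t0 t1; have [N hN] := hg t t0 t1.
exact: mul_bound t0 t1 hM hN r (ltW r0) rt.
Qed.

Lemma tameX f n : tame f -> tame (f ^+ n).
Proof. by move=> hf; elim: n => [|n IH]; [exact: tame1|rewrite exprS; apply: tameM]. Qed.

Lemma tame_sum (I : Type) (s : seq I) (P : pred I) (F : I -> fps C) :
  (forall i, P i -> tame (F i)) -> tame (\sum_(i <- s | P i) F i).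
Proof. by move=> h; elim/big_rec: _ => [|i y /h]; [exact: tame0|apply: tameD]. Qed.

Lemma tame_subst p f : (0 < p)%N -> tame f -> tame (fps_subst p f).
Proof.
move=> p0 hf r r0 r1; have [M hM] := hf _ (exprn_ge0 p r0) (pow_lt1 r0 r1 p0).
exists M => n /=; case: ifP => [/dvdnP[m ->]|_].
  by rewrite mulnK // mulnC exprM.
rewrite nc0 mul0r (le_trans _ (hM 0%N)) // mulr_ge0 ?nc_ge0 ?exprn_ge0 //.
Qed.

Lemma tame_scale c f : nc c <= 1 -> tame f -> tame (fps_scale c f).
Proof.
move=> c1 hf r r0 r1; have [M hM] := hf r r0 r1; exists M => n /=.
rewrite (le_trans _ (hM n)) // ler_wpM2r ?exprn_ge0 // ncM ncX.
by rewrite ler_piMl ?nc_ge0 // exprn_ile1 // nc_ge0.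
Qed.

(** Iterated square roots replace the [p]-th root: [t p] is [r^(1/2^p)], and [p <= 2^p]. *)
Lemma root_between p r : 0 < r -> r < 1 -> exists t, [/\ 0 < t, t < 1 & r <= t ^+ p].
Proof.
move=> r0 r1; pose t m := iter m Num.sqrt r.
have t0 m : 0 < t m by elim: m => //= m; rewrite -sqrtr_gt0.
have t1 m : t m < 1 by elim: m => //= m IH; rewrite -sqrtr1 ltr_sqrt.
have tE m : t m ^+ (2 ^ m) = r.
  elim: m => [|m IH]; first by rewrite expr1.
  by rewrite expnS exprM /= sqr_sqrtr // ltW.
exists (t p); split=> //; rewrite -[leLHS](tE p).
by apply: ler_wiXn2l (ltW (t0 p)) (ltW (t1 p)) _ _ (ltnW (ltn_expl _ _)).
Qed.

Lemma tame_sec p i f : (0 < p)%N -> tame f -> tame (fps_sec p i f).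
Proof.
move=> p0 hf; apply: tame_pos => r r0 r1.
have [t [t0 t1 rt]] := root_between p r0 r1.
have [M hM] := hf t (ltW t0) t1; exists (M / t ^+ i) => n /=.
rewrite ler_pdivlMr ?exprn_gt0 // (le_trans _ (hM (p * n + i)%N)) //.
rewrite exprD mulrA ler_wpM2r ?exprn_ge0 ?(ltW t0) // ler_wpM2l ?nc_ge0 //.
by rewrite exprM lerXn2r ?nnegrE ?exprn_ge0 ?(ltW t0) ?(ltW r0).
Qed.

Definition ev f q : C := csum (fun n => f n * q ^+ n).

Lemma ev_bound f q : tame f -> nc q < 1 ->
  exists2 M, 0 <= M & sums_le (fun n => nc (f n * q ^+ n)) M.
Proof.
move=> hf q1; pose t := (1 + nc q) / 2; have q0 := nc_ge0 q.
have t0 : 0 < t by rewrite /t; lra.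
have t1 : t < 1 by rewrite /t; lra.
have qt : nc q < t by rewrite /t; lra.
have [M hM] := hf t (ltW t0) t1.
have M0 : 0 <= M by rewrite (le_trans _ (hM 0%N)) ?mulr_ge0 ?nc_ge0 ?exprn_ge0 // ltW.
have z1 : nc q / t < 1 by rewrite ltr_pdivrMr ?mul1r.
have z0 : 0 <= nc q / t by rewrite divr_ge0 // ltW.
exists (M * (1 - nc q / t)^-1); first by rewrite mulr_ge0 // invr_ge0 subr_ge0 ltW.
apply: sums_le_cmp (sums_leZ M0 (sums_le_geo z0 z1)) => n.
have -> : nc (f n * q ^+ n) = (nc (f n) * t ^+ n) * (nc q / t) ^+ n.
  by rewrite -mulrA -exprMn mulrC [t * _]mulrC divfK ?gt_eqF // ncM ncX mulrC.
by rewrite ler_wpM2r ?exprn_ge0.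
Qed.

Lemma ev_has f q : tame f -> nc q < 1 -> has_sum (fun n => f n * q ^+ n) (ev f q).
Proof. by move=> hf q1; have [M _ hM] := ev_bound hf q1; apply: csum_has hM. Qed.

Lemma ev_eq f q s : has_sum (fun n => f n * q ^+ n) s -> ev f q = s.
Proof. exact: csumP. Qed.

Lemma evD f g q : tame f -> tame g -> nc q < 1 -> ev (f + g) q = ev f q + ev g q.
Proof.
move=> hf hg q1; apply: ev_eq.
apply: eq_has_sum (has_sumD (ev_has hf q1) (ev_has hg q1)) => n.
by rewrite fpsDE mulrDl.
Qed.

Lemma ev_const c q : ev (fps_const c) q = c.
Proof.
apply: ev_eq; have := @has_sum1 R _ (fun n => fps_const c n * q ^+ n) 0%N.
by rewrite /= expr0 mulr1; apply=> n /negPf ->; rewrite mul0r.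
Qed.

Lemma ev0 q : ev 0 q = 0. Proof. exact: ev_const. Qed.
Lemma ev1 q : ev 1 q = 1. Proof. exact: ev_const. Qed.

Lemma ev_X i q : ev (fps_X i) q = q ^+ i.
Proof.
apply: ev_eq; have := @has_sum1 R _ (fun n => (fps_X i : fps C) n * q ^+ n) i.
by rewrite /= eqxx mul1r; apply=> n /negPf ->; rewrite mul0r.
Qed.

(** The double family over [nat * nat] is summed twice: along the first index it gives the product
    of the values, along [i + j] the Cauchy product. *)
Lemma evM f g q : tame f -> tame g -> nc q < 1 -> ev (f * g) q = ev f q * ev g q.
Proof.
move=> hf hg q1.
have [M M0 hM] := ev_bound hf q1; have [N N0 hN] := ev_bound hg q1.
pose a n := f n * q ^+ n; pose b n := g n * q ^+ n.
pose F (z : nat * nat) := a z.1 * b z.2.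
have [s hs] : exists s, has_sum F s.
  apply: (@has_sum_ex _ _ _ (M * N)).
  apply: sums_le_cmp (sums_le_prod _ _ N0 hM hN) => [z|n|n]; rewrite ?nc_ge0 //.
  by rewrite ncM.
have sE : s = ev f q * ev g q.
  have h1 : has_sum (fun i => a i * ev g q) s.
    apply: (has_sum_fiber (h := fst) hs) => i.
    apply: (@has_sum_push _ _ _ _ (fun j : nat => (i, j))) => [x y []//|[u v]|].
      by rewrite /=; case: (u =P i) => [-> _|_]; [exists v|rewrite eqxx].
    apply: eq_has_sum (has_sumZ (a i) (ev_has hg q1)) => j.
    by rewrite /= eqxx.
  apply: has_sum_uniq h1 _.
  by rewrite mulrC; apply: eq_has_sum (has_sumZ (ev g q) (ev_has hf q1)) => n; rewrite mulrC.
rewrite -sE; apply: ev_eq; apply: (@has_sum_fiber _ _ _ _ (fun z : nat * nat => (z.1 + z.2)%N) _ _ hs) => n.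
apply: (@has_sum_push _ _ _ _ (fun i : 'I_n.+1 => (i : nat, (n - i)%N))).
- by move=> i j [] /val_inj.
- move=> [i j] /=; case: (i + j =P n)%N => [E _|]; last by rewrite eqxx.
  have i_n : (i < n.+1)%N by rewrite ltnS -E leq_addr.
  by exists (Ordinal i_n); rewrite /= -E addKn.
rewrite fpsME mulr_suml; apply: eq_has_sum (@has_sum_finT _ _) => i /=.
have i_n : (i <= n)%N by rewrite -ltnS.
by rewrite subnKC // eqxx /F /a /b mulrACA -exprD subnKC.
Qed.

Lemma evN f q : tame f -> nc q < 1 -> ev (- f) q = - ev f q.
Proof.
move=> hf q1; rewrite -[LHS]addr0 -(subrr (ev f q)) addrA -evD //; last exact: tameN.
by rewrite addNr ev0 add0r.
Qed.

Lemma evB f g q : tame f -> tame g -> nc q < 1 -> ev (f - g) q = ev f q - ev g q.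
Proof. by move=> hf hg q1; rewrite evD ?evN //; apply: tameN. Qed.

Lemma evX f n q : tame f -> nc q < 1 -> ev (f ^+ n) q = ev f q ^+ n.
Proof.
by move=> hf q1; elim: n => [|n IH]; rewrite ?ev1 // !exprS evM ?IH //; apply: tameX.
Qed.

Lemma ev_sum (I : Type) (s : seq I) (P : pred I) (F : I -> fps C) q :
  (forall i, P i -> tame (F i)) -> nc q < 1 ->
  ev (\sum_(i <- s | P i) F i) q = \sum_(i <- s | P i) ev (F i) q.
Proof.
move=> h q1; elim: s => [|i s IH]; first by rewrite !big_nil ev0.
rewrite !big_cons; case: ifP => // Pi; rewrite evD ?IH //; first exact: h.
exact: tame_sum.
Qed.

Lemma ev_subst p f q : (0 < p)%N -> tame f -> nc q < 1 -> ev (fps_subst p f) q = ev f (q ^+ p).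
Proof.
move=> p0 hf q1; have qp : nc (q ^+ p) < 1 by rewrite ncX pow_lt1 ?nc_ge0.
apply: ev_eq; apply: (@has_sum_push _ _ _ _ (fun n => n * p)%N).
- by move=> i j /eqP; rewrite eqn_pmul2r // => /eqP.
- by move=> n /=; case: ifP => [/dvdnP[m ->] _|]; [exists m|rewrite mul0r eqxx].
apply: eq_has_sum (ev_has hf qp) => n /=.
by rewrite dvdn_mull // mulnK // mulnC exprM.
Qed.

Lemma ev_scale c f q : ev (fps_scale c f) q = ev f (c * q).
Proof.
rewrite /ev; congr csum; apply: funext => n /=.
by rewrite exprMn mulrCA mulrA.
Qed.

End Evaluation.

(** * Fourier series and the Cauchy estimate *)

Section Exponential.
Variable R : realType.
Local Notation C := R[i].
Implicit Types (w z : C) (f : fps C).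

(** This is [exp(2 i pi w)]; thus [ee t] is the usual [q], of modulus below 1 when [Im t > 0]. *)
Definition ee w : C :=
  ((expR (- (2 * pi * Im w)) * cos (2 * pi * Re w)) +i*
   (expR (- (2 * pi * Im w)) * sin (2 * pi * Re w)))%C.

Lemma eeD w z : ee (w + z) = ee w * ee z.
Proof.
case: w => a b; case: z => c d; rewrite /ee /=.
rewrite !mulrDr opprD expRD cosD sinD; apply/eqP; rewrite eq_complex /=.
by apply/andP; split; apply/eqP; ring.
Qed.

Lemma ee0 : ee 0 = 1.
Proof. by rewrite /ee /= !mulr0 oppr0 expR0 cos0 sin0 mulr1 mulr0. Qed.

Lemma ee1 : ee 1 = 1.
Proof.
have e : 2 * pi * 1 = pi *+ 2 :> R by rewrite mulr1 mulr2n; ring.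
by rewrite /ee /= e !mulr0 oppr0 expR0 cos2pi sin2pi mulr1 mulr0.
Qed.

Lemma ee_mul w n : ee (n%:R * w) = ee w ^+ n.
Proof.
elim: n => [|n IH]; first by rewrite mul0r ee0.
by rewrite -natr1 mulrDl mul1r eeD IH exprSr.
Qed.

Lemma ee_nat n : ee n%:R = 1.
Proof. by rewrite -[n%:R]mulr1 ee_mul ee1 expr1n. Qed.

Lemma eeN w : ee (- w) * ee w = 1.
Proof. by rewrite -eeD addNr ee0. Qed.

Lemma ee_int (m : int) : ee m%:~R = 1.
Proof.
case: m => n; first exact: ee_nat.
by rewrite NegzE rmorphN /= -[LHS]mulr1 -[X in _ * X = _](ee_nat n.+1) eeN.
Qed.

Lemma ee_Dint w (m : int) : ee (w + m%:~R) = ee w.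
Proof. by rewrite eeD ee_int mulr1. Qed.

Lemma nc_ee w : nc (ee w) = expR (- (2 * pi * Im w)).
Proof.
rewrite /ee /= !exprMn -mulrDr cos2Dsin2 mulr1 sqrtr_sqr ger0_norm //.
exact: expR_ge0.
Qed.

Lemma ee_lt1 w : 0 < Im w -> nc (ee w) < 1.
Proof.
by move=> h; rewrite nc_ee expR_lt1 oppr_lt0 !mulr_gt0 // pi_gt0.
Qed.

Lemma ee_neq0 w : ee w != 0.
Proof. by apply/eqP => h; have := eeN w; rewrite h mulr0 => /eqP; rewrite eq_sym oner_eq0. Qed.

Lemma ee_frac_neq1 (k N : nat) : (0 < k)%N -> (k < N)%N -> ee (k%:R / N%:R) != 1.
Proof.
move=> k0 kN; have N0 : (0 < N%:R :> R) by rewrite ltr0n (leq_trans _ kN).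
have -> : k%:R / N%:R = ((k%:R / N%:R : R)%:C)%C :> C.
  by rewrite rmorphM /= fmorphV /= !rmorph_nat.
set x := (k%:R / N%:R : R).
have x0 : 0 < x by rewrite divr_gt0 // ltr0n.
have x1 : x < 1 by rewrite ltr_pdivrMr // mul1r ltr_nat.
rewrite /ee /= mulr0 oppr0 expR0 !mul1r eq_complex /= negb_and; apply/orP; left.
have -> : 2 * pi * x = (pi * x) *+ 2 by rewrite mulr2n; ring.
rewrite cos_mulr2n; apply/eqP => h; have cs := cos2Dsin2 (pi * x).
have : 0 < sin (pi * x).
  by rewrite sin_gt0_pi // mulr_gt0 ?pi_gt0 //= -[ltRHS]mulr1 ltr_pM2l ?pi_gt0.
by move=> s0; have : 0 < sin (pi * x) ^+ 2 by [rewrite exprn_gt0]; lra.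
Qed.

Lemma sum_roots (N m : nat) : (0 < N)%N ->
  \sum_(k < N) ee (k%:R / N%:R) ^+ m = if (N %| m)%N then N%:R else 0.
Proof.
move=> N0; have Nn0 : (N%:R : C) != 0 by rewrite pnatr_eq0 -lt0n.
pose z := ee (1 / N%:R).
have zk k : ee (k%:R / N%:R) = z ^+ k by rewrite -ee_mul mul1r.
have zN : z ^+ N = 1 by rewrite -ee_mul mul1r divff // ee1.
have E k : ee (k%:R / N%:R) ^+ m = (z ^+ m) ^+ k by rewrite zk -!exprM mulnC.
under eq_bigr => k _ do rewrite E.
have zm : z ^+ m = z ^+ (m %% N) by rewrite {1}(divn_eq m N) exprD mulnC exprM zN expr1n mul1r.
case: ifP => [Nm|Nm].
  rewrite zm (eqP Nm) expr0; under eq_bigr => k _ do rewrite expr1n.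
  by rewrite sumr_const card_ord.
have z1 : z ^+ m != 1.
  by rewrite zm -zk ee_frac_neq1 ?ltn_mod // lt0n; move: Nm; rewrite /dvdn => ->.
have /eqP := subrX1 (z ^+ m) N.
rewrite -exprM mulnC exprM zN expr1n subrr eq_sym mulf_eq0 subr_eq0 (negPf z1) /=.
by move/eqP.
Qed.

Lemma clim_le (u : nat -> C) l M : clim u l -> (forall n, nc (u n) <= M) -> nc l <= M.
Proof.
move=> hu hM; apply/ler_addgt0Pl => e e0; have [N hN] := hu e e0.
have -> : l = u N - (u N - l) by ring.
by rewrite (le_trans (ncB _ _)) // addrC lerD // ltW // hN.
Qed.

Lemma clim_uniq (u : nat -> C) l l' : clim u l -> clim u l' -> l = l'.
Proof.
move=> h h'; apply/eqP; rewrite -subr_eq0 -nc_eq0 eq_le nc_ge0 andbT.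
apply/ler_addgt0Pl => e e0; rewrite addr0.
have e2 : 0 < e / 2 by rewrite divr_gt0.
have [N hN] := h _ e2; have [N' hN'] := h' _ e2.
have -> : l - l' = (u (maxn N N') - l') - (u (maxn N N') - l) by ring.
by rewrite (le_trans (ncB _ _)) // (splitr e) lerD // ltW // ?hN ?hN' ?leq_maxl ?leq_maxr.
Qed.

(** A discrete contour integral: averaging over the [(N+1)]-th roots of unity with weight exponent
    [N * n], which is [-n] modulo [N + 1], keeps only the indices [j = n] modulo [N + 1]. As [N]
    grows, coefficient [n] alone remains. *)
Lemma cauchy_estimate f y M n : tame f -> 0 < y ->
  (forall x, nc (ev f (ee (x +i* y)%C)) <= M) ->
  nc (f n) * expR (- (2 * pi * y)) ^+ n <= M.
Proof.
move=> hf y0 hM.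
pose r := ee (0 +i* y)%C.
have r1 : nc r < 1 by apply: ee_lt1.
have nr : nc r = expR (- (2 * pi * y)) by rewrite nc_ee.
rewrite -nr -ncX -ncM.
have [B _ hB] := ev_bound hf r1.
pose F (N j : nat) : C := if (N.+1 %| j + N * n)%N then f j * r ^+ j else 0.
pose S N := N.+1%:R^-1 * \sum_(k < N.+1) ee (k%:R / N.+1%:R) ^+ (N * n) * ev f (ee (k%:R / N.+1%:R) * r).
apply: (@clim_le S).
  apply: (@tannery _ _ F (fun j => if j == n then f j * r ^+ j else 0) (fun j => nc (f j * r ^+ j)) B).
  - by move=> N j; rewrite /F; case: ifP => // _; rewrite nc0 nc_ge0.
  - exact: hB.
  - move=> j e e0; exists (j + n)%N => N hN; rewrite /F.
    have -> : (N.+1 %| j + N * n)%N = (j == n).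
      have jN : (j < N.+1)%N by rewrite ltnS (leq_trans _ hN) ?leq_addr.
      have nN : (n < N.+1)%N by rewrite ltnS (leq_trans _ hN) ?leq_addl.
      have E : (j + N * n + n = n * N.+1 + j)%N by rewrite mulnSr [(N * n)%N]mulnC; lia.
      apply/idP/eqP => [/eqP h|->]; last by rewrite -mulSn dvdn_mulr.
      have := congr1 (modn^~ N.+1) E.
      by rewrite /= -modnDml h add0n modnMDl !modn_small.
    by rewrite subrr nc0.
  - move=> N; rewrite /S.
    have N0 : (N.+1%:R : C) != 0 by rewrite pnatr_eq0.
    pose c (k : 'I_N.+1) := ee (k%:R / N.+1%:R).
    have c1 k : nc (c k) = 1.
      rewrite nc_ee (_ : Im _ = 0) ?mulr0 ?oppr0 ?expR0 //.
      have -> : (k%:R / N.+1%:R : C) = ((k%:R / N.+1%:R : R)%:C)%C by rewrite rmorphM /= fmorphV /= !rmorph_nat.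
      by [].
    pose G := \sum_(k < N.+1) fps_const (c k ^+ (N * n)) * fps_scale (c k) f.
    have tG k : tame (fps_const (c k ^+ (N * n)) * fps_scale (c k) f).
      by apply: tameM; [apply: tame_const|apply: tame_scale; rewrite ?c1].
    have -> : \sum_(k < N.+1) ee (k%:R / N.+1%:R) ^+ (N * n) * ev f (ee (k%:R / N.+1%:R) * r) = ev G r.
      rewrite ev_sum //; apply: eq_bigr => k _.
      rewrite evM ?ev_const ?ev_scale //; first exact: tame_const.
      by apply: tame_scale; rewrite ?c1.
    have tG' : tame G by apply: tame_sum.
    apply: eq_has_sum (has_sumZ N.+1%:R^-1 (ev_has tG' r1)) => j.
    rewrite /F /G fps_sumE.
    under eq_bigr => k _ do rewrite fps_constM /= mulrA -exprD addnC.
    rewrite -mulr_suml sum_roots //; case: ifP => _; last by rewrite !mul0r mulr0.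
    by rewrite !mulrA mulVf // mul1r.
  - have := @has_sum1 R _ (fun j => if j == n then f j * r ^+ j else 0) n.
    by rewrite eqxx; apply=> x /negPf ->.
move=> N; rewrite /S ncM ncV nc_nat mulrC ler_pdivrMr ?ltr0n //.
rewrite (le_trans (nc_sum _ _ _)) // mulr_natr -[N.+1 in X in _ <= X]card_ord -sumr_const ler_sum // => k _.
rewrite ncM ncX nc_ee.
have E : (k%:R / N.+1%:R : C) = ((k%:R / N.+1%:R : R)%:C)%C by rewrite rmorphM /= fmorphV /= !rmorph_nat.
rewrite {1}E /= mulr0 oppr0 expR0 expr1n mul1r -eeD E.
by have -> : ((k%:R / N.+1%:R : R)%:C)%C + (0 +i* y)%C = ((k%:R / N.+1%:R) +i* y)%C
  by rewrite /= /GRing.add /= addr0 add0r.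
Qed.

Lemma ev_inj0 f : tame f -> (forall w, 0 < Im w -> ev f (ee w) = 0) -> f = 0.
Proof.
move=> hf h; apply/fpsP => n; rewrite fps0E; apply/eqP.
rewrite -nc_eq0 eq_le nc_ge0 andbT.
have := @cauchy_estimate f 1 0 n hf ltr01; rewrite pmulr_lle0 ?exprn_gt0 ?expR_gt0 //.
by apply=> x; rewrite h ?nc0.
Qed.

End Exponential.

(** * A vanishing criterion under the Fricke involution *)

Section HeckeBound.
Variable R : realType.
Local Notation C := R[i].
Implicit Types (t w : C) (f : fps C).

Definition fricke t : C := - (3 * t)^-1.

Lemma ImV w : Im w^-1 = - Im w / nc w ^+ 2.
Proof. by rewrite nc_sqr; case: w => a b /=; rewrite mulNr. Qed.

Lemma natC n : (n%:R : C) = (n%:R : R)%:C%C.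
Proof. by rewrite rmorph_nat. Qed.

Lemma Im_natM n w : Im (n%:R * w) = n%:R * Im w.
Proof. by rewrite natC; case: w => a b /=; rewrite mul0r addr0. Qed.

Lemma Im_fricke t : Im (fricke t) = Im t / (3 * nc t ^+ 2).
Proof.
rewrite /fricke ImN ImV Im_natM ncM nc_nat exprMn mulNr opprK.
have [->|t0] := eqVneq t 0; first by rewrite nc0 expr0n /= !mulr0 invr0 !mulr0.
by field; rewrite nc_eq0.
Qed.

Lemma Im_D1 t : Im (t + 1) = Im t.
Proof. by case: t => a b /=; rewrite addr0. Qed.

Lemma Im_gt0_neq0 t : 0 < Im t -> t != 0.
Proof. by apply: contraTneq => ->; rewrite /= ltxx. Qed.

Lemma Im_fricke_gt0 t : 0 < Im t -> 0 < Im (fricke t).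
Proof.
move=> h; rewrite Im_fricke divr_gt0 // mulr_gt0 // exprn_gt0 // nc_gt0.
exact: Im_gt0_neq0.
Qed.

Lemma frickeK t : fricke (fricke t) = t.
Proof.
rewrite /fricke; have [->|t0] := eqVneq t 0; first by rewrite mulr0 invr0 oppr0 mulr0 invr0 oppr0.
by field.
Qed.

Lemma Re_int_shift t : exists m : int, `|Re (t + m%:~R)| <= 1 / 2 /\ Im (t + m%:~R) = Im t.
Proof.
pose m := Num.floor (Re t + 1 / 2); exists (- m).
have mC : ((- m)%:~R : C) = ((- m)%:~R : R)%:C%C by rewrite rmorph_int.
rewrite mC; split; last by rewrite ImD /= addr0.
rewrite ReD /= rmorphN /=.
have /andP[h1 h2] := floor_itv (Re t + 1 / 2).
rewrite -/m rmorphD /= in h1 h2.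
by rewrite ler_norml; apply/andP; split; lra.
Qed.

(** After a translation [|Re t| <= 1/2]; if moreover [Im t < 1/4], then [3 |t|^2 <= 15/16], so the
    Fricke involution multiplies the height by at least [16/15]. The height [1/4] lies safely below
    the lowest point [1/(2 sqrt 3)] of a fundamental domain. *)
Lemma modular_reduction (P : C -> Prop) :
  (forall t, P (t + 1) -> P t) -> (forall t, P t -> P (t + 1)) ->
  (forall t, 0 < Im t -> P (fricke t) -> P t) ->
  (forall t, 1 / 4 <= Im t -> P t) -> forall t, 0 < Im t -> P t.
Proof.
move=> h1 h1' hW h4.
have hn (n : nat) t : P (t + n%:R) <-> P t.
  elim: n t => [|n IH] t; first by rewrite addr0.
  rewrite -natr1 addrA; split=> [/h1|/IH/h1' //].
  by rewrite IH.
have hi t (m : int) : P (t + m%:~R) -> P t.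
  case: m => n; first by move/hn.
  by rewrite NegzE rmorphN /= => h; rewrite -[t](subrK n.+1%:R); apply/hn.
have main n : forall t, 0 < Im t -> 1 / 4 * (15 / 16) ^+ n <= Im t -> P t.
  elim: n => [|n IH] t t0; first by rewrite expr0 mulr1; apply: h4.
  move=> hy; have [|y4] := lerP (1 / 4) (Im t); first exact: h4.
  have [m [hr him]] := Re_int_shift t.
  apply: (hi _ m); apply: hW; rewrite ?him //; apply: IH.
    by rewrite Im_fricke_gt0 // him.
  have tm0 : 0 < Im (t + m%:~R) by rewrite him.
  have nt0 : 0 < nc (t + m%:~R) ^+ 2 by rewrite exprn_gt0 // nc_gt0 Im_gt0_neq0.
  have hn2 : nc (t + m%:~R) ^+ 2 <= 5 / 16.
    rewrite nc_sqr him.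
    have hr2 : Re (t + m%:~R) ^+ 2 <= (1 / 2) ^+ 2.
      by move: hr; rewrite ler_norml => /andP[? ?]; nra.
    have hi2 : Im t ^+ 2 <= (1 / 4) ^+ 2 by nra.
    by apply: le_trans (lerD hr2 hi2) _; lra.
  have d0 : 0 < 3 * nc (t + m%:~R) ^+ 2 by rewrite mulr_gt0.
  rewrite Im_fricke him ler_pdivlMr //.
  rewrite exprS in hy; have e0 : 0 <= (15 / 16 : R) ^+ n by rewrite exprn_ge0 //; lra.
  set x := (15 / 16) ^+ n in hy e0 *; set N := nc _ ^+ 2 in hn2 nt0 *.
  apply: le_trans hy.
  have : x * N <= x * (5 / 16) by rewrite ler_wpM2l.
  lra.
move=> t t0.
suff [n hn'] : exists n, 1 / 4 * (15 / 16 : R) ^+ n <= Im t by exact: main hn'.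
have bern n : 1 + n%:R / 15 <= (16 / 15 : R) ^+ n.
  elim: n => [|n IH]; first by rewrite mul0r addr0.
  rewrite exprS -natr1; have n0 : 0 <= (n%:R : R) by []; nra.
pose n := Num.bound (15 / (4 * Im t)); exists n.
have hn0 : 15 / (4 * Im t) <= n%:R.
  by apply/ltW/archi_boundP; rewrite divr_ge0 // mulr_ge0 // ltW.
have e : (15 / 16 : R) ^+ n = ((16 / 15) ^+ n)^-1.
  by rewrite -exprVn; congr (_ ^+ _); rewrite invf_div.
have x0 : 0 < (16 / 15 : R) ^+ n by rewrite exprn_gt0 //; lra.
rewrite e ler_pdivrMr //.
have := bern n; set x := (16 / 15) ^+ n in x0 * => bn.
rewrite ler_pdivrMr ?mulr_gt0 // in hn0.
by nra.
Qed.

Lemma sin_mvt (x : R) : 0 < x -> exists2 c, 0 < c < x & sin x = cos c * x.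
Proof.
move=> x0.
have [|c hc E] := @MVT R sin cos 0 x x0.
  by apply: continuous_subspaceT => c; apply: continuous_sin.
by move: hc E; rewrite in_itv /= sin0 !subr0 => hc E; exists c.
Qed.

Lemma sin_le_id (x : R) : 0 <= x -> sin x <= x.
Proof.
rewrite le_eqVlt => /orP[/eqP <-|x0]; first by rewrite sin0.
by have [c _ ->] := sin_mvt x0; rewrite ler_piMl ?cos_le1 // ltW.
Qed.

(** At [x = pi/6], the triple angle formula for [sin (3 x) = 1] forces [sin x = 1/2], while
    [sin x <= x]. *)
Lemma pi_ge3 : 3 <= pi :> R.
Proof.
have p0 := pi_gt0 R.
set x : R := pi / 6; have x0 : 0 < x by rewrite divr_gt0.
have s0 : 0 < sin x by rewrite sin_gt0_pi // x0 /= /x; lra.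
have e : sin (x + x *+ 2) = 1.
  by rewrite -(sin_pihalf R); congr sin; rewrite /x mulr2n; field.
rewrite sinD sin_mulr2n cos_mulr2n in e.
have cs := cos2Dsin2 x; have xs := sin_le_id (ltW x0).
have cE : cos x ^+ 2 = 1 - sin x ^+ 2 by lra.
have : (sin x + 1) * (2 * sin x - 1) ^+ 2 = 0.
  have e2 : 4 * sin x * cos x ^+ 2 - sin x = 1 by rewrite -[RHS]e; ring.
  rewrite cE in e2.
  have -> : (sin x + 1) * (2 * sin x - 1) ^+ 2 = 1 - (4 * sin x * (1 - sin x ^+ 2) - sin x) by ring.
  by rewrite e2 subrr.
move/eqP; rewrite mulf_eq0 expf_eq0 /= => /orP[/eqP h|/eqP h]; first by lra.
by move: xs; rewrite /x; lra.
Qed.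

(** This makes the contraction factor of [hecke_bound] less than 1; the exponent is [6 (1/4 - 1/8)],
    with 6 a lower bound of [2 pi]. *)
Lemma expR34 : 2 < expR (3 / 4 : R).
Proof.
have -> : 3 / 4 = 8%:R * (3 / 32) :> R by field.
rewrite expRM_natl; apply: (@lt_le_trans _ _ ((1 + 3 / 32) ^+ 8)).
  by rewrite !exprS expr0; lra.
by rewrite lerXn2r ?nnegrE ?expR_ge0 ?expR_ge1Dx //; lra.
Qed.

(* By the reduction, |f(ee t)| Im(t)^K on Im t = 1/8 is bounded by its values on
   Im t >= 1/4, so Cauchy's estimate shrinks any bound on the coefficients by a
   factor < 1. *)
Lemma hecke_bound f K n0 : tame f -> (8 * K + 6 <= 6 * n0)%N ->
  (forall n, (n < n0)%N -> f n = 0) ->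
  (forall t, 0 < Im t -> nc (ev f (ee (fricke t))) = 3 ^+ K * nc t ^+ (2 * K) * nc (ev f (ee t))) ->
  f = 0.
Proof.
move=> tf hK f0 hW.
pose r : R := expR (- (2 * pi / 8)).
have r0 : 0 < r by apply: expR_gt0.
have p3 := pi_ge3.
have r1 : r < 1 by rewrite expR_lt1; lra.
(* With [x = exp(-3/4)] this is [x / (1 - x)]: one factor [x] is gained between the heights [1/8]
   and [1/4], and [1 / (1 - x)] bounds the geometric tail of the series. *)
pose th : R := expR (- (3 / 4)) / (1 - expR (- (3 / 4))).
have E2 : expR (- (3 / 4) : R) < 1 / 2.
  by rewrite expRN div1r ltf_pV2 ?posrE ?expR_gt0 ?expR34.
have th0 : 0 <= th.
  by rewrite divr_ge0 ?expR_ge0 // subr_ge0; lra.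
have th1 : th < 1.
  by rewrite ltr_pdivrMr ?mul1r ?subr_gt0; lra.
pose Phi t := nc (ev f (ee t)) * Im t ^+ K.
have step M : (forall n, nc (f n) * r ^+ n <= M) -> forall n, nc (f n) * r ^+ n <= th * M.
  move=> hM n.
  have M0 : 0 <= M by apply: le_trans (hM 0%N); rewrite mulr_ge0 ?nc_ge0 ?exprn_ge0 // ltW.
  have hPhi t : 0 < Im t -> Phi t <= th * M * (1 / 8) ^+ K.
    move: t; apply: (@modular_reduction (fun t => Phi t <= th * M * (1 / 8) ^+ K)) => [t|t|t t0|t t4].
    - by rewrite /Phi eeD ee1 mulr1 Im_D1.
    - by rewrite /Phi eeD ee1 mulr1 Im_D1.
    - have e : Phi (fricke t) = 3 ^+ K * nc t ^+ (2 * K) * nc (ev f (ee t)) * Im (fricke t) ^+ K.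
        refine (etrans _ (congr1 (fun z : R => z * Im (fricke t) ^+ K) (hW t t0))); reflexivity.
      rewrite {}e Im_fricke /Phi.
      have n0' : 0 < nc t by rewrite nc_gt0 Im_gt0_neq0.
      congr (_ <= _).
      rewrite exprMn exprVn exprMn -exprM.
      have u3 : 3 ^+ K != 0 :> R by rewrite expf_neq0 // pnatr_eq0.
      have un : nc t ^+ (2 * K) != 0 by rewrite expf_neq0 // gt_eqF.
      by field; rewrite u3 un.
    have t0 : 0 < Im t by lra.
    pose s := nc (ee t); have q1 : nc (ee t) < 1 by apply: ee_lt1.
    have s0 : 0 <= s by apply: nc_ge0.
    have sr : s / r = expR (- (2 * pi * (Im t - 1 / 8))).
      by rewrite /s /r nc_ee -expRB; congr expR; field.
    pose x := expR (- (6 * (Im t - 1 / 8))).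
    have srx : s / r <= x by rewrite sr ler_expR lerN2; nra.
    have x34 : x <= expR (- (3 / 4)) by rewrite ler_expR lerN2; nra.
    have x0 : 0 < x by apply: expR_gt0.
    have sr0 : 0 <= s / r by rewrite divr_ge0 // ltW.
    have rm k : 0 <= r ^+ k by rewrite exprn_ge0 // ltW.
    pose g := fps_sec 1 n0 f.
    have fg : f = fps_X n0 * g.
      apply/fpsP => m; rewrite fps_XM; case: leqP => [h|/f0 //].
      by rewrite /= mul1n subnK.
    have tg : tame g by apply: tame_sec.
    have hg : nc (ev g (ee t)) <= M / r ^+ n0 * (1 - x)^-1.
      apply: (has_sum_le (ev_has tg q1)).
      have x1 : x < 1 by lra.
      apply: sums_le_cmp (sums_leZ _ (sums_le_geo (ltW x0) x1)); last first.
        by rewrite divr_ge0 // exprn_ge0 // ltW.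
      move=> m; rewrite ncM ncX -/s /= mul1n.
      have -> : s ^+ m = r ^+ m * (s / r) ^+ m by rewrite -exprMn mulrC divfK ?gt_eqF.
      rewrite mulrA; apply: ler_pM.
      - exact: mulr_ge0 (nc_ge0 _) (rm m).
      - exact: exprn_ge0.
      - rewrite ler_pdivlMr ?exprn_gt0 // -mulrA -exprD; exact: hM.
      - by rewrite lerXn2r ?nnegrE // ltW.
    (* The height factor grows at most like [exp(8 K (Im t - 1/8))]. The hypothesis
       [8 * K + 6 <= 6 * n0] lets [x ^+ n0] absorb it and still leaves one factor
       [x <= exp(-3/4)]. *)
    have h8 : (8 * Im t) ^+ K <= expR (8 * K%:R * (Im t - 1 / 8)).
      have -> : 8 * K%:R * (Im t - 1 / 8) = K%:R * (8 * Im t - 1) by field.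
      rewrite expRM_natl lerXn2r ?nnegrE ?expR_ge0 ?mulr_ge0 ?(ltW t0) //.
      by apply: le_trans (expR_ge1Dx _); lra.
    rewrite /Phi fg evM //; last exact: tame_X.
    rewrite ev_X ncM ncX -/s.
    have -> : Im t ^+ K = (8 * Im t) ^+ K * (1 / 8) ^+ K.
      by rewrite -exprMn; congr (_ ^+ _); field.
    rewrite mulrA; apply: ler_wpM2r; first by rewrite exprn_ge0 // divr_ge0.
    have -> : s ^+ n0 = r ^+ n0 * (s / r) ^+ n0 by rewrite -exprMn mulrC divfK ?gt_eqF.
    have rn0 : r ^+ n0 != 0 by rewrite expf_neq0 // gt_eqF.
    have x1' : 1 - x != 0 by apply/eqP => h; lra.
    have b1 : r ^+ n0 * (s / r) ^+ n0 * nc (ev g (ee t)) <= x ^+ n0 * (M * (1 - x)^-1).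
      have -> : x ^+ n0 * (M * (1 - x)^-1) = r ^+ n0 * x ^+ n0 * (M / r ^+ n0 * (1 - x)^-1).
        by field; rewrite rn0 x1'.
      apply: ler_pM => //; first by rewrite mulr_ge0 // exprn_ge0.
        exact: nc_ge0.
      by rewrite ler_wpM2l // lerXn2r ?nnegrE // ltW.
    have b0 : 0 <= r ^+ n0 * (s / r) ^+ n0 * nc (ev g (ee t)).
      by rewrite mulr_ge0 ?nc_ge0 // mulr_ge0 // exprn_ge0.
    have b8 : 0 <= (8 * Im t) ^+ K by rewrite exprn_ge0 // mulr_ge0 // ltW.
    apply: (le_trans (ler_pM b0 b8 b1 h8)).
    have -> : x ^+ n0 * (M * (1 - x)^-1) * expR (8 * K%:R * (Im t - 1 / 8)) =
       (x ^+ n0 * expR (8 * K%:R * (Im t - 1 / 8))) / (1 - x) * M by field.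
    rewrite ler_wpM2r // /th ler_pM ?mulr_ge0 ?exprn_ge0 ?expR_ge0 ?invr_ge0 ?(ltW x0) //; first lra.
      rewrite /x -expRM_natl -expRD ler_expR.
      have hKR : 8 * K%:R + 6 <= 6 * n0%:R :> R.
        by rewrite -!natrM -natrD ler_nat.
      nra.
    by rewrite lef_pV2 ?posrE; lra.
  have h8 : (0 : R) < 1 / 8 by lra.
  have hc x : nc (ev f (ee (x +i* (1 / 8))%C)) <= th * M.
    have := hPhi (x +i* (1 / 8))%C h8; rewrite /Phi /=.
    by rewrite ler_pM2r // exprn_gt0.
  have := cauchy_estimate n tf h8 hc.
  by rewrite (_ : 2 * pi * (1 / 8) = 2 * pi / 8) //; ring.
have [M hM] := tf r (ltW r0) r1.
have hk k : forall n, nc (f n) * r ^+ n <= th ^+ k * M.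
  elim: k => [|k IH]; first by rewrite expr0 mul1r.
  by rewrite exprS -mulrA; apply: step.
have M0 : 0 <= M by apply: le_trans (hM 0%N); rewrite mulr_ge0 ?nc_ge0 ?exprn_ge0 // ltW.
apply/fpsP => n; rewrite fps0E; apply/eqP; rewrite -nc_eq0.
have rn : 0 < r ^+ n by rewrite exprn_gt0.
rewrite -(mulIr_eq0 _ (mulIf (lt0r_neq0 rn))) eq_le mulr_ge0 ?nc_ge0 ?(ltW rn) // andbT.
(* Since [k.+1 * th ^+ k] is bounded in [k], a positive coefficient would contradict the iterated
   bound [hk]. *)
have bnd k : k.+1%:R * (nc (f n) * r ^+ n) <= (1 - th)^-1 * M.
  rewrite (le_trans (ler_wpM2l _ (hk k n))) // mulrA ler_wpM2r //.
  exact: pow_lt1_mul.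
rewrite leNgt; apply/negP => pos.
pose k := Num.bound ((1 - th)^-1 * M / (nc (f n) * r ^+ n)).
have := bnd k; rewrite -ler_pdivlMr // leNgt => /negP; apply.
apply: (lt_trans (archi_boundP _)); last by rewrite ltr_nat.
by rewrite divr_ge0 ?(ltW pos) // mulr_ge0 // invr_ge0 subr_ge0 ltW.
Qed.

End HeckeBound.

(** * The Lipschitz formula *)

Section Lipschitz.
Variable R : realType.
Local Notation C := R[i].
Implicit Types (w z t : C) (f : fps C) (u v : nat -> C).

Lemma clim_const z : clim (fun=> z) z.
Proof. by move=> e e0; exists 0%N => n _; rewrite subrr nc0. Qed.

Lemma eq_clim u v z : (forall n, u n = v n) -> clim u z -> clim v z.
Proof. by move=> uv h e e0; have [N hN] := h e e0; exists N => n /hN; rewrite uv. Qed.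

Lemma climD u v z w : clim u z -> clim v w -> clim (fun n => u n + v n) (z + w).
Proof.
move=> hu hv e e0; have e2 : 0 < e / 2 by rewrite divr_gt0.
have [N hN] := hu _ e2; have [N' hN'] := hv _ e2.
exists (maxn N N') => n; rewrite geq_max => /andP[/hN h /hN' h'].
by rewrite opprD addrACA (le_lt_trans (ncD _ _)) // (splitr e) ltrD.
Qed.

Lemma clim_bnd u z : clim u z -> exists N, forall n, (N <= n)%N -> nc (u n) <= nc z + 1.
Proof.
move=> h; have [N hN] := h 1 ltr01; exists N => n /hN hn.
have -> : u n = z + (u n - z) by ring.
by rewrite (le_trans (ncD _ _)) // lerD2l ltW.
Qed.

Lemma clim_small u z (b : nat -> R) : (forall n, nc (u n - z) <= b n) ->
  (forall e, 0 < e -> exists N, forall n, (N <= n)%N -> b n < e) -> clim u z.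
Proof.
move=> h hb e e0; have [N hN] := hb e e0; exists N => n /hN.
exact: le_lt_trans.
Qed.

Lemma climM u v z w : clim u z -> clim v w -> clim (fun n => u n * v n) (z * w).
Proof.
move=> hu hv e e0.
have [N0 hN0] := clim_bnd hu.
have a0 : 0 < nc z + 1 by rewrite ltr_wpDl ?nc_ge0.
have b0 : 0 < nc w + 1 by rewrite ltr_wpDl ?nc_ge0.
have e2 : 0 < e / 2 by rewrite divr_gt0.
have [N1 hN1] := hu _ (divr_gt0 e2 b0); have [N2 hN2] := hv _ (divr_gt0 e2 a0).
exists (maxn N0 (maxn N1 N2)) => n; rewrite !geq_max => /and3P[/hN0 h0 /hN1 h1 /hN2 h2].
have -> : u n * v n - z * w = u n * (v n - w) + (u n - z) * w by ring.
rewrite (le_lt_trans (ncD _ _)) // !ncM (splitr e) ltr_leD //.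
  apply: (le_lt_trans (ler_wpM2r (nc_ge0 _) h0)).
  by rewrite -ltr_pdivlMl // mulrC.
have h1' : nc (u n - z) * (nc w + 1) <= e / 2 by rewrite -ler_pdivlMr // ltW.
by apply: le_trans h1'; rewrite ler_wpM2l ?nc_ge0 // lerDl.
Qed.

Lemma climX u z m : clim u z -> clim (fun n => u n ^+ m) (z ^+ m).
Proof.
move=> h; elim: m => [|m IH]; first exact: clim_const.
by rewrite exprS; apply: eq_clim (climM h IH) => n; rewrite exprS.
Qed.

Lemma climV u z : z != 0 -> clim u z -> clim (fun n => (u n)^-1) z^-1.
Proof.
move=> z0 hu e e0; have nz : 0 < nc z by rewrite nc_gt0.
have z2 : 0 < nc z / 2 by rewrite divr_gt0.
have [N1 hN1] := hu _ z2.
have d0 : 0 < e * (nc z * (nc z / 2)) by rewrite mulr_gt0 // mulr_gt0.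
have [N2 hN2] := hu _ d0.
exists (maxn N1 N2) => n; rewrite !geq_max => /andP[/hN1 h1 /hN2 h2].
have un : nc z / 2 < nc (u n).
  have : nc z <= nc (u n) + nc (u n - z).
    by rewrite -{1}(subKr (u n) z) ncB.
  by lra.
have un0 : u n != 0 by rewrite -nc_gt0; lra.
have -> : (u n)^-1 - z^-1 = (z - u n) / (u n * z) by field; rewrite un0 z0.
rewrite ncM ncV ncM ncBC ltr_pdivrMr ?mulr_gt0 ?nc_gt0 //.
apply: (lt_le_trans h2); rewrite ler_pM2l //.
by rewrite [leLHS]mulrC ler_wpM2r ?ltW.
Qed.

Lemma cos_ge (c : R) : 0 <= c -> 1 - cos c <= c ^+ 2 / 2.
Proof.
move=> c0; have e : c = (c / 2) *+ 2 by rewrite mulr2n -splitr.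
have cs := cos2Dsin2 (c / 2).
have h : - (c / 2) <= sin (c / 2).
  have [->|/eqP cn] := eqVneq c 0; first by rewrite mul0r sin0 oppr0.
  have c2 : 0 < c / 2 by rewrite divr_gt0 // lt_neqAle eq_sym c0 andbT; apply/eqP.
  have [d _ ->] := sin_mvt c2.
  have := cos_geN1 d; nra.
have h' := @sin_le_id R (c / 2) (divr_ge0 c0 (ler0n _ 2)).
rewrite {1}e cos_mulr2n mulr2n; nra.
Qed.

Lemma sin_lin (x : R) : `|x| <= 1 -> `|sin x - x| <= x ^+ 2.
Proof.
wlog x0 : x / 0 <= x.
  move=> H; have [/H//|x0] := lerP 0 x => hx.
  have := H (- x); rewrite oppr_ge0 normrN sinN -opprD normrN sqrrN => -> //.
  exact: ltW.
rewrite (ger0_norm x0) => x1.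
have [->|xn] := eqVneq x 0; first by rewrite sin0 subrr normr0 expr0n.
have xp : 0 < x by rewrite lt_neqAle eq_sym xn.
have [c /andP[c0 cx] ->] := sin_mvt xp.
have -> : cos c * x - x = - (x * (1 - cos c)) by ring.
have h := cos_ge (ltW c0); have h1 := cos_le1 c.
rewrite normrN ger0_norm ?mulr_ge0 ?subr_ge0 //.
have : c ^+ 2 <= x by nra.
by nra.
Qed.

Lemma cos_lin (x : R) : `|cos x - 1| <= x ^+ 2.
Proof.
wlog x0 : x / 0 <= x.
  move=> H; have [/H//|x0] := lerP 0 x.
  by have := H (- x); rewrite oppr_ge0 cosN sqrrN => -> //; exact: ltW.
have h := cos_ge x0; have h1 := cos_le1 x.
by rewrite distrC ger0_norm ?subr_ge0 //; have := sqr_ge0 x; lra.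
Qed.

Lemma exp_lin (x : R) : `|x| <= 1 / 2 -> `|expR x - 1 - x| <= 2 * x ^+ 2.
Proof.
rewrite ler_norml => /andP[h1 h2].
have a := expR_ge1Dx x; have b := expR_ge1Dx (- x).
have e : expR x * expR (- x) = 1 by rewrite expRxMexpNx_1.
have p := expR_gt0 x.
have : expR x * (1 - x) <= 1 by rewrite -[leRHS]e ler_wpM2l // ltW.
by move=> h; rewrite ger0_norm; [nra|lra].
Qed.

Definition twopii : C := (0 +i* (2 * pi))%C.

Lemma ee_lin z : nc (twopii * z) <= 1 / 2 -> nc (ee z - 1 - twopii * z) <= 6 * nc (twopii * z) ^+ 2.
Proof.
case: z => a b.
have -> : twopii * (a +i* b)%C = (- (2 * pi * b) +i* (2 * pi * a))%C.
  by apply/eqP; rewrite eq_complex /=; apply/andP; split; apply/eqP; ring.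
rewrite /ee /=; set X := - (2 * pi * b); set Y := 2 * pi * a => h.
have hX : `|X| <= 1 / 2 by apply: le_trans h; exact: (nc_Re (X +i* Y)%C).
have hY : `|Y| <= 1 / 2 by apply: le_trans h; exact: (nc_Im (X +i* Y)%C).
rewrite subr0; apply: (le_trans (nc_ReIm ((expR X * cos Y - 1 - X) +i* (expR X * sin Y - Y))%C)) => /=.
rewrite sqr_sqrtr ?addr_ge0 ?sqr_ge0 //.
have e1 := exp_lin hX; have e2 := cos_lin Y.
have Y1 : `|Y| <= 1 by apply: le_trans hY _; lra.
have e3 := sin_lin Y1; have p := expR_gt0 X.
move: hX hY e1 e2 e3; rewrite !ler_norml => /andP[? ?] /andP[? ?] /andP[? ?] /andP[? ?] /andP[? ?].
have E2 : expR X <= 2 by nra.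
have re : `|expR X * cos Y - 1 - X| <= 2 * X ^+ 2 + 2 * Y ^+ 2.
  by rewrite ler_norml; apply/andP; split; nra.
have im : `|expR X * sin Y - Y| <= 2 * X ^+ 2 + 4 * Y ^+ 2.
  have -> : expR X * sin Y - Y = (expR X) * (sin Y - Y) + (expR X - 1) * Y by ring.
  have b1 : `|(expR X) * (sin Y - Y)| <= 2 * Y ^+ 2.
    by rewrite ler_norml; apply/andP; split; nra.
  have b2 : `|(expR X - 1) * Y| <= 2 * X ^+ 2 + 2 * Y ^+ 2.
    have b3 : `|expR X - 1| <= 2 * `|X|.
      have : `|expR X - 1| <= `|expR X - 1 - X| + `|X|.
        by rewrite -{1}[expR X - 1](subrK X) ler_normD.
      have hx2 : 2 * X ^+ 2 <= `|X|.
        by have := normr_ge0 X; rewrite -real_normK ?num_real //; have : `|X| <= 1/2 by [rewrite ler_norml; apply/andP; split]; nra.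
      have : `|expR X - 1 - X| <= 2 * X ^+ 2 by rewrite ler_norml; apply/andP; split.
      lra.
    rewrite normrM; apply: (le_trans (ler_wpM2r (normr_ge0 Y) b3)).
    rewrite -(real_normK (num_real X)) -(real_normK (num_real Y)).
    have := normr_ge0 X; have := normr_ge0 Y; nra.
  by apply: (le_trans (ler_normD _ _)); lra.
by have := sqr_ge0 X; have := sqr_ge0 Y; lra.
Qed.

End Lipschitz.

(** * Absolute convergence of lattice sums of weight 3 *)

Section LatticeSummability.
Variable R : realType.
Local Notation C := R[i].
Implicit Types (w z t : C).

Lemma sums_le_inj (T U : choiceType) (h : T -> U) (u : U -> R) M :
  injective h -> sums_le u M -> sums_le (u \o h) M.
Proof.
move=> hi hu A; apply: le_trans (hu [fset h x | x in A]%fset).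
by rewrite big_imfset //= => x y _ _; apply: hi.
Qed.

(** The weight [(n+1)^(-3/2)]: splitting an exponent 3 evenly between the two coordinates bounds a
    lattice sum by a product of two convergent series. *)
Definition wt (n : nat) : R := (n.+1%:R * Num.sqrt n.+1%:R)^-1.

Lemma wt_ge0 n : 0 <= wt n.
Proof. by rewrite invr_ge0 mulr_ge0 ?sqrtr_ge0. Qed.

Lemma sums_le_wt : sums_le wt 3.
Proof.
apply: sums_le_nat => [n|n]; first exact: wt_ge0.
(* Telescoping: each weight is at most the corresponding difference of [2 / sqrt]. *)
have main m : \sum_(i < m.+1) wt i <= 3 - 2 / Num.sqrt m.+1%:R.
  elim: m => [|m IH]; first by rewrite big_ord_recl big_ord0 /wt /= sqrtr1 mulr1 invr1; lra.
  rewrite big_ord_recr /=; apply: (le_trans (lerD IH (lexx _))).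
  rewrite /wt; set a := Num.sqrt m.+1%:R; set b := Num.sqrt m.+2%:R.
  have a0 : 0 < a by rewrite sqrtr_gt0.
  have b0 : 0 < b by rewrite sqrtr_gt0.
  have a2 : a ^+ 2 = m.+1%:R by rewrite sqr_sqrtr.
  have b2 : b ^+ 2 = m.+2%:R by rewrite sqr_sqrtr.
  have ab : b ^+ 2 = a ^+ 2 + 1 by rewrite a2 b2 -natr1.
  have leab : a <= b by rewrite ler_sqrt // ler_nat.
  rewrite -b2 -subr_ge0.
  have -> : 3 - 2 / b - (3 - 2 / a + (b ^+ 2 * b)^-1) = (2 * (b - a) * (b + a) * b ^+ 2 - a * (b + a)) / (a * (b + a) * b ^+ 3).
    by field; rewrite !gt_eqF // addr_gt0.
  rewrite divr_ge0 //; last by rewrite ltW // !mulr_gt0 ?addr_gt0 // exprn_gt0.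
  have -> : 2 * (b - a) * (b + a) = 2 * (b ^+ 2 - a ^+ 2) by ring.
  by rewrite ab; nra.
case: n => [|n]; first by rewrite big_ord0.
by apply: (le_trans (main n)); rewrite gerBl divr_ge0 ?sqrtr_ge0.
Qed.

Definition wtz (k : int) : R := wt `|k|%N.

Lemma sums_le_wtz : sums_le wtz (2 * 3).
Proof.
pose h (k : int) : bool * nat := (k < 0, `|k|%N).
have hi : injective h.
  move=> x y [s a]; move: s a; case: (lerP 0 x) => x0; case: (lerP 0 y) => y0 //= _ a.
    by rewrite -(gez0_abs x0) -(gez0_abs y0) a.
  by apply: oppr_inj; rewrite -(ltz0_abs x0) -(ltz0_abs y0) a.
have hb : sums_le (fun=> 1 : R) (2 : R) (T := bool).
  move=> A; rewrite big_const_seq count_predT iter_addr_0.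
  rewrite ler_nat; have := card_uniqP (fset_uniq A); have := max_card (mem (enum_fset A)).
  by rewrite card_bool => + <-.
have := sums_le_prod (fun=> ler01) wt_ge0 (ler0n _ 3) hb sums_le_wt.
move/(sums_le_inj hi); apply: sums_le_cmp => k /=.
by rewrite mul1r.
Qed.

Lemma wtM (a b : nat) (X : R) : a.+1%:R <= X -> b.+1%:R <= X -> (X ^+ 3)^-1 <= wt a * wt b.
Proof.
move=> aX bX; rewrite /wt -invfM.
have a0 : (0 : R) < a.+1%:R by []. have b0 : (0 : R) < b.+1%:R by [].
have X0 : 0 < X by apply: lt_le_trans aX.
rewrite lef_pV2 ?posrE ?exprn_gt0 ?mulr_gt0 ?sqrtr_gt0 //.
set s := Num.sqrt a.+1%:R; set t := Num.sqrt b.+1%:R.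
have s0 : 0 <= s by apply: sqrtr_ge0. have t0 : 0 <= t by apply: sqrtr_ge0.
have st : s * t <= X.
  rewrite -(@ler_pXn2r _ 2) ?nnegrE ?mulr_ge0 ?(ltW X0) // exprMn !sqr_sqrtr //.
  by rewrite expr2 ler_pM.
have -> : a.+1%:R * s * (b.+1%:R * t) = (a.+1%:R * b.+1%:R) * (s * t) by ring.
rewrite exprSr ler_pM ?mulr_ge0 //.
by rewrite expr2 ler_pM.
Qed.

(** As [Im t > 0], there is [c] with [|m| + |n| <= c |m t + n|]. For [(m, n)] nonzero both [|m| + 1]
    and [|n| + 1] are then at most [2 c |m t + n|], and [wtM] splits the cube. *)
Lemma lattice_bound t : 0 < Im t -> exists2 K, 0 <= K &
  forall m n : int, nc ((m%:~R * t + n%:~R) ^+ 3)^-1 <= K * (wtz m * wtz n).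
Proof.
move=> y0; pose c := ((Im t)^-1 + 1 + `|Re t| / Im t).
have yi : 0 < (Im t)^-1 by rewrite invr_gt0.
have c0 : 0 < c by rewrite /c -addrA ltr_wpDr // addr_ge0 // divr_ge0 // ltW.
exists ((2 * c) ^+ 3); first by rewrite exprn_ge0 // mulr_ge0 // ltW.
move=> m n; rewrite ncV ncX.
set z := m%:~R * t + n%:~R.
have [->|z0] := eqVneq z 0.
  by rewrite nc0 expr0n invr0 mulr_ge0 ?exprn_ge0 ?mulr_ge0 ?wt_ge0 // ltW.
have nz : 0 < nc z by rewrite nc_gt0.
have hz : `|m%:~R : R| + `|n%:~R : R| <= c * nc z.
  have Rez : Re z = m%:~R * Re t + n%:~R.
    rewrite /z -!(rmorph_int (real_complex R)) /=; case: (t) => a b /=.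
    by rewrite mul0r subr0.
  have Imz : Im z = m%:~R * Im t.
    rewrite /z -!(rmorph_int (real_complex R)) /=; case: (t) => a b /=.
    by rewrite mul0r !addr0.
  have h1 : `|m%:~R : R| <= nc z / Im t.
    by rewrite ler_pdivlMr // -[X in _ * X]gtr0_norm // -normrM -Imz nc_Im.
  have h2 : `|n%:~R : R| <= nc z + `|m%:~R| * `|Re t|.
    have -> : n%:~R = Re z - m%:~R * Re t by rewrite Rez; ring.
    by rewrite (le_trans (ler_normB _ _)) // normrM lerD2r nc_Re.
  apply: (le_trans (lerD h1 h2)).
  have h3 : `|m%:~R : R| * `|Re t| <= nc z / Im t * `|Re t| by rewrite ler_wpM2r.
  apply: (le_trans (lerD (lexx _) (lerD (lexx _) h3))).
  by rewrite /c le_eqVlt; apply/orP; left; apply/eqP; field; rewrite gt_eqF.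
have mn : 1 <= `|m%:~R : R| + `|n%:~R : R|.
  rewrite -!intr_norm -rmorphD /= -[1]/(1%:~R) ler_int.
  have : (m != 0) || (n != 0).
    rewrite -negb_and; apply: contra z0 => /andP[/eqP m0 /eqP n0].
    by rewrite /z m0 n0 mul0r addr0.
  by lia.
have abs1 (k : int) : `|k|%N.+1%:R = `|k%:~R| + 1 :> R.
  by rewrite -natr1 natr_absz intr_norm.
have hm : `|m|%N.+1%:R <= 2 * c * nc z by rewrite abs1; have := normr_ge0 (n%:~R : R); lra.
have hn : `|n|%N.+1%:R <= 2 * c * nc z by rewrite abs1; have := normr_ge0 (m%:~R : R); lra.
have := wtM hm hn; rewrite exprMn invfM ler_pdivrMl ?exprn_gt0 ?mulr_gt0 //.
Qed.

Definition wtzz (z : int * int) := wtz z.1 * wtz z.2.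

Lemma sums_le_wtzz : sums_le wtzz (2 * 3 * (2 * 3)).
Proof.
have N0 : 0 <= 2 * 3 :> R by rewrite mulr_ge0.
exact: (sums_le_prod (fun x => wt_ge0 _) (fun x => wt_ge0 _) N0 sums_le_wtz sums_le_wtz).
Qed.

(** The sum of [f(m, n) (m t + n)^(-3)] over the whole lattice; the origin contributes 0 because the
    inverse of 0 is 0. *)
Definition lat (f : int -> int -> C) t := csum (fun z : int * int => f z.1 z.2 * ((z.1%:~R * t + z.2%:~R) ^+ 3)^-1).

Lemma lat_has f t : 0 < Im t -> (forall m n, nc (f m n) <= 1) ->
  has_sum (fun z : int * int => f z.1 z.2 * ((z.1%:~R * t + z.2%:~R) ^+ 3)^-1) (lat f t).
Proof.
move=> t0 f1; have [K K0 hK] := lattice_bound t0.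
apply: csum_has (sums_le_cmp _ (sums_leZ K0 sums_le_wtzz)) => -[m n] /=.
by rewrite ncM (le_trans _ (hK m n)) // ler_piMl ?nc_ge0.
Qed.

Lemma row_has f t : 0 < Im t -> (forall n : int, nc (f n) <= 1) -> exists s,
  has_sum (fun n : int => f n * ((t + n%:~R) ^+ 3)^-1) s.
Proof.
move=> t0 f1; have [K K0 hK] := lattice_bound t0.
have K0' : 0 <= K * wtz 1 by rewrite mulr_ge0 ?wt_ge0.
apply: (has_sum_ex (M := K * wtz 1 * (2 * 3))).
apply: sums_le_cmp (sums_leZ K0' sums_le_wtz) => n /=.
rewrite ncM -[t in X in _ * X <= _]mul1r (le_trans _ (le_trans (hK 1 n) _)) //; last by rewrite mulrA.
by rewrite ler_piMl ?nc_ge0.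
Qed.

End LatticeSummability.

(** * The Lipschitz formula in weight 3 *)

Section LipschitzFormula.
Variable R : realType.
Local Notation C := R[i].
Implicit Types (w z t v : C).

Definition sq2 : fps C := FPS (fun n => n%:R ^+ 2).

Lemma tame_sq2 : tame sq2.
Proof.
apply: (@tame_growth _ _ 2 1) => n; rewrite mul1r /= ncX nc_nat.
by rewrite lerXn2r ?nnegrE // ler_nat.
Qed.

Lemma ev_sq2 (q : C) : nc q < 1 -> (1 - q) ^+ 3 * ev sq2 q = q * (1 + q).
Proof.
move=> q1.
have t1 : tame (1 - fps_X 1 : fps C) by apply: tameB; [exact: tame1|exact: tame_X].
have E : (1 - fps_X 1) ^+ 3 * sq2 = fps_X 1 * (1 + fps_X 1).
  have d (f : fps C) n : ((1 - fps_X 1) * f) n = f n - (if n is m.+1 then f m else 0).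
    by rewrite mulrBl mul1r fpsBE fps_XM; case: n => [|n] //=; rewrite subSS subn0.
  apply/fpsP => n; rewrite !exprS expr0 mulr1 -!mulrA.
  case: n => [|[|[|n]]]; by rewrite fps_XM !d /= ?fps1E /=; ring.
have tq : tame sq2 := tame_sq2.
have tX : tame (fps_X 1 : fps C) by exact: tame_X.
have e1 : ev (1 - fps_X 1) q = 1 - q by rewrite evB ?ev1 ?ev_X ?expr1 //; exact: tame1.
have e2 : ev (1 + fps_X 1) q = 1 + q by rewrite evD ?ev1 ?ev_X ?expr1 //; exact: tame1.
have := congr1 (fun f => ev f q) E; rewrite /= !evM ?evX ?e1 ?e2 ?ev_X ?expr1 //.
- exact: tameM.
- exact: tameX.
- by apply: tameD => //; exact: tame1.
Qed.

(** Supplies the majorant for the passage to the limit in [lipschitz_strip]. With [e = |ee z|] and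
    [u = pi Re z], one has [|1 - ee z|^2 = (1 - e)^2 + 4 e sin(u)^2]: the first term controls
    [Im z], the second [Re z]. *)
Lemma ee_lower z : `|Re z| <= 1 / 2 -> 0 <= Im z -> Im z <= 1 ->
  expR (- (2 * pi)) * nc z <= nc (1 - ee z).
Proof.
move=> x12 y0 y1.
set r := expR (- (2 * pi)).
have r0 : 0 < r by apply: expR_gt0.
have p3 := pi_ge3 R.
rewrite -(@ler_pXn2r _ 2) ?nnegrE ?nc_ge0 ?mulr_ge0 ?nc_ge0 ?(ltW r0) //.
rewrite exprMn !nc_sqr.
case: z x12 y0 y1 => x y /=.
wlog x0 : x / 0 <= x.
  move=> H; have [/H//|x0] := lerP 0 x => hx y0 y1.
  have := H (- x); rewrite oppr_ge0 normrN sqrrN mulrN cosN sinN mulrN opprK.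
  by rewrite add0r sub0r sqrrN => HH; apply: HH => //; exact: ltW.
rewrite (ger0_norm x0) => x12 y0 y1.
set e := expR (- (2 * pi * y)); set u := pi * x.
have e0 : 0 < e by apply: expR_gt0.
have re : r <= e by rewrite ler_expR lerN2; nra.
have e1 : e * (1 + 2 * pi * y) <= 1.
  have := expR_ge1Dx (2 * pi * y); rewrite -(ler_pM2l e0) => /le_trans; apply.
  by rewrite /e mulrC expRxMexpNx_1.
have uE : 2 * pi * x = u *+ 2 by rewrite /u mulr2n; ring.
have cs := cos2Dsin2 u.
have su : x / 2 <= sin u.
  have [->|xn] := eqVneq x 0.
    rewrite /u; have [->|xn] := eqVneq x 0; last first.
      rewrite mul0r; apply: sin_ge0_pi; rewrite mulr_ge0 ?pi_ge0 //=; nra.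
    by rewrite mulr0 mul0r sin0.
  have xp : 0 < x by rewrite lt_neqAle eq_sym xn.
  have u2 : 0 < u / 2 by rewrite /u divr_gt0 // mulr_gt0 // pi_gt0.
  have pl4 : pi / 2 < 2 :> R := pihalf_lt2 R.
  have hc c : 0 <= c -> c <= u / 2 -> 1 / 2 <= cos c.
    move=> c0 cu; have := cos_ge c0.
    have : c <= 1 by rewrite /u in cu; nra.
    nra.
  have -> : sin u = 2 * cos (u / 2) * sin (u / 2).
    by rewrite {1}(_ : u = (u / 2) *+ 2) ?sin_mulr2n ?mulr2n -?splitr //; ring.
  have [c /andP[c0 cu] ->] := sin_mvt u2.
  have h1 := hc c (ltW c0) (ltW cu); have h2 := hc (u / 2) (ltW u2) (lexx _).
  have h3 : 1 / 4 <= cos (u / 2) * cos c by nra.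
  have -> : 2 * cos (u / 2) * (cos c * (u / 2)) = (cos (u / 2) * cos c) * u by field.
  apply: (@le_trans _ _ (1 / 4 * u)); first by rewrite /u; nra.
  by rewrite ler_wpM2r //; lra.
have e1' : e <= 1.
  by rewrite /e expR_le1 oppr_le0 mulr_ge0 // mulr_ge0 // pi_ge0.
rewrite uE cos_mulr2n sin_mulr2n.
have -> : (1 - e * (cos u ^+ 2 *+ 2 - 1)) ^+ 2 + (0 - e * ((cos u * sin u) *+ 2)) ^+ 2 =
   (1 - e) ^+ 2 + 4 * e * sin u ^+ 2 + 4 * e * (e * cos u ^+ 2 - 1) * (cos u ^+ 2 + sin u ^+ 2 - 1).
  by rewrite !mulr2n; ring.
rewrite cs subrr mulr0 addr0.
have h1 : (r * y) ^+ 2 <= (1 - e) ^+ 2.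
  have a0 : 0 <= r * y by rewrite mulr_ge0 // ltW.
  have : r * y <= 1 - e.
    have : r * y <= e * y by rewrite ler_wpM2r.
    have : 0 <= e * y by rewrite mulr_ge0 // ltW.
    nra.
  by move=> h; rewrite lerXn2r ?nnegrE //; lra.
have h2 : (r * x) ^+ 2 <= 4 * e * sin u ^+ 2.
  have : (x / 2) ^+ 2 <= sin u ^+ 2 by rewrite lerXn2r ?nnegrE //; lra.
  have : r ^+ 2 <= e by nra.
  rewrite exprMn => a b; have := sqr_ge0 x.
  nra.
by rewrite mulrDr -!exprMn addrC lerD.
Qed.

Lemma clim_sub (u : nat -> C) l (s : nat -> nat) : (forall n, (n <= s n)%N) ->
  clim u l -> clim (u \o s) l.
Proof.
by move=> hs h e e0; have [N hN] := h e e0; exists N => n hn; apply: hN; apply: leq_trans (hs n).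
Qed.

Lemma archi_small (K e : R) : 0 < e -> exists N, forall n, (N <= n)%N -> K / n.+1%:R < e.
Proof.
move=> e0; exists (Num.bound (`|K| / e)) => n hn.
rewrite ltr_pdivrMr // mulrC -ltr_pdivrMr //.
apply: (@le_lt_trans _ _ (`|K| / e)); first by rewrite ler_pM2r ?invr_gt0 // ler_norm.
apply: (lt_le_trans (archi_boundP _)); first by rewrite divr_ge0 // ltW.
by rewrite ler_nat (leq_trans hn).
Qed.

Lemma clim_inv : clim (fun n => n.+1%:R^-1) (0 : C).
Proof.
apply: (clim_small (b := fun n => 1 / n.+1%:R)) => [n|e /(archi_small 1)//].
by rewrite subr0 ncV nc_nat div1r.
Qed.

Lemma clim_ee v : clim (fun n => n.+1%:R * (ee (v / n.+1%:R) - 1)) (twopii R * v).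
Proof.
pose K := nc (twopii R * v); have K0 : 0 <= K by apply: nc_ge0.
move=> e e0; have [N hN] := archi_small (6 * K ^+ 2) e0.
have [N' hN'] := archi_small K (divr_gt0 ltr01 (ltr0n R 2)).
exists (maxn N N') => n; rewrite geq_max => /andP[/hN h /hN' h'].
have n0 : (n.+1%:R : C) != 0 by rewrite pnatr_eq0.
have E : nc (twopii R * (v / n.+1%:R)) = K / n.+1%:R by rewrite mulrA ncM ncV nc_nat.
have := @ee_lin R (v / n.+1%:R); rewrite E => /(_ (ltW h')) hl.
have -> : n.+1%:R * (ee (v / n.+1%:R) - 1) - twopii R * v =
  n.+1%:R * (ee (v / n.+1%:R) - 1 - twopii R * (v / n.+1%:R)).
  by rewrite [RHS]mulrBr [X in _ = _ - X]mulrCA [n.+1%:R * (v / _)]mulrC divfK.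
rewrite ncM nc_nat; apply: le_lt_trans h.
apply: (le_trans (ler_wpM2l (ler0n _ _) hl)).
have nR : (n.+1%:R : R) != 0 by rewrite pnatr_eq0.
by rewrite le_eqVlt; apply/orP; left; apply/eqP; move: (n.+1%:R : R) nR => m nR; field.
Qed.

Lemma clim_ee1 v : clim (fun n => ee (v / n.+1%:R)) 1.
Proof.
have := climD (climM clim_inv (clim_ee v)) (clim_const 1).
rewrite mul0r add0r; apply: eq_clim => n.
by rewrite mulrA mulVf ?pnatr_eq0 // mul1r subrK.
Qed.

Lemma twopii_neq0 : twopii R != 0.
Proof.
apply/eqP => h; have := congr1 Im h => /= /eqP.
by rewrite mulf_eq0 pnatr_eq0 /= gt_eqF ?pi_gt0.
Qed.

(** The constant [(-2 i pi)^3 / 2!] of the Lipschitz formula. *)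
Definition kap : C := - (twopii R ^+ 3 / 2).

Lemma kap_neq0 : kap != 0.
Proof. by rewrite oppr_eq0 mulf_neq0 ?invr_eq0 ?pnatr_eq0 // expf_neq0 // twopii_neq0. Qed.

(* The Lipschitz formula follows by averaging over N-fold division and letting N go
   to infinity. *)
Lemma sq2_average (N : nat) : (0 < N)%N ->
  \sum_(i < N) fps_scale (ee (i%:R / N%:R)) sq2 = fps_const (N%:R ^+ 3) * fps_subst N sq2.
Proof.
move=> N0; apply/fpsP => n; rewrite fps_sumE fps_constM /=.
rewrite -mulr_suml sum_roots //; case: ifP => [/dvdnP[m ->]|_]; last by rewrite mul0r mulr0.
by rewrite mulnK // natrM; ring.
Qed.

Lemma nc_ee_frac (i N : nat) : nc (ee (i%:R / N%:R : C)) = 1.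
Proof.
rewrite nc_ee (_ : (i%:R / N%:R : C) = ((i%:R / N%:R : R)%:C)%C) /= ?mulr0 ?oppr0 ?expR0 //.
by rewrite rmorphM /= fmorphV /= !rmorph_nat.
Qed.

Lemma Im_divn w (n : nat) : Im (w / n.+1%:R) = Im w / n.+1%:R.
Proof.
rewrite (_ : w / n.+1%:R = w * ((n.+1%:R^-1 : R)%:C)%C); last by rewrite fmorphV /= rmorph_nat.
by case: w => a b /=; rewrite mulr0 add0r.
Qed.

Lemma Re_divn w (n : nat) : Re (w / n.+1%:R) = Re w / n.+1%:R.
Proof.
rewrite (_ : w / n.+1%:R = w * ((n.+1%:R^-1 : R)%:C)%C); last by rewrite fmorphV /= rmorph_nat.
by case: w => a b /=; rewrite mulr0 subr0.
Qed.

Lemma Im_Dint w (k : int) : Im (w + k%:~R) = Im w.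
Proof. by rewrite -(rmorph_int (real_complex R)); case: w => a b /=; rewrite addr0. Qed.

Lemma Re_Dint w (k : int) : Re (w + k%:~R) = Re w + k%:~R.
Proof. by rewrite -(rmorph_int (real_complex R)); case: w => a b /=. Qed.

Lemma scaled_fraction (F : fieldType) (m E : F) : m != 0 -> 1 - E != 0 ->
  (m ^+ 3)^-1 * (E * (1 + E) / (1 - E) ^+ 3) = E * (1 + E) / (-1 * (m * (E - 1))) ^+ 3.
Proof.
move=> m0 E0; have -> : -1 * (m * (E - 1)) = m * (1 - E) by ring.
by field; rewrite m0 E0.
Qed.

Lemma lipschitz_strip w : 0 < Im w -> `|Re w| <= 1 / 2 ->
  has_sum (fun n : int => ((w + n%:~R) ^+ 3)^-1) (kap * ev sq2 (ee w)).
Proof.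
move=> y0 x12.
pose M0 := Num.bound (Im w).
(* The number of division points is the odd number [2 (M + M0) + 1], so that [k] runs over a
   symmetric interval and [|Re z| <= 1/2]; the margin [M0 > Im w] ensures [Im z <= 1], as [ee_lower]
   demands. *)
have hM0 : Im w < M0%:R by apply: archi_boundP; apply: ltW.
pose sg M := (2 * (M + M0))%N.
pose F (M : nat) (k : int) : C := if (`|k| <= M + M0)%N then
   ((sg M).+1%:R ^+ 3)^-1 * ev sq2 (ee ((w + k%:~R) / (sg M).+1%:R)) else 0.
have [s hs] : exists s, has_sum (fun n : int => ((w + n%:~R) ^+ 3)^-1) s.
  have [|s hs] := @row_has R (fun=> 1) w y0; first by rewrite nc1.
  by exists s; apply: eq_has_sum hs => n; rewrite mul1r.
have Fs M : has_sum (F M) (ev sq2 (ee w)).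
  apply: (@has_sum_push _ _ _ _ (fun i : 'I_(sg M).+1 => i%:Z - (M + M0)%:Z)).
  - by move=> i j /addIr [] /val_inj.
  - move=> k; rewrite /F; case: leqP => [hk _|_]; last by rewrite eqxx.
    have hi : (absz ((k : int) + (M + M0)%:Z)%R < (sg M).+1)%N by rewrite /sg; lia.
    by exists (Ordinal hi) => /=; lia.
  pose x := ee ((w + (- (M + M0)%:Z)%:~R) / (sg M).+1%:R).
  have n0 : ((sg M).+1%:R : C) != 0 by rewrite pnatr_eq0.
  have x1 : nc x < 1.
    apply: ee_lt1; rewrite Im_divn Im_Dint.
    by rewrite divr_gt0.
  have xN : x ^+ (sg M).+1 = ee w.
    by rewrite -ee_mul mulrC divfK // ee_Dint.
  have -> : ev sq2 (ee w) = \sum_(i < (sg M).+1) (F M \o (fun i : 'I_(sg M).+1 => i%:Z - (M + M0)%:Z)) i.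
    rewrite -xN -ev_subst //; last exact: tame_sq2.
    have tS : tame (fps_subst (sg M).+1 sq2) by apply: tame_subst => //; exact: tame_sq2.
    have -> : ev (fps_subst (sg M).+1 sq2) x = ((sg M).+1%:R ^+ 3)^-1 * ev (fps_const ((sg M).+1%:R ^+ 3) * fps_subst (sg M).+1 sq2) x.
      by rewrite evM ?ev_const // ?mulKf ?expf_neq0 //; exact: tame_const.
    rewrite -sq2_average // ev_sum => [|i _|//]; last first.
      by apply: tame_scale; rewrite ?nc_ee_frac //; exact: tame_sq2.
    rewrite mulr_sumr; apply: eq_bigr => i _; rewrite /F /= ev_scale.
    have -> : (absz (i%:Z - (M + M0)%:Z)%R <= M + M0)%N by have := ltn_ord i; rewrite /sg; lia.
    rewrite -eeD; congr (_ * ev _ (ee _)).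
    by rewrite -mulrDl addrCA; congr ((w + _) / _); rewrite [RHS]rmorphD.
  exact: has_sum_finT.
have c1 : nc (kap^-1) <> 0 by apply/eqP; rewrite nc_eq0 invr_eq0 kap_neq0.
have lim : clim (fun=> ev sq2 (ee w)) (kap^-1 * s).
  pose B : R := 2 * (expR (- (2 * pi)) ^+ 3)^-1.
  have [K K0 hK] := lattice_bound y0.
  have Bge0 : 0 <= B by rewrite mulr_ge0 // invr_ge0 exprn_ge0 // expR_ge0.
  have BK0 : 0 <= B * (K * wtz R 1) by rewrite mulr_ge0 // mulr_ge0 ?wt_ge0.
  apply: (@tannery _ _ F (fun k : int => kap^-1 * ((w + k%:~R) ^+ 3)^-1) (fun k => B * (K * wtz R 1) * wtz R k) _ _ _ _ (sums_leZ BK0 (sums_le_wtz R))) => //.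
  - move=> M k.
    apply: (@le_trans _ _ (B * nc ((w + k%:~R) ^+ 3)^-1)); last first.
      by have := hK 1 k; rewrite mul1r => h; rewrite -mulrA ler_wpM2l // -mulrA.
    rewrite /F; case: leqP => [hk|_]; last by rewrite nc0 mulr_ge0 ?nc_ge0.
    set N := (sg M).+1; set z := (w + k%:~R) / N%:R.
    have N0 : (0 : R) < N%:R by [].
    have Imz : Im z = Im w / N%:R by rewrite Im_divn Im_Dint.
    have z1 : nc (ee z) < 1 by apply: ee_lt1; rewrite Imz divr_gt0.
    have zl : expR (- (2 * pi)) * nc z <= nc (1 - ee z).
      apply: ee_lower; rewrite ?Imz ?divr_ge0 ?(ltW y0) //; last first.
        rewrite ler_pdivrMr // mul1r (le_trans (ltW hM0)) // ler_nat /N /sg; lia.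
      rewrite Re_divn Re_Dint normrM normfV (gtr0_norm N0) ler_pdivrMr //.
      apply: (le_trans (ler_normD _ _)).
      have : `|k%:~R : R| <= (M + M0)%:R by rewrite -intr_norm -natr_absz ler_nat.
      have NE : N%:R = 2 * (M + M0)%:R + 1 :> R by rewrite /N /sg -[LHS]natr1 natrM.
      by rewrite NE => h; lra.
    have z0 : 0 < nc z by rewrite nc_gt0 Im_gt0_neq0 // Imz divr_gt0.
    have d0 : 0 < expR (- (2 * pi)) * nc z :> R by rewrite mulr_gt0 ?expR_gt0.
    have d1 : 0 < nc (1 - ee z) by apply: lt_le_trans zl.
    have e : ev sq2 (ee z) = ee z * (1 + ee z) / (1 - ee z) ^+ 3.
      by rewrite -ev_sq2 // mulrC mulKf // expf_neq0 // -nc_gt0.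
    rewrite e !ncM !ncV !ncX nc_nat.
    have h1 : nc (ee z) * nc (1 + ee z) <= 2.
      have := ncD 1 (ee z); rewrite nc1; have := nc_ge0 (ee z); have := nc_ge0 (1 + ee z); nra.
    have h2 : (nc (1 - ee z) ^+ 3)^-1 <= ((expR (- (2 * pi)) * nc z) ^+ 3)^-1.
      by rewrite lef_pV2 ?posrE ?exprn_gt0 // lerXn2r ?nnegrE ?nc_ge0 // ltW.
    have h3 : nc (ee z) * nc (1 + ee z) / nc (1 - ee z) ^+ 3 <= 2 / (expR (- (2 * pi)) * nc z) ^+ 3.
      by rewrite ler_pM // ?mulr_ge0 ?nc_ge0 // invr_ge0 exprn_ge0 // nc_ge0.
    have h4 := ler_wpM2l (_ : 0 <= (N%:R ^+ 3)^-1) h3.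
    apply: (le_trans (h4 _)); first by rewrite invr_ge0 exprn_ge0.
    rewrite /z ncM ncV nc_nat /B le_eqVlt; apply/orP; left; apply/eqP.
    have w0 : nc (w + k%:~R) != 0 by rewrite nc_eq0 Im_gt0_neq0 // Im_Dint.
    have ex0 : expR (- (2 * pi)) != 0 :> R by rewrite gt_eqF ?expR_gt0.
    by field; rewrite w0 ex0 gt_eqF.
  - move=> k; set v := w + k%:~R.
    have v0 : v != 0 by rewrite Im_gt0_neq0 // Im_Dint.
    have hsg n : (n <= sg n)%N by rewrite /sg; lia.
    have l1 := clim_sub hsg (clim_ee v); have l2 := clim_sub hsg (clim_ee1 v).
    have tv : - (twopii R * v) != 0 by rewrite oppr_eq0 mulf_neq0 ?twopii_neq0.
    have l3 := climM (clim_const (-1)) l1.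
    have l3' : (- 1 * (twopii R * v)) ^+ 3 != 0 by rewrite mulN1r expf_neq0.
    have l4 := climM (climM l2 (climD (clim_const 1) l2)) (climV l3' (climX 3 l3)).
    move=> e e0; have [N hN] := l4 e e0; exists (maxn N `|k|) => n.
    rewrite geq_max => /andP[/hN h kn].
    rewrite /F (_ : (`|k| <= n + M0)%N); last by rewrite (leq_trans kn) ?leq_addr.
    move: h => /=; set N1 := (sg n).+1; set z := v / N1%:R.
    have Imz : Im z = Im w / N1%:R by rewrite Im_divn Im_Dint.
    have y1 : 0 < Im z by rewrite Imz divr_gt0.
    have z1 : nc (ee z) < 1 by apply: ee_lt1.
    have d1 : 1 - ee z != 0.
      rewrite subr_eq0; apply: contraTneq z1 => <-; by rewrite nc1 ltxx.
    have n0 : (N1%:R : C) != 0 by rewrite pnatr_eq0.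
    have -> : ev sq2 (ee z) = ee z * (1 + ee z) / (1 - ee z) ^+ 3.
      by rewrite -ev_sq2 // mulrC mulKf // expf_neq0.
    have -> : kap^-1 / v ^+ 3 = 1 * (1 + 1) / (- 1 * (twopii R * v)) ^+ 3.
      by rewrite /kap; field; rewrite v0 twopii_neq0.
    have -> // : (N1%:R ^+ 3)^-1 * (ee z * (1 + ee z) / (1 - ee z) ^+ 3) =
      ee z * (1 + ee z) / (-1 * (N1%:R * (ee z - 1))) ^+ 3.
    exact: scaled_fraction.
  - exact: has_sumZ.
have E : ev sq2 (ee w) = kap^-1 * s := clim_uniq (clim_const _) lim.
by rewrite E mulVKf ?kap_neq0.
Qed.

Lemma lipschitz w : 0 < Im w ->
  has_sum (fun n : int => ((w + n%:~R) ^+ 3)^-1) (kap * ev sq2 (ee w)).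
Proof.
move=> y0; have [m [h1 h2]] := Re_int_shift w.
have h := lipschitz_strip (w := w + m%:~R); rewrite h2 ee_Dint in h.
have {}h := h y0 h1.
apply: (has_sum_push (h := fun n : int => n + m)) => [x y /addIr//|n _|].
  by exists (n - m); rewrite subrK.
by apply: eq_has_sum h => n; rewrite /comp [n + m]addrC rmorphD addrA.
Qed.

End LipschitzFormula.

(** * Eisenstein series of weight 3 *)

Section Character.

Definition chi (k : int) : int :=
  if (k %% 3)%Z == 1 then 1 else if (k %% 3)%Z == 2 then -1 else 0.

Lemma modz3 (k : int) : [\/ (k %% 3)%Z = 0, (k %% 3)%Z = 1 | (k %% 3)%Z = 2].
Proof.
have h0 := @modz_ge0 k 3 isT; have h1 := @ltz_mod k 3 isT.
have : [|| (k %% 3)%Z == 0, (k %% 3)%Z == 1 | (k %% 3)%Z == 2].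
  by move: h0 h1; case: (k %% 3)%Z => [[|[|[|n]]]|n].
by case/or3P => /eqP ->; [apply: Or31|apply: Or32|apply: Or33].
Qed.

Lemma eq_chi (a b : int) : (a %% 3)%Z = (b %% 3)%Z -> chi a = chi b.
Proof. by rewrite /chi => ->. Qed.

Lemma chiM (a b : int) : chi (a * b) = chi a * chi b.
Proof.
have -> : chi (a * b) = chi ((a %% 3)%Z * (b %% 3)%Z).
  by apply: eq_chi; rewrite modzMml modzMmr.
have -> : chi a * chi b = chi (a %% 3)%Z * chi (b %% 3)%Z.
  by congr (_ * _); apply: eq_chi; rewrite modz_mod.
by case: (modz3 a) => ->; case: (modz3 b) => ->.
Qed.

Lemma chiN (a : int) : chi (- a) = - chi a.
Proof. by rewrite -mulN1r chiM -[chi (-1)]/(-1) mulN1r. Qed.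

Lemma chi0 : chi 0 = 0. Proof. by []. Qed.

Lemma chi_dvd (a : int) : (3 %| a)%Z -> chi a = 0.
Proof. by rewrite /chi => /dvdz_mod0P ->. Qed.

Lemma chi_Dmul (a b : int) : chi (a + 3 * b) = chi a.
Proof. by apply: eq_chi; rewrite mulrC addrC modzMDl. Qed.

Lemma chi_sq (a : int) : ~~ (3 %| a)%Z -> chi a * chi a = 1.
Proof.
move=> h; rewrite /chi; case: (modz3 a) => E; rewrite E //.
by move: h; rewrite (introT dvdz_mod0P E).
Qed.

Lemma chi_norm (a : int) : `|chi a| <= 1.
Proof. by rewrite /chi; case: (modz3 a) => ->. Qed.

End Character.

Section Lambert.

(** The Lambert series [sum a_m b_d X^(m d)] over [m >= 1]. The ranges of [m] and [d] contain every
    factorization of a positive [n], and the constant coefficient is an empty sum. *)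
Definition lamb (k : comNzRingType) (a b : nat -> k) : fps k :=
  FPS (fun n => \sum_(m < n) \sum_(d < n.+1 | (m.+1 * d == n)%N) a m.+1 * b d).

(* In the notation of the Borweins, [27 ys = c(q)^3], [Bs = b(q)^3] and, below,
   [ss = a(q)^3]. *)
Definition ys : fps int := lamb (fun m => chi m) (fun d => d%:R ^+ 2).
Definition bs : fps int := lamb (fun m => 1) (fun d => chi d * d%:R ^+ 2).
Definition Bs : fps int := 1 - fps_const 9 * bs.

Lemma lamb_map (k k' : comNzRingType) (phi : {rmorphism k -> k'}) (a b : nat -> k) :
  fps_map phi (lamb a b) = lamb (phi \o a) (phi \o b).
Proof.
apply/fpsP => n /=; rewrite rmorph_sum; apply: eq_bigr => m _.
by rewrite rmorph_sum; apply: eq_bigr => d _; rewrite rmorphM.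
Qed.

End Lambert.

(** Series are kept over the integers and transported to [C] for analysis, to [F_p] for reduction
    and to binary integers for computation. *)
Definition fz (k : comNzRingType) : fps int -> fps k := fps_map (intmul 1 : {rmorphism int -> k}).

Section Expansions.
Variable R : realType.
Local Notation C := R[i].
Implicit Types (w z t q : C).

Lemma lambert_ev (a b : nat -> C) q : nc q < 1 -> (forall m, nc (a m) <= 1) ->
  (forall d, nc (b d) <= d%:R ^+ 2) ->
  has_sum (fun m => a m.+1 * ev (FPS b) (q ^+ m.+1)) (ev (lamb a b) q).
Proof.
move=> q1 ha hb.
have b0 : b 0%N = 0.
  by apply/eqP; rewrite -nc_eq0 eq_le nc_ge0 andbT; have := hb 0%N; rewrite expr0n.
have tb : tame (FPS b).
  apply: (@tame_growth _ _ 2 1) => d; rewrite mul1r (le_trans (hb d)) //.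
  by rewrite lerXn2r ?nnegrE // ler_nat.
pose F (z : nat * nat) := a z.1.+1 * (b z.2 * q ^+ (z.1.+1 * z.2)).
have q0 := nc_ge0 q.
have [s hs] : exists s, has_sum F s.
  have [M M0 hM] := ev_bound (@tame_sq2 R) q1.
  have v0 d : 0 <= nc (sq2 R d * q ^+ d) by apply: nc_ge0.
  have u0 m : 0 <= nc q ^+ m by apply: exprn_ge0.
  apply: (has_sum_ex (sums_le_cmp _ (sums_le_prod u0 v0 M0 (sums_le_geo q0 q1) hM))) => -[m d].
  rewrite /F /= !ncM !ncX nc_nat.
  apply: (@le_trans _ _ (1 * (d%:R ^+ 2 * nc q ^+ (m.+1 * d)))).
    by rewrite ler_pM ?mulr_ge0 ?nc_ge0 ?exprn_ge0 // ler_wpM2r // exprn_ge0.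
  rewrite mul1r mulrCA; case: d => [|d]; first by rewrite expr0n /= !mul0r.
  rewrite ler_wpM2l ?exprn_ge0 // -exprD; apply: ler_wiXn2l => //; first exact: ltW.
  by rewrite mulSn mulnS addnCA addnA leq_addr.
have h1 : has_sum (fun m => a m.+1 * ev (FPS b) (q ^+ m.+1)) s.
  apply: (has_sum_fiber (h := fst) hs) => m.
  apply: (@has_sum_push _ _ _ _ (fun d : nat => (m, d))) => [x y []//|[u v]|].
    by rewrite /=; case: (u =P m) => [-> _|_]; [exists v|rewrite eqxx].
  have qm : nc (q ^+ m.+1) < 1 by rewrite ncX pow_lt1.
  apply: eq_has_sum (has_sumZ (a m.+1) (ev_has tb qm)) => d.
  by rewrite /= eqxx /F /= exprM.
suff h2 : has_sum (fun n => lamb a b n * q ^+ n) s by rewrite (ev_eq h2).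
apply: (@has_sum_fiber _ _ _ _ (fun z : nat * nat => (z.1.+1 * z.2)%N) _ _ hs) => n.
apply: (@has_sum_push _ _ _ _ (fun z : 'I_n * 'I_n.+1 => (z.1 : nat, z.2 : nat))).
- by move=> [x y] [x' y'] [] /val_inj -> /val_inj ->.
- move=> [m d] /=; case: (_ =P n) => [E|_]; last by rewrite eqxx.
  case: d E => [|d] E; first by rewrite /F /= b0 mul0r mulr0 eqxx.
  move=> _.
  have hm : (m < n)%N by rewrite -E mulnS leq_addr.
  have hd : (d.+1 < n.+1)%N by rewrite ltnS -E leq_pmull.
  by exists (Ordinal hm, Ordinal hd).
have -> : lamb a b n * q ^+ n = \sum_(z : 'I_n * 'I_n.+1) (((fun z : nat * nat => if (z.1.+1 * z.2)%N == n then F z else 0)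
    \o (fun z : 'I_n * 'I_n.+1 => (z.1 : nat, z.2 : nat))) z).
  rewrite /= pair_big_dep /= mulr_suml [LHS]big_mkcond /=; apply: eq_bigr => -[m d] _ /=.
  by case: eqP => // E; rewrite /F /= E mulrA.
exact: has_sum_finT.
Qed.

Lemma even_sum (u : nat -> C) t :
  has_sum (fun n => u n.+1) t -> has_sum (fun k : int => u `|k|%N) (u 0%N + (t + t)).
Proof.
move=> h.
have h0 := @has_sum1 R _ (fun k : int => if k == 0 then u 0%N else 0) 0.
have h0' : has_sum (fun k : int => if k == 0 then u 0%N else 0) (u 0%N).
  by apply: h0 => k /negPf ->.
have h1 : has_sum (fun k : int => if 0 < k then u `|k|%N else 0) t.
  apply: (@has_sum_push _ _ _ _ (fun n : nat => n.+1%:Z)) => [x y []//|k|].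
    case: (ltrP 0 k) => [k0 _|_]; last by rewrite eqxx.
    by exists `|k|.-1%N; lia.
  exact: eq_has_sum h.
have h2 : has_sum (fun k : int => if k < 0 then u `|k|%N else 0) t.
  apply: (@has_sum_push _ _ _ _ (fun n : nat => - n.+1%:Z)) => [x y /oppr_inj []//|k|].
    case: (ltrP k 0) => [k0 _|_]; last by rewrite eqxx.
    by exists `|k|.-1%N; lia.
  exact: eq_has_sum h.
apply: eq_has_sum (has_sumD h0' (has_sumD h1 h2)) => k.
case: (ltrgtP k 0) => [k0|k0|->]; rewrite ?add0r ?addr0 ?eqxx //.
Qed.

Lemma lat_rows (f : int -> int -> C) t (g : int -> C) : 0 < Im t ->
  (forall m n, nc (f m n) <= 1) ->
  (forall m : int, has_sum (fun n : int => f m n * ((m%:~R * t + n%:~R) ^+ 3)^-1) (g m)) ->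
  has_sum g (lat f t).
Proof.
move=> t0 f1 hg; apply: (has_sum_fiber (h := fst) (lat_has t0 f1)) => m.
apply: (@has_sum_push _ _ _ _ (fun n : int => (m, n))) => [x y []//|[u v]|].
  by rewrite /=; case: (u =P m) => [-> _|_]; [exists v|rewrite eqxx].
by apply: eq_has_sum (hg m) => n; rewrite /= eqxx.
Qed.

Lemma nc_int (k : int) : nc (k%:~R : C) = `|k|%:~R.
Proof. by rewrite -(rmorph_int (real_complex R)) nc_real intr_norm. Qed.

Lemma nc_chi (k : int) : nc ((chi k)%:~R : C) <= 1.
Proof. by rewrite nc_int -[1]/(1%:~R) ler_int chi_norm. Qed.

Lemma has_sum0 (T : choiceType) : has_sum (fun _ : T => 0 : C) 0.
Proof. by have := @has_sum_fin R T (fun=> 0) fset0 (fun _ _ => erefl); rewrite big_seq_fset0. Qed.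

Lemma int_termN (c m n : int) t :
  (- c)%:~R * (((- m)%:~R * t + (- n)%:~R) ^+ 3)^-1 = c%:~R * ((m%:~R * t + n%:~R) ^+ 3)^-1.
Proof.
have -> : (- m)%:~R * t + (- n)%:~R = - (m%:~R * t + n%:~R) :> C by rewrite !mulrNz mulNr opprD.
set z := _ + _; have -> : (- z) ^+ 3 = - z ^+ 3 by ring.
by rewrite mulrNz invrN mulrNN.
Qed.

Lemma ev_ys_lambert q : nc q < 1 ->
  has_sum (fun m => (chi m.+1)%:~R * ev (sq2 R) (q ^+ m.+1)) (ev (fz C ys) q).
Proof.
move=> q1; rewrite /fz lamb_map.
have -> : (intmul 1 : {rmorphism int -> C}) \o (fun d : nat => d%:R ^+ 2) = (fun d : nat => d%:R ^+ 2 : C).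
  by apply: funext => d /=; rewrite rmorphXn /= rmorph_nat.
apply: (lambert_ev q1) => [m|d]; first exact: nc_chi.
by rewrite ncX nc_nat.
Qed.

(** Row [m > 0] is the Lipschitz sum at [m t]. Row [-m] equals it, as the character and the weight
    are both odd, and row 0 vanishes with [chi 0]. *)
Lemma lat_ys t : 0 < Im t ->
  lat (fun m _ => (chi m)%:~R) t = 2 * kap R * ev (fz C ys) (ee t).
Proof.
move=> t0.
pose u (m : nat) : C := (chi m)%:~R * (kap R * ev (sq2 R) (ee t ^+ m)).
have hu := has_sumZ (kap R) (ev_ys_lambert (ee_lt1 t0)).
have hrow : has_sum (fun k : int => u `|k|%N) (lat (fun m _ => (chi m)%:~R) t).
  apply: lat_rows => // [m _|m]; first exact: nc_chi.
  have pos (k : nat) : has_sum (fun n : int => (chi k.+1)%:~R * ((k.+1%:R * t + n%:~R) ^+ 3)^-1) (u k.+1).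
    apply: has_sumZ; rewrite -ee_mul; apply: lipschitz.
    by rewrite Im_natM mulr_gt0.
  case: m => [[|k]|k].
  - have -> : u `|0|%N = 0 by rewrite /u /= mul0r.
    by apply: eq_has_sum (has_sum0 _) => n; rewrite mul0r.
  - exact: pos.
  - rewrite NegzE abszN; apply: (@has_sum_push _ _ _ _ (fun n : int => - n)) => [|n _|].
    + exact: oppr_inj.
    + by exists (- n); rewrite opprK.
    apply: eq_has_sum (pos k) => n /=.
    by rewrite chiN int_termN.
have := even_sum (t := kap R * ev (fz C ys) (ee t)) (u := u).
have hu' : has_sum (fun n => u n.+1) (kap R * ev (fz C ys) (ee t)).
  by apply: eq_has_sum hu => m; rewrite /u mulrCA.
move=> /(_ hu') h; rewrite (has_sum_uniq hrow h) /u chi0 mul0r add0r.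
by ring.
Qed.

End Expansions.

Section WeightThree.
Variable R : realType.
Local Notation C := R[i].
Implicit Types (w z t q : C).

Definition om3 : C := ee (1 / 3).

Lemma om3_cube : om3 ^+ 3 = 1.
Proof. by rewrite -ee_mul mulrC divfK ?pnatr_eq0 // ee1. Qed.

Lemma om3_neq1 : om3 != 1.
Proof. exact: (@ee_frac_neq1 R 1 3). Qed.

Lemma om3_sum : om3 ^+ 2 + om3 + 1 = 0.
Proof.
have : (om3 - 1) * (om3 ^+ 2 + om3 + 1) = 0.
  have -> : (om3 - 1) * (om3 ^+ 2 + om3 + 1) = om3 ^+ 3 - 1 by ring.
  by rewrite om3_cube subrr.
by move/eqP; rewrite mulf_eq0 subr_eq0 (negPf om3_neq1) => /eqP.
Qed.

Lemma nc_om3 : nc om3 = 1.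
Proof. exact: (nc_ee_frac R 1 3). Qed.

(** The Gauss sum of [chi], a square root of -3 ([sqrtN3_sq]). *)
Definition sqrtN3 : C := om3 - om3 ^+ 2.

Lemma sqrtN3_neq0 : sqrtN3 != 0.
Proof.
rewrite /sqrtN3 -{1}[om3]mulr1 expr2 -mulrBr mulf_neq0 ?ee_neq0 // subr_eq0 eq_sym.
exact: om3_neq1.
Qed.

Definition chisq : fps C := FPS (fun n => (chi n)%:~R * n%:R ^+ 2).

Lemma nc_chisq n : nc (chisq n) <= n%:R ^+ 2.
Proof. by rewrite /= ncM ncX nc_nat ler_piMl ?exprn_ge0 // nc_chi. Qed.

Lemma tame_chisq : tame chisq.
Proof.
apply: (@tame_growth _ _ 2 1) => n; rewrite mul1r (le_trans (nc_chisq n)) //.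
by rewrite lerXn2r ?nnegrE // ler_nat.
Qed.

Lemma chi_nat3 (m : nat) : [/\ chi (3 * m)%N = 0, chi (3 * m + 1)%N = 1 & chi (3 * m + 2)%N = -1].
Proof.
have E (k : nat) : chi (3 * m + k)%N = chi k.
  by apply: eq_chi; rewrite !modz_nat -modnDml modnMr.
by split; rewrite ?E // -[(3 * m)%N]addn0 E.
Qed.

Lemma nat3_case (n : nat) : exists m, [\/ n = (3 * m)%N, n = (3 * m + 1)%N | n = (3 * m + 2)%N].
Proof.
exists (n %/ 3)%N; have h := divn_eq n 3; have : (n %% 3 < 3)%N by rewrite ltn_mod.
move: h; case: (n %% 3)%N => [|[|[|k]]] // E _; [apply: Or31|apply: Or32|apply: Or33]; lia.
Qed.

Lemma chisq_om3 : fps_scale om3 (sq2 R) - fps_scale (om3 ^+ 2) (sq2 R) = fps_const sqrtN3 * chisq.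
Proof.
apply/fpsP => n; rewrite fpsBE fps_constM /=.
have [m] := nat3_case n; have [c0 c1 c2] := chi_nat3 m.
have E k : om3 ^+ (3 * m + k) = om3 ^+ k by rewrite exprD exprM om3_cube expr1n mul1r.
have o4 : (om3 ^+ 2) ^+ 2 = om3 by rewrite -exprM (exprD om3 3 1) om3_cube mul1r expr1.
have E0 : om3 ^+ (3 * m) = 1 by rewrite -[(3 * m)%N]addn0 E expr0.
move=> En; rewrite exprAC -mulrBl [RHS]mulrA; congr (_ * _); rewrite /sqrtN3.
case: En => ->; rewrite ?c0 ?c1 ?c2 ?E ?E0 ?o4 ?mulrNz ?expr1.
- by rewrite expr1n; ring.
- by ring.
- by ring.
Qed.

(** The closed form extends to [q = 1], which is how [row_chi0] obtains its value. The factor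
    [(1 - X^3)^3] annihilates a quadratic polynomial times a function of period 3, so only finitely
    many coefficients are compared by cases. *)
Lemma ev_chisq q : nc q < 1 ->
  ev chisq q = (q - q ^+ 2 - 6 * q ^+ 3 - q ^+ 4 + q ^+ 5) / (1 + q + q ^+ 2) ^+ 3.
Proof.
move=> q1.
pose X i := fps_X i : fps C; pose c (n : nat) := fps_const (n%:R : C).
have tX i : tame (X i) by apply: tame_X.
have tc n : tame (c n) by apply: tame_const.
have t1 : tame (1 : fps C) by apply: tame1.
have E : (1 - X 3) ^+ 3 * chisq = X 1 - c 4 * X 2 + c 13 * X 4 - c 13 * X 5 + c 4 * X 7 - X 8.
  have d (f : fps C) n : ((1 - X 3) * f) n = f n - (if (3 <= n)%N then f (n - 3)%N else 0).
    by rewrite mulrBl mul1r fpsBE fps_XM.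
  have rhs n : (X 1 - c 4 * X 2 + c 13 * X 4 - c 13 * X 5 + c 4 * X 7 - X 8) n =
      (n == 1%N)%:R - 4%:R * (n == 2%N)%:R + 13%:R * (n == 4%N)%:R - 13%:R * (n == 5%N)%:R
      + 4%:R * (n == 7%N)%:R - (n == 8%N)%:R :> C.
    by rewrite !(fpsBE, fpsDE, fps_constM).
  apply/fpsP => n; rewrite rhs !exprS expr0 mulr1 -!mulrA {rhs}.
  have hc k : chi (Posz k.+3) = chi k by apply: eq_chi; rewrite -addn3 !modz_nat modnDr.
  have h0 : chi (Posz 0) = 0 by []. have h1 : chi (Posz 1) = 1 by [].
  have h2 : chi (Posz 2) = -1 by [].
  do 9! (case: n => [|n]; first by rewrite !d /= ?hc ?h0 ?h1 ?h2 ?(subSS, subn0); ring).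
  rewrite !d /= !subSS !subn0 /=.
  by rewrite !hc; ring.
have tq := tame_chisq.
have D0 : 1 + q + q ^+ 2 != 0.
  apply/eqP => h; have : (1 - q) * (1 + q + q ^+ 2) = 1 - q ^+ 3 by ring.
  rewrite h mulr0 => /esym/eqP; rewrite subr_eq0 => /eqP e.
  have : nc (q ^+ 3) < 1 by rewrite ncX pow_lt1 ?nc_ge0.
  by rewrite -e nc1 ltxx.
have q1' : 1 - q != 0.
  by rewrite subr_eq0; apply: contraTneq q1 => <-; rewrite nc1 ltxx.
have tcX k i : tame (c k * X i) by apply: tameM.
have ecX k i : ev (c k * X i) q = k%:R * q ^+ i by rewrite evM // ev_const ev_X.
have tD3 : tame (1 - X 3) by apply: tameB.
have eL : ev ((1 - X 3) ^+ 3 * chisq) q = (1 - q ^+ 3) ^+ 3 * ev chisq q.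
  by rewrite (evM (tameX 3 tD3) tq q1) (evX _ tD3 q1) (evB t1 (tX 3) q1) ev1 ev_X.
have eR : ev (X 1 - c 4 * X 2 + c 13 * X 4 - c 13 * X 5 + c 4 * X 7 - X 8) q =
   q ^+ 1 - 4%:R * q ^+ 2 + 13%:R * q ^+ 4 - 13%:R * q ^+ 5 + 4%:R * q ^+ 7 - q ^+ 8.
  have a1 := tameB (tX 1%N) (tcX 4 2%N). have a2 := tameD a1 (tcX 13 4%N).
  have a3 := tameB a2 (tcX 13 5%N). have a4 := tameD a3 (tcX 4 7%N).
  rewrite (evB a4 (tX 8) q1) (evD a3 (tcX _ _) q1) (evB a2 (tcX _ _) q1) (evD a1 (tcX _ _) q1).
  by rewrite (evB (tX 1%N) (tcX _ _) q1) !ecX !ev_X.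
have h : (1 - q ^+ 3) ^+ 3 * ev chisq q = q ^+ 1 - 4%:R * q ^+ 2 + 13%:R * q ^+ 4 - 13%:R * q ^+ 5 + 4%:R * q ^+ 7 - q ^+ 8.
  by rewrite -eL E eR.
have F : (1 - q) ^+ 3 * ((1 + q + q ^+ 2) ^+ 3 * ev chisq q - (q - q ^+ 2 - 6 * q ^+ 3 - q ^+ 4 + q ^+ 5)) = 0.
  transitivity ((1 - q ^+ 3) ^+ 3 * ev chisq q - (q ^+ 1 - 4%:R * q ^+ 2 + 13%:R * q ^+ 4 - 13%:R * q ^+ 5 + 4%:R * q ^+ 7 - q ^+ 8)).
    by ring.
  by rewrite h subrr.
move/eqP: F; rewrite mulf_eq0 expf_eq0 (negPf q1') /= subr_eq0 => /eqP <-.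
by rewrite mulrC mulKf // expf_neq0.
Qed.

(** The classes of [n] modulo 3 are separated; the classes of 1 and -1 are Lipschitz sums at
    [w + 1/3] and [w - 1/3]. *)
Lemma row_chi w : 0 < Im w ->
  has_sum (fun n : int => (chi n)%:~R * ((3 * w + n%:~R) ^+ 3)^-1)
    (kap R * sqrtN3 / 27 * ev chisq (ee w)).
Proof.
move=> w0.
pose F (e : int) (n : int) : C := if (n %% 3)%Z == (e %% 3)%Z then ((3 * w + n%:~R) ^+ 3)^-1 else 0.
have part (e : int) : has_sum (F e) (27^-1 * (kap R * ev (sq2 R) (ee (w + e%:~R / 3)))).
  have hw : 0 < Im (w + e%:~R / 3).
    have -> : (e%:~R / 3 : C) = ((e%:~R / 3 : R)%:C)%C by rewrite rmorphM /= fmorphV /= rmorph_int rmorph_nat.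
    by rewrite ImD /= addr0.
  apply: (@has_sum_push _ _ _ _ (fun k : int => 3 * k + e)) => [x y /addIr h|n|].
  - by apply: (mulfI (_ : (3 : int) != 0)).
  - rewrite /F; case: (_ =P (e %% 3)%Z) => [E _|_]; last by rewrite eqxx.
    exists (((n - e) %/ 3)%Z); rewrite mulrC divzK ?subrK //.
    by rewrite -eqz_mod_dvd; apply/eqP.
  apply: eq_has_sum (has_sumZ 27^-1 (lipschitz hw)) => k /=.
  rewrite /F [3 * k]mulrC modzMDl eqxx rmorphD rmorphM /=.
  have -> : 3 * w + (k%:~R * 3%:~R + e%:~R) = 3 * (w + e%:~R / 3 + k%:~R) by field.
  by rewrite exprMn -invfM; congr (_^-1); ring.
have h := has_sumD (part 1) (has_sumZ (-1) (part (-1))).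
have -> : kap R * sqrtN3 / 27 * ev chisq (ee w) = 27^-1 * (kap R * ev (sq2 R) (ee (w + 1%:~R / 3))) +
   -1 * (27^-1 * (kap R * ev (sq2 R) (ee (w + (-1)%:~R / 3)))).
  have q1 := ee_lt1 w0.
  have o2 : nc (om3 ^+ 2) <= 1 by rewrite ncX nc_om3 expr1n.
  have o1 : nc om3 <= 1 by rewrite nc_om3.
  have e1 : ee (w + 1%:~R / 3) = om3 * ee w by rewrite eeD mulrC.
  have e2 : ee (w + (-1)%:~R / 3) = om3 ^+ 2 * ee w.
    rewrite eeD mulrC; congr (_ * _); rewrite -[LHS](ee_Dint _ 1) -ee_mul; congr ee.
    by field.
  have ts := @tame_sq2 R.
  have t1 := tame_scale o1 ts. have t2 := tame_scale o2 ts.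
  have hh : ev (sq2 R) (om3 * ee w) - ev (sq2 R) (om3 ^+ 2 * ee w) = sqrtN3 * ev chisq (ee w).
    rewrite -[LHS](congr2 (fun a b => a - b) (ev_scale _ _ _) (ev_scale _ _ _)).
    by rewrite -(evB t1 t2 q1) chisq_om3 (evM (tame_const _) tame_chisq q1) ev_const.
  rewrite e1 e2; move: hh; move: (ev _ (om3 * _)) (ev _ (om3 ^+ 2 * _)) (ev chisq _) sqrtN3 (kap R).
  move=> a b c s k hh; transitivity (k / 27 * (s * c)); first by ring.
  by rewrite -hh; ring.
apply: eq_has_sum h => n; rewrite /F /chi.
by case: (modz3 n) => -> /=; rewrite ?mulr0 ?addr0 ?add0r ?mul0r // ?mul1r ?mulN1r ?mulNr ?mul1r.
Qed.

End WeightThree.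

Section WeightThreeLaws.
Variable R : realType.
Local Notation C := R[i].
Implicit Types (w z t q : C).

(** The row [m = 0] is beyond the Lipschitz formula and is reached as the limit of [row_chi] along
    [w = i / N]; at [q = 1] the closed form takes the value [-6 / 27]. *)
Lemma row_chi0 :
  has_sum (fun n : int => (chi n)%:~R * (n%:~R ^+ 3 : C)^-1) (kap R * sqrtN3 R / 27 * (- (2 / 9))).
Proof.
pose i : C := (0 +i* 1)%C.
have i0 : 0 < Im i by apply: ltr01.
have [K K0 hK] := lattice_bound i0.
have KW : 0 <= K * wtz R 0 by rewrite mulr_ge0 ?wt_ge0.
have sl := sums_leZ KW (sums_le_wtz R).
have bd (n : int) : nc ((chi n)%:~R * (n%:~R ^+ 3 : C)^-1) <= K * wtz R 0 * wtz R n.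
  have := hK 0 n; rewrite mul0r add0r mulrA => h; apply: le_trans h.
  by rewrite ncM ler_piMl ?nc_ge0 ?nc_chi.
have [l hl] := has_sum_ex (sums_le_cmp bd sl).
suff -> : kap R * sqrtN3 R / 27 * (- (2 / 9)) = l by [].
pose w (N : nat) : C := i / N.+1%:R.
have Imw N : Im (w N) = 1 / N.+1%:R by rewrite /w Im_divn.
have Rew N : Re (w N) = 0 by rewrite /w Re_divn mul0r.
have w0 N : 0 < Im (w N) by rewrite Imw divr_gt0.
have w30 N : Re (3 * w N) = 0.
  by rewrite natC; case: (w N) (Rew N) => a b /= ->; rewrite mulr0 mul0r subr0.
have wl : clim (fun N => 3 * w N) 0.
  have := climM (clim_const (3 * i)) (@clim_inv R).
  by rewrite mulr0; apply: eq_clim => n; rewrite mulrA.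
have lim1 : clim (fun N => kap R * sqrtN3 R / 27 * ev (chisq R) (ee (w N))) l.
  apply: (tannery (f := fun N (n : int) => (chi n)%:~R * ((3 * w N + n%:~R) ^+ 3)^-1) _ sl _ _ hl).
  - move=> N n; apply: le_trans (bd n); rewrite !ncM.
    have [->|n0] := eqVneq n 0; first by rewrite chi0 nc0 !mul0r.
    rewrite ler_wpM2l ?nc_ge0 //.
    have n1 : 0 < nc (n%:~R : C) by rewrite nc_gt0 intr_eq0.
    rewrite !ncV !ncX lef_pV2 ?posrE ?exprn_gt0 //; last first.
      by rewrite nc_gt0 Im_gt0_neq0 // Im_Dint Im_natM mulr_gt0.
    rewrite lerXn2r ?nnegrE ?nc_ge0 // nc_int intr_norm.
    by rewrite (le_trans _ (nc_Re _)) // Re_Dint w30 add0r.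
  - move=> n; have [->|n0] := eqVneq n 0.
      by apply: eq_clim (clim_const _) => N; rewrite chi0 !mul0r.
    apply: climM; first exact: clim_const.
    apply: climV; first by rewrite expf_neq0 // intr_eq0.
    by apply: climX; rewrite -[X in clim _ X]add0r; apply: climD => //; apply: clim_const.
  - by move=> N; apply: row_chi.
have lim2 : clim (fun N => kap R * sqrtN3 R / 27 * ev (chisq R) (ee (w N))) (kap R * sqrtN3 R / 27 * (- (2 / 9))).
  apply: climM; first exact: clim_const.
  have q1 : clim (fun N => ee (w N)) 1 by apply: clim_ee1.
  have qc c k := climM (clim_const c) (climX k q1).
  have d3 : 1 + 1 * 1 ^+ 1 + 1 * 1 ^+ 2 != 0 :> C.
    by rewrite (_ : _ + _ = 3%:R) ?pnatr_eq0 //; ring.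
  have := climM (climD (climD (climD (climD (qc 1 1%N) (qc (-1) 2%N)) (qc (- 6) 3%N)) (qc (-1) 4%N)) (qc 1 5%N))
    (climV (expf_neq0 3 d3) (climX 3 (climD (climD (clim_const 1) (qc 1 1%N)) (qc 1 2%N)))).
  have -> : (1 * 1 ^+ 1 + -1 * 1 ^+ 2 + - 6 * 1 ^+ 3 + -1 * 1 ^+ 4 + 1 * 1 ^+ 5) /
    (1 + 1 * 1 ^+ 1 + 1 * 1 ^+ 2) ^+ 3 = - (2 / 9) :> C by field.
  apply: eq_clim => N; rewrite ev_chisq ?ee_lt1 //.
  congr (_ / _ ^+ 3); by rewrite ?expr1; ring.
exact: clim_uniq lim2 lim1.
Qed.

(** Homogeneity of degree -3 under a homothety [c] that embeds one lattice into another. The Fricke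
    law, the isogenies and complex multiplication are all instances. *)
Lemma lat_push (f g : int -> int -> C) t t' (h : int * int -> int * int) (c : C) : 0 < Im t -> 0 < Im t' -> c != 0 ->
  (forall m n, nc (f m n) <= 1) -> (forall m n, nc (g m n) <= 1) -> injective h ->
  (forall x, g (h x).1 (h x).2 = f x.1 x.2) ->
  (forall m n, g m n != 0 -> exists x, h x = (m, n)) ->
  (forall x, (h x).1%:~R * t + (h x).2%:~R = c * (x.1%:~R * t' + x.2%:~R)) ->
  lat f t' = c ^+ 3 * lat g t.
Proof.
move=> t0 t0' c0 f1 g1 hi fg gs hc.
have hf := has_sumZ (c ^+ 3)^-1 (lat_has t0' f1).
have hg : has_sum (fun z : int * int => g z.1 z.2 * ((z.1%:~R * t + z.2%:~R) ^+ 3)^-1) ((c ^+ 3)^-1 * lat f t').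
  apply: (has_sum_push hi) => [[m n] /=|].
    by rewrite mulf_eq0 negb_or => /andP[/gs].
  by apply: eq_has_sum hf => z; rewrite /= fg hc mulrCA (exprMn 3) -invfM.
by rewrite (has_sum_uniq (lat_has t0 g1) hg) mulVKf // expf_neq0.
Qed.

Lemma lat_fricke f t : 0 < Im t -> (forall m n, nc (f m n) <= 1) ->
  lat f (fricke t) = (3 * t) ^+ 3 * lat (fun m n => if (3 %| m)%Z then f (- n) (m %/ 3)%Z else 0) t.
Proof.
move=> t0 f1; have tn := Im_gt0_neq0 t0.
pose h (z : int * int) : int * int := (3 * z.2, - z.1).
apply: (@lat_push f (fun m n => if (3 %| m)%Z then f (- n) (m %/ 3)%Z else 0) t (fricke t) h (3 * t)) => //.
- exact: Im_fricke_gt0.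
- by rewrite mulf_neq0 // pnatr_eq0.
- by move=> m n; case: ifP => _ //; rewrite nc0 ler01.
- by move=> [a b] [c d] [/(mulfI (isT : (3 : int) != 0)) -> /oppr_inj ->].
- by move=> [m n] /=; rewrite dvdz_mulr ?dvdzz //= opprK mulKz.
- move=> m n; case: ifP => [/divzK E _|_]; last by rewrite eqxx.
  by exists (- n, (m %/ 3)%Z); rewrite /h /= opprK mulrC E.
- move=> [m n] /=; rewrite /h /fricke rmorphM rmorphN /=; field.
  by rewrite tn.
Qed.

Lemma tame_lamb (a b : nat -> C) : (forall m, nc (a m) <= 1) ->
  (forall d, nc (b d) <= d%:R ^+ 2) -> tame (lamb a b).
Proof.
move=> ha hb; apply: (@tame_growth _ _ 4 1) => n; rewrite mul1r /=.
apply: (le_trans (nc_sum _ _ _)).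
apply: (@le_trans _ _ (\sum_(m < n) n.+1%:R ^+ 3)); last first.
  rewrite sumr_const card_ord -[_ *+ _]mulr_natl; apply: (@le_trans _ _ (n.+1%:R * n.+1%:R ^+ 3)); last by rewrite -exprS.
  apply: ler_wpM2r; first by rewrite exprn_ge0.
  by rewrite ler_nat.
apply: ler_sum => m _; apply: (le_trans (nc_sum _ _ _)).
rewrite big_mkcond /=; apply: (@le_trans _ _ (\sum_(d < n.+1) n.+1%:R ^+ 2)); last first.
  by rewrite sumr_const card_ord -[_ *+ _]mulr_natl -exprS.
apply: ler_sum => d _; case: ifP => _; last by rewrite exprn_ge0.
rewrite ncM; apply: (@le_trans _ _ (1 * d%:R ^+ 2)); first by rewrite ler_pM ?nc_ge0.
by rewrite mul1r lerXn2r ?nnegrE // ler_nat ltnW.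
Qed.

Lemma fz_ys : fz C ys = lamb (fun m => (chi m)%:~R) (fun d => d%:R ^+ 2).
Proof.
rewrite /fz lamb_map; congr lamb; apply: funext => d //=.
by rewrite rmorphXn /= rmorph_nat.
Qed.

Lemma fz_bs : fz C bs = lamb (fun=> 1) (fun d => (chi d)%:~R * d%:R ^+ 2).
Proof.
rewrite /fz lamb_map; congr lamb; apply: funext => d //=.
by rewrite rmorphM /= rmorphXn /= rmorph_nat.
Qed.

Lemma tame_ys : tame (fz C ys).
Proof. by rewrite fz_ys; apply: tame_lamb => d; rewrite ?nc_chi // ncX nc_nat. Qed.

Lemma tame_bs : tame (fz C bs).
Proof. by rewrite fz_bs; apply: tame_lamb => d; rewrite ?nc1 // nc_chisq. Qed.

Lemma fz_Bs : fz C Bs = 1 - fps_const 9%:R * fz C bs.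
Proof. by rewrite /fz /Bs rmorphB rmorph1 rmorphM /= fps_map_const rmorph_nat. Qed.

Lemma tame_Bs : tame (fz C Bs).
Proof.
rewrite fz_Bs; apply: tameB; first exact: tame1.
by apply: tameM; [exact: tame_const|exact: tame_bs].
Qed.

Lemma ev_Bs q : nc q < 1 -> ev (fz C Bs) q = 1 - 9 * ev (fz C bs) q.
Proof.
move=> q1; rewrite fz_Bs (evB (@tame1 R) (tameM (tame_const _) tame_bs) q1) ev1.
by rewrite (evM (tame_const _) tame_bs q1) ev_const.
Qed.

(** The row [m = 0] supplies the constant term: [-2/9 + 2 bs = -(2/9) (1 - 9 bs)], the origin of the
    9 in [Bs]. *)
Lemma lat_Bs t : 0 < Im t ->
  lat (fun m n => if (3 %| m)%Z then (chi n)%:~R else 0) t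
  = - (2 * kap R * sqrtN3 R / 243) * ev (fz C Bs) (ee t).
Proof.
move=> t0; set c := kap R * sqrtN3 R / 27.
pose u (k : nat) : C := if k is k'.+1 then c * ev (chisq R) (ee t ^+ k) else c * (- (2 / 9)).
pose g (m : int) : C := if (3 %| m)%Z then u `|(m %/ 3)%Z|%N else 0.
have q1 := ee_lt1 t0.
have hu : has_sum (fun n => u n.+1) (c * ev (fz C bs) (ee t)).
  rewrite fz_bs.
  have n1 (m : nat) : nc (1 : C) <= 1 by rewrite nc1.
  have h := lambert_ev q1 n1 (@nc_chisq R).
  by apply: eq_has_sum (has_sumZ c h) => k; rewrite /u mul1r.
have hg : has_sum g (u 0%N + (c * ev (fz C bs) (ee t) + c * ev (fz C bs) (ee t))).
  apply: (@has_sum_push _ _ _ _ (fun k : int => k * 3)) => [x y|m|].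
  - exact: (mulIf (isT : (3 : int) != 0)).
  - rewrite /g; case: ifP => [/divzK E _|_]; last by rewrite eqxx.
    by exists (m %/ 3)%Z.
  by apply: eq_has_sum (even_sum hu) => k; rewrite /= /g dvdz_mull ?dvdzz // mulzK.
have hrow := @lat_rows R (fun m n => if (3 %| m)%Z then (chi n)%:~R else 0) t g t0.
rewrite (has_sum_uniq (hrow _ _) hg) => [|m n|m]; last 2 first.
- by case: ifP => _; rewrite ?nc_chi // nc0.
- rewrite /g; case: ifP => [/divzK E|_]; last by apply: eq_has_sum (has_sum0 _) => n; rewrite mul0r.
  rewrite -{1}E; move: (m %/ 3)%Z => k {E}.
  have pos (j : nat) : has_sum (fun n : int => (chi n)%:~R * ((3 * (j.+1%:R * t) + n%:~R) ^+ 3)^-1) (u j.+1).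
    by rewrite /u -ee_mul; apply: row_chi; rewrite Im_natM mulr_gt0.
  have E3 (j : int) : (j * 3)%:~R * t = 3 * (j%:~R * t) :> C by rewrite rmorphM /=; ring.
  case: k => [[|k]|k].
  - by apply: eq_has_sum (row_chi0) => n; rewrite !mul0r add0r.
  - by apply: eq_has_sum (pos k) => n; rewrite E3.
  - rewrite NegzE abszN; apply: (@has_sum_push _ _ _ _ (fun n : int => - n)) => [|n _|].
    + exact: oppr_inj.
    + by exists (- n); rewrite opprK.
    apply: eq_has_sum (pos k) => n /=.
    have e : - k.+1%:Z * 3 = - (k.+1%:Z * 3) by rewrite mulNr.
    by rewrite chiN e int_termN E3.
by rewrite (ev_Bs q1) /u /c; field.
Qed.

Lemma fricke_ys t : 0 < Im t ->
  ev (fz C ys) (ee (fricke t)) = sqrtN3 R / 9 * t ^+ 3 * ev (fz C Bs) (ee t).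
Proof.
move=> t0.
have h := etrans (esym (lat_fricke t0 (fun m _ => nc_chi _ m))) (lat_ys (Im_fricke_gt0 t0)).
pose g (m n : int) : C := if (3 %| m)%Z then (chi n)%:~R else 0.
have E : lat (fun m n : int => if (3 %| m)%Z then (chi (- n))%:~R else 0) t = - lat g t.
  have h1 : has_sum _ _ := has_sumZ (-1) (@lat_has R g t t0 _).
  apply: csumP; rewrite -mulN1r; apply: eq_has_sum (h1 _) => [z|m n].
    rewrite /g /=; case: ifP => _; last by rewrite !mul0r mulr0.
    by rewrite chiN rmorphN mulN1r mulNr.
  by rewrite /g; case: ifP => _; rewrite ?nc_chi ?nc0.
have {}h := etrans (esym (congr1 ( *%R ((3 * t) ^+ 3)) (etrans E (congr1 -%R (lat_Bs t0))))) h.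
have k0 : 2 * kap R != 0 by apply: mulf_neq0 (kap_neq0 R); rewrite pnatr_eq0.
move: h k0; move: (ev (fz C Bs) _) (ev (fz C ys) _) (kap R) (sqrtN3 R) => b y k s h k0.
apply: (mulfI k0); transitivity ((3 * t) ^+ 3 * - (- (2 * k * s / 243) * b)); first exact/esym/h.
by field.
Qed.

Lemma sqrtN3_sq : sqrtN3 R ^+ 2 = -3.
Proof.
have h : om3 R ^+ 2 = - om3 R - 1 by have := om3_sum R => /eqP; rewrite -addrA addr_eq0 opprD => /eqP.
have -> : sqrtN3 R ^+ 2 = om3 R ^+ 2 * (1 - om3 R) ^+ 2 by rewrite /sqrtN3; ring.
have -> : (1 - om3 R) ^+ 2 = 1 - 2 * om3 R + om3 R ^+ 2 by ring.
rewrite h; have -> : (- om3 R - 1) * (1 - 2 * om3 R + (- om3 R - 1)) = 3 * om3 R ^+ 2 + 3 * om3 R by ring.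
by rewrite h; ring.
Qed.

Lemma fricke_Bs t : 0 < Im t ->
  ev (fz C Bs) (ee (fricke t)) = 81 * sqrtN3 R * t ^+ 3 * ev (fz C ys) (ee t).
Proof.
move=> t0; have h := fricke_ys (Im_fricke_gt0 t0).
have tn := Im_gt0_neq0 t0. have s0 := sqrtN3_neq0 R.
rewrite frickeK in h; rewrite h /fricke.
move: (ev _ _) (sqrtN3_sq) => b hs.
have -> : 81 * sqrtN3 R * t ^+ 3 * (sqrtN3 R / 9 * (- (3 * t)^-1) ^+ 3 * b) = - (sqrtN3 R ^+ 2 / 3) * b.
  by field.
by rewrite hs; field.
Qed.

End WeightThreeLaws.

HB.instance Definition _ (k : comNzRingType) :=
  GRing.RMorphism.copy (@fz k) (fps_map (intmul 1 : {rmorphism int -> k})).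

(** * Arithmetic of the coefficients of [y] and [B] modulo 3 *)

Section Coefficients.

Lemma lambE (k : comNzRingType) (a b : nat -> k) n N : (0 < n)%N -> (n < N)%N ->
  lamb a b n = \sum_(d < N) if (0 < d)%N && (d %| n)%N then a (n %/ d)%N * b d else 0.
Proof.
move=> n0 nN; rewrite /lamb /=.
rewrite (exchange_big_dep xpredT) //=.
transitivity (\sum_(d < n.+1) if (0 < d)%N && (d %| n)%N then a (n %/ d)%N * b d else 0).
  apply: eq_bigr => d _; case: ifP => [/andP[d0 dn]|h].
    have dn0 : (0 < n %/ d)%N by rewrite divn_gt0 // dvdn_leq.
    have hm : ((n %/ d).-1 < n)%N by rewrite prednK // leq_div.
    rewrite (big_pred1 (Ordinal hm)) => [|m] /=; first by rewrite prednK.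
    rewrite -[RHS]/(m == (n %/ d).-1 :> nat) -[RHS]eqSS prednK //.
    by rewrite eqn_div.
  rewrite big_pred0 // => m; apply: contraFF h; move: (nat_of_ord m) (nat_of_ord d) => i j /eqP E.
  apply/andP; split; last by rewrite -E dvdn_mull.
  by rewrite lt0n; apply: contraTneq n0 => d0; rewrite -E d0 muln0.
rewrite -(big_mkord xpredT (fun d => if (0 < d)%N && (d %| n)%N then a (n %/ d)%N * b d else 0)).
rewrite -(big_mkord xpredT (fun d => if (0 < d)%N && (d %| n)%N then a (n %/ d)%N * b d else 0)).
rewrite [RHS](big_cat_nat (n := n.+1)) //= [X in _ + X]big_nat_cond [X in _ + X]big1 ?addr0 // => d.
by rewrite andbT => /andP[nd _]; case: ifP => // /andP[_ /(dvdn_leq n0)]; rewrite leqNgt nd.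
Qed.

Lemma sum_mul3 (V : nmodType) (f : nat -> V) M :
  \sum_(d < 3 * M) f d = \sum_(e < M) (f (3 * e)%N + f (3 * e + 1)%N + f (3 * e + 2)%N).
Proof.
elim: M => [|M IH]; first by rewrite !big_ord0.
by rewrite mulnS addnC addn3 !big_ord_recr /= IH -!addrA addn1 addn2.
Qed.

Lemma ys0 : ys 0%N = 0. Proof. by rewrite /ys /= big_ord0. Qed.
Lemma bs0 : bs 0%N = 0. Proof. by rewrite /bs /= big_ord0. Qed.
Lemma Bs0 : Bs 0%N = 1. Proof. by rewrite /Bs fpsBE fps_constM bs0. Qed.

Lemma coprime3 e : coprime 3 (3 * e + 1) && coprime 3 (3 * e + 2).
Proof. by rewrite !prime_coprime //; lia. Qed.

(** A divisor [d] of [3 n] prime to 3 has [chi (3 n / d) = 0]; the others are [d = 3 e], and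
    [d^2 = 9 e^2]. *)
Lemma ys_mul3 n : ys (3 * n)%N = 9 * ys n.
Proof.
case: n => [|n]; first by rewrite muln0 ys0 mulr0.
rewrite /ys (@lambE _ _ _ _ (3 * n.+2)%N) ?muln_gt0 ?ltn_pmul2l //.
rewrite (@lambE _ _ _ n.+1 n.+2) //.
rewrite (sum_mul3 (fun d => if (0 < d)%N && (d %| 3 * n.+1)%N then chi ((3 * n.+1) %/ d)%N * d%:R ^+ 2 else 0)).
rewrite mulr_sumr; apply: eq_bigr => e _.
have /andP[c1 c2] := coprime3 e.
have z d : coprime 3 d -> (if (0 < d)%N && (d %| 3 * n.+1)%N then chi (3 * n.+1 %/ d)%N * d%:R ^+ 2 else 0) = 0.
  move=> cd; case: ifP => // /andP[d0]; rewrite Gauss_dvdr 1?coprime_sym // => dn.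
  by rewrite -muln_divA // chi_dvd ?mul0r // PoszM dvdz_mulr.
rewrite (z _ c1) (z _ c2) !addr0 muln_gt0 /= dvdn_pmul2l // divnMl //.
by case: ifP => _; rewrite ?mulr0 // natrM; ring.
Qed.

Lemma bs_mul3 n : bs (3 * n)%N = bs n.
Proof.
case: n => [|n]; first by rewrite muln0 bs0.
rewrite /bs (@lambE _ _ _ _ (3 * n.+2)%N) ?muln_gt0 ?ltn_pmul2l //.
rewrite (@lambE _ _ _ n.+1 (3 * n.+2)) //; last by lia.
apply: eq_bigr => d _.
have [d3|d3] := boolP (3 %| d)%N.
  have c0 : chi d = 0 by apply: chi_dvd.
  by rewrite c0 mul0r mulr0 !if_same.
by rewrite Gauss_dvdr // coprime_sym prime_coprime.
Qed.

Lemma Bs_mul3 n : Bs (3 * n)%N = Bs n.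
Proof. by rewrite /Bs !fpsBE !fps_constM bs_mul3 !fps1E; case: n. Qed.

(** When 3 does not divide [n], multiplicativity gives [chi d = chi n * chi (n / d)] for every
    divisor [d]. *)
Lemma Bs_ys n : ~~ (3 %| n)%N -> Bs n = - (9 * (chi n * ys n)).
Proof.
case: n => [//|n] n3; rewrite /Bs fpsBE fps_constM fps1E sub0r; congr (- (9 * _)).
rewrite /bs /ys (@lambE _ _ _ n.+1 n.+2) // (@lambE _ _ _ n.+1 n.+2) // mulr_sumr.
apply: eq_bigr => d _; case: ifP => [/andP[d0 /divnK E]|_]; last by rewrite mulr0.
have h : ~~ (3 %| (n.+1 %/ d)%N%:Z)%Z.
  by apply: contra n3 => h; rewrite -E dvdn_mulr.
have -> : chi n.+1 = chi (n.+1 %/ d)%N * chi d by rewrite -chiM -PoszM E.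
have c1 := chi_sq h; rewrite mul1r; move: c1; set x := chi (n.+1 %/ d)%N => c1.
by rewrite mulrACA c1 mul1r.
Qed.

Definition Y1 : fps int := fps_sec 3 1 ys.
Definition Y2 : fps int := fps_sec 3 2 ys.
Definition ss : fps int := Bs + fps_const 27 * ys.

Lemma sec_Bs0 : fps_sec 3 0 Bs = Bs.
Proof. by apply/fpsP => n; rewrite -[LHS]/(Bs (3 * n + 0)%N) addn0 Bs_mul3. Qed.

Lemma sec_ys0 : fps_sec 3 0 ys = fps_const 9 * ys.
Proof. by apply/fpsP => n; rewrite fps_constM -[LHS]/(ys (3 * n + 0)%N) addn0 ys_mul3. Qed.

Lemma sec_Bs1 : fps_sec 3 1 Bs = - (fps_const 9 * Y1).
Proof.
apply/fpsP => n; rewrite fpsNE fps_constM -[LHS]/(Bs (3 * n + 1)%N) -[Y1 n]/(ys (3 * n + 1)%N).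
have [_ c1 _] := chi_nat3 n.
by rewrite Bs_ys ?c1 ?mul1r //; lia.
Qed.

Lemma sec_Bs2 : fps_sec 3 2 Bs = fps_const 9 * Y2.
Proof.
apply/fpsP => n; rewrite fps_constM -[LHS]/(Bs (3 * n + 2)%N) -[Y2 n]/(ys (3 * n + 2)%N).
have [_ _ c2] := chi_nat3 n.
by rewrite Bs_ys ?c2 ?mulN1r ?mulrN ?opprK //; lia.
Qed.

End Coefficients.

Section BinaryComputation.

Local Notation Z := BinNums.Z.

(* The finitely many coefficients to check are computed in binary integers. *)
Definition agr n (f : fps Z) (l : seq Z) := forall i, (i < n)%N -> f i = nth 0 l i.

Definition zsum (f : nat -> Z) n : Z := foldr (fun j s => f j + s) 0 (iota 0 n).

Lemma zsumE f n : zsum f n = \sum_(j < n) f j.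
Proof. by rewrite -(big_mkord xpredT f) unlock /index_iota subn0. Qed.

Definition cadd n (l l' : seq Z) := mkseq (fun i => nth 0 l i + nth 0 l' i) n.
Definition cmul n (l l' : seq Z) := mkseq (fun i => zsum (fun j => nth 0 l j * nth 0 l' (i - j)) i.+1) n.
Definition cscale n c (l : seq Z) := mkseq (fun i => c * nth 0 l i) n.

Lemma agrD n f g l l' : agr n f l -> agr n g l' -> agr n (f + g) (cadd n l l').
Proof. by move=> h h' i i_n; rewrite nth_mkseq // fpsDE h // h'. Qed.

Lemma agrZ n c f l : agr n f l -> agr n (fps_const c * f) (cscale n c l).
Proof. by move=> h i i_n; rewrite nth_mkseq // fps_constM h. Qed.

Lemma agrM n f g l l' : agr n f l -> agr n g l' -> agr n (f * g) (cmul n l l').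
Proof.
move=> h h' i i_n; rewrite nth_mkseq // zsumE fpsME; apply: eq_bigr => j _.
by rewrite h ?h' // (leq_ltn_trans _ i_n) ?leq_subr // -ltnS.
Qed.

Lemma agr_mk n (f : fps Z) (F : nat -> Z) : (forall i, (i < n)%N -> f i = F i) -> agr n f (mkseq F n).
Proof. by move=> h i i_n; rewrite nth_mkseq // h. Qed.

Definition zchi (n : nat) : Z := if (n %% 3 == 1)%N then 1 else if (n %% 3 == 2)%N then -1 else 0.
Definition zy n : Z := if n is 0 then 0 else
  zsum (fun d => if (0 < d)%N && (d %| n)%N then zchi (n %/ d) * BinInt.Z.of_nat d ^+ 2 else 0) n.+1.
Definition zb n : Z := if n is 0 then 1 else
  -9 * zsum (fun d => if (0 < d)%N && (d %| n)%N then zchi d * BinInt.Z.of_nat d ^+ 2 else 0) n.+1.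

Lemma zchiE (n : nat) : (chi n)%:~R = zchi n.
Proof. by rewrite /chi /zchi modz_nat; case: (n %% 3)%N => [|[|[|k]]]. Qed.

Lemma fz_zy n : fz Z ys n = zy n.
Proof.
rewrite /fz lamb_map; case: n => [|n]; first by rewrite /= big_ord0.
rewrite (@lambE _ _ _ n.+1 n.+2) // /zy zsumE; apply: eq_bigr => d _.
by case: ifP => // _; rewrite /= zchiE rmorphXn /= rmorph_nat; congr (_ * _ ^+ 2); lia.
Qed.

Lemma fz_zb n : fz Z Bs n = zb n.
Proof.
have -> : fz Z Bs = 1 - fps_const 9 * fz Z bs.
  by rewrite /fz /Bs rmorphB rmorph1 rmorphM /= fps_map_const.
rewrite fpsBE fps_constM /fz lamb_map.
case: n => [|n]; first by rewrite /lamb /= big_ord0 mulr0 subr0.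
rewrite (@lambE _ _ _ n.+1 n.+2) // fps1E sub0r -mulNr /zb zsumE; congr (_ * _).
apply: eq_bigr => d _.
by case: ifP => // _; rewrite /= mul1r rmorphM /= zchiE rmorphXn /= rmorph_nat; congr (_ * _ ^+ 2); lia.
Qed.

(** [rel2] and [rel3] carry the second and third elementary symmetric functions of [B] at the points
    [(t + k) / 3]; [rel2] behaves as a form of weight 18 and [X * rel3] as one of weight 27. *)
Definition rel2 : fps int := fps_X 1 * (Y1 * Y2) - fps_const 3 * (ys * ss).
Definition rel3 : fps int := fps_const 3 * (Y1 ^+ 3 - fps_X 1 * Y2 ^+ 3) - Bs * (Y1 * Y2).

End BinaryComputation.

(** * The cubic relations *)

Section SubstMorphism.
Variable k : comNzRingType.
Implicit Types f g : fps k.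
Lemma fps_substC p (c : k) : (0 < p)%N -> fps_subst p (fps_const c) = fps_const c.
Proof.
move=> p0; apply/fpsP => n /=; case: n => [|n]; first by rewrite dvdn0 div0n.
case: ifP => // /dvdnP[[|m] E]; first by rewrite mul0n in E.
by rewrite {1}E mulnK.
Qed.
Lemma fps_substN p f : fps_subst p (- f) = - fps_subst p f. Proof. exact: raddfN. Qed.
Lemma fps_substD p f g : fps_subst p (f + g) = fps_subst p f + fps_subst p g. Proof. exact: raddfD. Qed.
Lemma fps_substB p f g : fps_subst p (f - g) = fps_subst p f - fps_subst p g. Proof. exact: raddfB. Qed.
Lemma fps_constN (c : k) : fps_const (- c) = - fps_const c. Proof. exact: rmorphN. Qed.
End SubstMorphism.

Section FzMorphism.
Variable k : comNzRingType.
Implicit Types f g : fps int.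
Lemma fzD f g : fz k (f + g) = fz k f + fz k g. Proof. exact: rmorphD. Qed.
Lemma fzN f : fz k (- f) = - fz k f. Proof. exact: rmorphN. Qed.
Lemma fzB f g : fz k (f - g) = fz k f - fz k g. Proof. exact: rmorphB. Qed.
Lemma fzM f g : fz k (f * g) = fz k f * fz k g. Proof. exact: rmorphM. Qed.
Lemma fzX f n : fz k (f ^+ n) = fz k f ^+ n. Proof. exact: rmorphXn. Qed.
Lemma fz_X i : fz k (fps_X i) = fps_X i. Proof. exact: fps_map_X. Qed.
Lemma fz_const (c : int) : fz k (fps_const c) = fps_const c%:~R. Proof. exact: fps_map_const. Qed.
Lemma fz_subst p f : fz k (fps_subst p f) = fps_subst p (fz k f). Proof. exact: fps_map_subst. Qed.
Lemma fz_sec p i f : fz k (fps_sec p i f) = fps_sec p i (fz k f). Proof. exact: fps_map_sec. Qed.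
End FzMorphism.

Section LowCoefficients.
Local Notation Z := BinNums.Z.

Definition cY n i := mkseq (fun j => zy (3 * j + i)) n.
Definition cy n := mkseq zy n.
Definition cb n := mkseq zb n.
Definition cs n := cadd n (cb n) (cscale n 27 (cy n)).

Lemma agr_ys n : agr n (fz Z ys) (cy n). Proof. by apply: agr_mk => i _; apply: fz_zy. Qed.
Lemma agr_Bs n : agr n (fz Z Bs) (cb n). Proof. by apply: agr_mk => i _; apply: fz_zb. Qed.
Lemma agr_sec n i : agr n (fz Z (fps_sec 3 i ys)) (cY n i).
Proof. by apply: agr_mk => j _; rewrite -fz_zy. Qed.

Lemma agr_X n : agr n (fps_X 1 : fps Z) (mkseq (fun i => (i == 1%N)%:R) n).
Proof. by apply: agr_mk. Qed.

Lemma agr_ss n : agr n (fz Z ss) (cs n).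
Proof.
rewrite /ss fzD fzM fz_const; apply: agrD; first exact: agr_Bs.
by apply: (@agrZ _ 27); apply: agr_ys.
Qed.

Lemma agr_low n f l : agr n (fz Z f) l -> take n l = nseq n 0 -> forall i, (i < n)%N -> f i = 0.
Proof.
move=> h hl i i_n; apply/eqP; rewrite -(intr_eq0 Z); apply/eqP.
by rewrite -[LHS]/(fz Z f i) h // -(nth_take _ i_n) hl nth_nseq i_n.
Qed.

(** Nine coefficients, because the vanishing criterion with exponent 6 asks for
    [8 * 6 + 6 <= 6 * 9]. *)
Lemma rel2_low i : (i < 9)%N -> rel2 i = 0.
Proof.
have h : agr 9 (fz Z rel2) (cadd 9 (cmul 9 (mkseq (fun i => (i == 1%N)%:R) 9) (cmul 9 (cY 9 1) (cY 9 2)))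
   (cscale 9 (-3) (cmul 9 (cy 9) (cs 9)))).
  have -> : fz Z rel2 = fps_X 1 * (fz Z (fps_sec 3 1 ys) * fz Z (fps_sec 3 2 ys)) + fps_const (-3) * (fz Z ys * fz Z ss).
    by rewrite /rel2 !(fzB, fzM, fz_const, fz_X) fps_constN mulNr.
  by apply: agrD; [apply: agrM; [exact: agr_X|apply: agrM; exact: agr_sec]|apply: agrZ; apply: agrM; [exact: agr_ys|exact: agr_ss]].
by move: i; apply: (agr_low h); vm_compute.
Qed.

(** Twelve coefficients, because [X * rel3] then vanishes to order 13, and [8 * 9 + 6 <= 6 * 13]. *)
Lemma rel3_low i : (i < 12)%N -> rel3 i = 0.
Proof.
have h : agr 12 (fz Z rel3) (cadd 12 (cscale 12 3 (cadd 12
   (cmul 12 (cY 12 1) (cmul 12 (cY 12 1) (cY 12 1)))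
   (cscale 12 (-1) (cmul 12 (mkseq (fun i => (i == 1%N)%:R) 12) (cmul 12 (cY 12 2) (cmul 12 (cY 12 2) (cY 12 2)))))))
   (cscale 12 (-1) (cmul 12 (cb 12) (cmul 12 (cY 12 1) (cY 12 2))))).
  have -> : fz Z rel3 = fps_const 3 * (fz Z Y1 * (fz Z Y1 * fz Z Y1) + fps_const (-1) * (fps_X 1 * (fz Z Y2 * (fz Z Y2 * fz Z Y2))))
     + fps_const (-1) * (fz Z Bs * (fz Z Y1 * fz Z Y2)).
    by rewrite /rel3 !(fzB, fzM, fzX, fz_const, fz_X) fps_constN [fps_const 1]rmorph1; ring.
  do ?[apply: agrD|apply: agrZ|apply: agrM]; try exact: agr_sec; try exact: agr_X; exact: agr_Bs.
by move: i; apply: (agr_low h); vm_compute.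
Qed.

End LowCoefficients.

Section CubeRootsOfUnity.
Variables (K : comPzRingType) (o a b c : K).
Hypothesis ho : o ^+ 2 + o + 1 = 0.

Lemma omega_e2 : (a + b + c) * (a + o * b + o ^+ 2 * c) + (a + b + c) * (a + o ^+ 2 * b + o ^+ 4 * c)
  + (a + o * b + o ^+ 2 * c) * (a + o ^+ 2 * b + o ^+ 4 * c) = 3 * a ^+ 2 - 3 * b * c.
Proof.
transitivity (3 * a ^+ 2 - 3 * b * c + (o ^+ 2 + o + 1) * (2 * a * b + 2 * a * c * (1 - o + o ^+ 2) + o * b ^+ 2
  + b * c * (o ^+ 3 + o ^+ 2 - 2 * o + 3) + o ^+ 2 * (1 - o + o ^+ 2) * c ^+ 2)); first by ring.
by rewrite ho mul0r addr0.
Qed.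

Lemma omega_e3 : (a + b + c) * (a + o * b + o ^+ 2 * c) * (a + o ^+ 2 * b + o ^+ 4 * c) =
  a ^+ 3 + b ^+ 3 + c ^+ 3 - 3 * a * b * c.
Proof.
(* The explicit quotient, by [o^2 + o + 1], of the difference of the two sides. *)
pose Q := (1) * o ^+ 4 * a ^+ 1 * b ^+ 0 * c ^+ 2 + (1) * o ^+ 4 * a ^+ 0 * b ^+ 1 * c ^+ 2 + (1) * o ^+ 4 * a ^+ 0 * b ^+ 0 * c ^+ 3 + (1) * o ^+ 3 * a ^+ 1 * b ^+ 1 * c ^+ 1 + (-1) * o ^+ 3 * a ^+ 1 * b ^+ 0 * c ^+ 2 + (1) * o ^+ 3 * a ^+ 0 * b ^+ 2 * c ^+ 1 + (-1) * o ^+ 3 * a ^+ 0 * b ^+ 0 * c ^+ 3 + (1) * o ^+ 2 * a ^+ 2 * b ^+ 0 * c ^+ 1 + (1) * o ^+ 2 * a ^+ 1 * b ^+ 1 * c ^+ 1 + (1) * o ^+ 2 * a ^+ 1 * b ^+ 0 * c ^+ 2 + (-1) * o ^+ 1 * a ^+ 2 * b ^+ 0 * c ^+ 1 + (1) * o ^+ 1 * a ^+ 1 * b ^+ 2 * c ^+ 0 + (-2) * o ^+ 1 * a ^+ 1 * b ^+ 1 * c ^+ 1 + (1) * o ^+ 1 * a ^+ 0 * b ^+ 3 * c ^+ 0 + (1) * o ^+ 1 * a ^+ 0 * b ^+ 0 * c ^+ 3 + (1) * o ^+ 0 * a ^+ 2 * b ^+ 1 * c ^+ 0 + (1) * o ^+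 0 * a ^+ 2 * b ^+ 0 * c ^+ 1 + (3) * o ^+ 0 * a ^+ 1 * b ^+ 1 * c ^+ 1 + (-1) * o ^+ 0 * a ^+ 0 * b ^+ 3 * c ^+ 0 + (-1) * o ^+ 0 * a ^+ 0 * b ^+ 0 * c ^+ 3.
transitivity (a ^+ 3 + b ^+ 3 + c ^+ 3 - 3 * a * b * c + (o ^+ 2 + o + 1) * Q); first by rewrite /Q; ring.
by rewrite ho mul0r addr0.
Qed.

End CubeRootsOfUnity.

Lemma solve_e2 (K : comPzRingType) (r0 r1 r2 b a0 a1 a2 d g : K) : r0 = a0 -> r1 = a1 -> r2 = a2 -> b = d ->
  r0 * r1 + r0 * r2 + r1 * r2 = 3 * b ^+ 2 + g -> g = a0 * a1 + a0 * a2 + a1 * a2 - 3 * d ^+ 2.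
Proof. by move=> -> -> -> -> ->; ring. Qed.

Lemma solve_e3 (K : comPzRingType) (r0 r1 r2 b a0 a1 a2 d g : K) : r0 = a0 -> r1 = a1 -> r2 = a2 -> b = d ->
  r0 * r1 * r2 = b ^+ 3 - 243 * g -> 243 * g = d ^+ 3 - a0 * a1 * a2.
Proof. by move=> -> -> -> -> ->; ring. Qed.

Section CubicRelations.
Variable R : realType.
Local Notation C := R[i].
Implicit Types (w z t q : C).
Local Notation om3 := (om3 R).
Local Notation B := (fz C Bs).
Local Notation y := (fz C ys).
Local Notation s3 := (sqrtN3 R).

(** The Fricke involution exchanges [f] and [h] up to factors, so [|f h|] is multiplied by exactly
    [3^k |t|^(2k)] and [hecke_bound] applies to [f * h]; the low coefficients of [f] alone make the
    product vanish to high order. *)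
Lemma hecke_pair (f h : fps C) (c : C) k n0 : tame f -> tame h -> c != 0 ->
  (8 * k + 6 <= 6 * n0)%N -> (forall n, (n < n0)%N -> f n = 0) ->
  (forall t, 0 < Im t -> ev f (ee (fricke t)) = c * t ^+ k * ev h (ee t)) -> f = 0.
Proof.
move=> tf th c0 hk hf E.
have fh0 : f * h = 0.
  apply: (hecke_bound (tameM tf th) hk) => [n n_n0|t t0].
    by rewrite fpsME big1 // => i _; rewrite hf ?mul0r // (leq_ltn_trans _ n_n0) // -ltnS.
  have w0 := Im_fricke_gt0 t0; have tn := Im_gt0_neq0 t0.
  have q1 := ee_lt1 t0; have q2 := ee_lt1 w0.
  have E2 := E _ w0; rewrite frickeK in E2.
  have e3 : nc (fricke t) = (3 * nc t)^-1 by rewrite /fricke ncN ncV ncM nc_nat.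
  rewrite (evM tf th q2) (evM tf th q1) (E _ t0) E2.
  move: (ev h (ee t)) (ev h (ee (fricke t))) => a b.
  have t1 : nc t ^+ k != 0 by rewrite expf_neq0 // nc_eq0.
  have t3 : (3 : R) ^+ k != 0 by rewrite expf_neq0 // pnatr_eq0.
  have t2 : nc t ^+ (2 * k) = nc t ^+ k * nc t ^+ k by rewrite mul2n -addnn exprD.
  rewrite [LHS]ncM [nc (_ * a)]ncM [nc (c * t ^+ k)]ncM [nc (t ^+ k)]ncX t2.
  rewrite [nc (c * fricke t ^+ k * b * a)]ncM [nc (_ * b)]ncM [nc (c * fricke t ^+ k)]ncM [nc (fricke t ^+ k)]ncX e3 exprVn exprMn.
  move: (nc c) (nc t ^+ k) (3 ^+ k) t1 t3 (nc a) (nc b) => c' T U t1 t3 a' b'.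
  by field; rewrite t1 t3.
have [//|h0] := fps_mul_eq0 fh0.
apply: ev_inj0 => // t t0; have := E _ (Im_fricke_gt0 t0).
by rewrite frickeK h0 ev0 mulr0.
Qed.

Lemma tame_Y i : tame (fz C (fps_sec 3 i ys)).
Proof. by rewrite fz_sec; apply: tame_sec => //; apply: tame_ys. Qed.

Lemma ev_Bs_sec q : nc q < 1 ->
  ev B q = ev B (q ^+ 3) - 9 * (q * ev (fz C Y1) (q ^+ 3)) + 9 * (q ^+ 2 * ev (fz C Y2) (q ^+ 3)).
Proof.
move=> q1.
have q31 : nc (q ^+ 3) < 1 by rewrite ncX pow_lt1 ?nc_ge0.
have E : B = fps_subst 3 B + fps_const (-9) * (fps_X 1 * fps_subst 3 (fz C Y1))
   + fps_const 9 * (fps_X 2 * fps_subst 3 (fz C Y2)).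
  rewrite {1}(@fps_secE _ 3 B) // !big_ord_recl big_ord0 addr0 /= fps_X0 mul1r.
  rewrite -!fz_sec sec_Bs0 sec_Bs1 sec_Bs2 -addrA; congr (_ + (_ + _)).
    by rewrite fzN fzM fz_const fps_substN fps_substM // fps_substC // fps_constN; ring.
  by rewrite fzM fz_const fps_substM // fps_substC //; ring.
have tB := @tame_Bs R; have t1 := tame_Y 1; have t2 := tame_Y 2.
have tc c : tame (fps_const c : fps C) by apply: tame_const.
have tx i : tame (fps_X i : fps C) by apply: tame_X.
have s0 := tame_subst (isT : (0 < 3)%N) tB.
have s1 := tameM (tx 1%N) (tame_subst (isT : (0 < 3)%N) t1).
have s2 := tameM (tx 2%N) (tame_subst (isT : (0 < 3)%N) t2).
rewrite {1}E (evD (tameD s0 (tameM (tc _) s1)) (tameM (tc _) s2) q1) (evD s0 (tameM (tc _) s1) q1).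
rewrite (evM (tc _) s1 q1) (evM (tc _) s2 q1) (evM (tx _) (tame_subst (isT : (0 < 3)%N) t1) q1).
rewrite (evM (tx _) (tame_subst (isT : (0 < 3)%N) t2) q1) !ev_const !ev_X.
rewrite (ev_subst (isT : (0 < 3)%N) tB q1) (ev_subst (isT : (0 < 3)%N) t1 q1) (ev_subst (isT : (0 < 3)%N) t2 q1).
by rewrite expr1 mulNr.
Qed.

Definition B3 (k : int) t := ev B (ee ((t + k%:~R) / 3)).

Lemma B3E (k : int) t : 0 < Im t -> let q := ee t in let x := ee (t / 3) in let z := ee (k%:~R / 3) in
  B3 k t = ev B q - 9 * (z * x * ev (fz C Y1) q) + 9 * (z ^+ 2 * x ^+ 2 * ev (fz C Y2) q).
Proof.
move=> t0 q x z; rewrite /B3.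
have E : ee ((t + k%:~R) / 3) = z * x by rewrite mulrDl eeD mulrC.
have E3 : (z * x) ^+ 3 = q.
  rewrite -E -ee_mul; have -> : 3%:R * ((t + k%:~R) / 3) = t + k%:~R by field.
  exact: ee_Dint.
rewrite E (ev_Bs_sec (q := z * x)) ?E3 ?exprMn // -E; apply: ee_lt1.
by rewrite (Im_divn _ 2) divr_gt0 // Im_Dint.
Qed.

Lemma ee_third : ee (1%:~R / 3) = om3 /\ ee ((-1)%:~R / 3) = om3 ^+ 2.
Proof.
split=> //; rewrite -[LHS](ee_Dint _ 1) -ee_mul; congr ee.
by field.
Qed.

Lemma B3_abc t : 0 < Im t -> exists a b c : C,
  [/\ [/\ B3 0 t = a + b + c, B3 1 t = a + om3 * b + om3 ^+ 2 * c & B3 (-1) t = a + om3 ^+ 2 * b + om3 ^+ 4 * c],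
    a = ev B (ee t), b * c = - (81 * (ee t * (ev (fz C Y1) (ee t) * ev (fz C Y2) (ee t)))),
    b ^+ 3 = - (729 * (ee t * ev (fz C Y1) (ee t) ^+ 3)) & c ^+ 3 = 729 * (ee t ^+ 2 * ev (fz C Y2) (ee t) ^+ 3)].
Proof.
move=> t0; exists (ev B (ee t)), (- (9 * (ee (t / 3) * ev (fz C Y1) (ee t)))), (9 * (ee (t / 3) ^+ 2 * ev (fz C Y2) (ee t))).
rewrite !B3E //; have [-> ->] := ee_third; rewrite mul0r ee0.
have E3 : ee t = ee (t / 3) ^+ 3 by rewrite -ee_mul mulrC divfK ?pnatr_eq0.
move: (ev B _) (ev (fz C Y1) _) (ev (fz C Y2) _) => a b c; rewrite E3; move: (ee (t / 3)) om3 => x o.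
by split=> //; [split|..]; ring.
Qed.

Lemma B3_e2 t : 0 < Im t -> B3 0 t * B3 1 t + B3 0 t * B3 (-1) t + B3 1 t * B3 (-1) t =
  3 * ev B (ee t) ^+ 2 + 243 * (ee t * (ev (fz C Y1) (ee t) * ev (fz C Y2) (ee t))).
Proof.
move=> t0; have [a [b [c [[-> -> ->] <- hbc _ _]]]] := B3_abc t0.
rewrite (omega_e2 a b c (om3_sum R)) -mulrA hbc; ring.
Qed.

Lemma B3_e3 t : 0 < Im t -> B3 0 t * B3 1 t * B3 (-1) t =
  ev B (ee t) ^+ 3 - 243 * (ee t * (3 * (ev (fz C Y1) (ee t) ^+ 3 - ee t * ev (fz C Y2) (ee t) ^+ 3)
     - ev B (ee t) * (ev (fz C Y1) (ee t) * ev (fz C Y2) (ee t)))).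
Proof.
move=> t0; have [a [b [c [[-> -> ->] E hbc hb hc]]]] := B3_abc t0.
rewrite (omega_e3 a b c (om3_sum R)) -mulrA hbc hb hc -E; ring.
Qed.

Lemma B3_fricke0 t : 0 < Im t -> B3 0 (fricke t) = 27 * t ^+ 3 * (81 * s3 * ev y (ee t ^+ 3)).
Proof.
move=> t0; have t30 : 0 < Im (3 * t) by rewrite (Im_natM 3) mulr_gt0.
rewrite /B3 -ee_mul; have -> : (fricke t + 0%:~R) / 3 = fricke (3 * t).
  by rewrite /fricke addr0; field; rewrite Im_gt0_neq0.
by rewrite fricke_Bs //; ring.
Qed.

(** For [e = 1] or [-1], [(fricke t + e) / 3] is [fricke u] with [u = fricke v - e] and
    [v = t - e / 3]. Two Fricke steps and a translation thus bring the value back to [B] at [v],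
    with [u v = - e t] for the automorphy factor. *)
Lemma B3_fricke_shift t (e : int) : 0 < Im t -> e * e = 1 ->
  B3 e (fricke t) = e%:~R * 27 * t ^+ 3 * ev B (ee (t + (- e)%:~R / 3)).
Proof.
move=> t0 e1; set v := t + (- e)%:~R / 3; set u := fricke v + (- e)%:~R.
have eC : (e%:~R : C) ^+ 2 = 1 by rewrite expr2 -rmorphM /= e1.
have v0 : 0 < Im v.
  have -> : v = ((- e)%:~R + 3 * t) / 3%:R by rewrite /v; field.
  by rewrite Im_divn divr_gt0 // addrC Im_Dint (Im_natM 3) mulr_gt0.
have vn := Im_gt0_neq0 v0; have tn := Im_gt0_neq0 t0.
have u0 : 0 < Im u by rewrite Im_Dint Im_fricke_gt0.
have un := Im_gt0_neq0 u0.
have uv : u * v = - e%:~R * t.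
  have -> : u * v = - 3^-1 - e%:~R * v by rewrite /u /fricke; field.
  rewrite /v rmorphN /=; move: (e%:~R : C) eC => x x2.
  have -> : - 3^-1 - x * (t + - x / 3) = - x * t + (x ^+ 2 - 1) / 3 by field.
  by rewrite x2 subrr mul0r addr0.
have E : (fricke t + e%:~R) / 3 = fricke u.
  apply: (mulfI un); rewrite {2}/fricke; apply: (mulfI vn).
  rewrite [v * (u * ((fricke t + _) / 3))]mulrA [v * u]mulrC uv.
  have -> : v * (u * - (3 * u)^-1) = - v / 3 by field.
  rewrite /v /fricke rmorphN /=; move: (e%:~R : C) eC => x x2.
  have -> : - x * t * ((- (3 * t)^-1 + x) / 3) = (x / 3 - x ^+ 2 * t) / 3 by field.
  by rewrite x2; field.
have F1 : B3 e (fricke t) = 81 * s3 * u ^+ 3 * (s3 / 9 * v ^+ 3 * ev B (ee v)).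
  by rewrite /B3 E fricke_Bs // -(fricke_ys v0) /u ee_Dint.
rewrite F1; move: (ev B (ee v)) s3 (sqrtN3_sq R) (e%:~R : C) eC uv; clear.
clearbody u; clearbody v; move=> z s s2 x x2 uv.
transitivity (9 * s ^+ 2 * (u * v) ^+ 3 * z); first by field.
rewrite s2 uv.
have -> : 9 * -3 * (- x * t) ^+ 3 * z = x ^+ 2 * (x * 27 * t ^+ 3 * z) by ring.
by rewrite x2 mul1r.
Qed.

(** [Bm], [Bp] and [y3] are [B] at [t - 1/3], [B] at [t + 1/3] and [y] at [3 t]: up to factors, the
    three values [B3] seen through the Fricke involution. *)
Definition Bm := fps_scale (om3 ^+ 2) B.
Definition Bp := fps_scale om3 B.
Definition y3 := fps_subst 3 y.

Lemma tame_Bm : tame Bm.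
Proof. by apply: tame_scale; [rewrite ncX nc_om3 expr1n|exact: tame_Bs]. Qed.
Lemma tame_Bp : tame Bp.
Proof. by apply: tame_scale; [rewrite nc_om3|exact: tame_Bs]. Qed.
Lemma tame_y3 : tame y3.
Proof. by apply: tame_subst => //; exact: tame_ys. Qed.

Lemma B3_fricke t : 0 < Im t ->
  [/\ B3 0 (fricke t) = 27 * t ^+ 3 * (81 * s3 * ev y3 (ee t)),
      B3 1 (fricke t) = 27 * t ^+ 3 * ev Bm (ee t) &
      B3 (-1) (fricke t) = - (27 * t ^+ 3 * ev Bp (ee t))].
Proof.
move=> t0; have [e1 e2] := ee_third.
split.
- have -> : ev y3 (ee t) = ev y (ee t ^+ 3) by apply: ev_subst (@tame_ys R) (ee_lt1 t0).
  exact: B3_fricke0.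
- have -> : ev Bm (ee t) = ev B (ee (t + (- 1)%:~R / 3)).
    by rewrite eeD e2 mulrC; apply: ev_scale.
  by rewrite (B3_fricke_shift t0 (e := 1)) // !mul1r.
- have -> : ev Bp (ee t) = ev B (ee (t + (- - 1)%:~R / 3)).
    by rewrite opprK eeD e1 mulrC; apply: ev_scale.
  by rewrite (B3_fricke_shift t0 (e := -1)) // !mulNr mul1r.
Qed.

Lemma ev_ss q : nc q < 1 -> ev (fz C ss) q = ev B q + 27 * ev y q.
Proof.
move=> q1; have tc : tame (fps_const 27 : fps C) by apply: tame_const.
have -> : fz C ss = B + fps_const 27 * y by rewrite /ss fzD fzM fz_const.
by rewrite (evD (@tame_Bs R) (tameM tc (@tame_ys R)) q1) (evM tc (@tame_ys R) q1) ev_const.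
Qed.

Lemma tame_ss : tame (fz C ss).
Proof.
have -> : fz C ss = B + fps_const 27 * y by rewrite /ss fzD fzM fz_const.
by apply: tameD; [exact: tame_Bs|apply: tameM; [exact: tame_const|exact: tame_ys]].
Qed.

Lemma fz_inj f : fz C f = 0 -> f = 0.
Proof.
move/fpsP=> h; apply/fpsP => n; apply/eqP; have := h n; rewrite fps0E /= => /eqP.
by rewrite intr_eq0 => /eqP ->; case: n.
Qed.

Lemma fz_low (f : fps int) n0 : (forall i, (i < n0)%N -> f i = 0) -> forall i, (i < n0)%N -> fz C f i = 0.
Proof. by move=> h i hi; rewrite /= h. Qed.

Lemma fricke_rel2 (t a b c Y b0 s : C) : s ^+ 2 = -3 ->
  27 * t ^+ 3 * (81 * s * a) * (27 * t ^+ 3 * b) +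
  27 * t ^+ 3 * (81 * s * a) * - (27 * t ^+ 3 * c) +
  27 * t ^+ 3 * b * - (27 * t ^+ 3 * c) -
  3 * (81 * s * t ^+ 3 * Y) ^+ 2 -
  243 * (3 * (s / 9 * t ^+ 3 * b0 * (81 * s * t ^+ 3 * Y + 27 * (s / 9 * t ^+ 3 * b0)))) =
  243 * (3 * t ^+ 6 *
    (81 * s * (a * (b - c)) - b * c + 81 * Y ^+ 2 + b0 * (b0 + 27 * Y))).
Proof.
move=> s2.
transitivity (729 * (t ^+ 6 * (81 * s * (a * (b - c)) - b * c)) +
  s ^+ 2 * - (3 * 81 ^+ 2 * t ^+ 6 * Y ^+ 2 + 243 * t ^+ 6 * b0 * (27 * Y + b0))); first by field.
by rewrite s2; ring.
Qed.

Lemma fricke_rel3 (t a b c Y s : C) : s ^+ 2 = -3 ->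
  (81 * s * t ^+ 3 * Y) ^+ 3 -
  27 * t ^+ 3 * (81 * s * a) * (27 * t ^+ 3 * b) * - (27 * t ^+ 3 * c) =
  243 * (81 * t ^+ 9 * (81 * s * (a * (b * c)) + -81 * s * Y ^+ 3)).
Proof.
move=> s2.
transitivity (81 ^+ 3 * s * s ^+ 2 * t ^+ 9 * Y ^+ 3 + 19683 * 81 * t ^+ 9 * s * (a * (b * c))); first by ring.
by rewrite s2; ring.
Qed.

Lemma rel2_eq0 : rel2 = 0.
Proof.
have ty := @tame_ys R. have tB := @tame_Bs R. have ts := tame_ss.
have t1 := tame_Y 1. have t2 := tame_Y 2.
have tc c : tame (fps_const c : fps C) by apply: tame_const.
have tx i : tame (fps_X i : fps C) by apply: tame_X.
apply: fz_inj.
have Er : fz C rel2 = fps_X 1 * (fz C Y1 * fz C Y2) - fps_const 3 * (y * fz C ss).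
  by rewrite /rel2 !(fzB, fzM, fz_const, fz_X).
have t12 := tameM (tx 1%N) (tameM t1 t2). have tys := tameM (tc 3) (tameM ty ts).
have tr : tame (fz C rel2) by rewrite Er; apply: tameB.
(* Read off from [fricke_rel2]: the Fricke transform of [rel2] divided by [3 t^6]. For [hecke_pair]
   it is enough that it converges in the disc. *)
pose h := fps_const (81 * s3) * (y3 * (Bm - Bp)) - Bm * Bp + fps_const 81 * y ^+ 2 + B * fz C ss.
have ta := tameM (tc (81 * s3)) (tameM tame_y3 (tameB tame_Bm tame_Bp)).
have tb := tameM tame_Bm tame_Bp. have td := tameM (tc 81) (tameX 2 ty).
have te := tameM tB ts.
have th : tame h := tameD (tameD (tameB ta tb) td) te.
apply: (@hecke_pair _ h 3 6 9 tr th) => //; first by rewrite pnatr_eq0.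
  exact: (fz_low rel2_low).
move=> t t0; have q1 := ee_lt1 t0. have w0 := Im_fricke_gt0 t0. have w1 := ee_lt1 w0.
have n243 : (243 : C) != 0 by rewrite pnatr_eq0.
apply: (mulfI n243).
have [r0 r1 r2] := B3_fricke t0.
have E2 := solve_e2 r0 r1 r2 (fricke_Bs t0) (B3_e2 w0).
rewrite Er (evB t12 tys w1) (evM (tx _) (tameM t1 t2) w1) (evM t1 t2 w1) (evM (tc _) (tameM ty ts) w1) (evM ty ts w1).
rewrite ev_X expr1 ev_const mulrBr.
rewrite E2 (ev_ss w1) (fricke_Bs t0) (fricke_ys t0).
rewrite /h (evD (tameD (tameB ta tb) td) te q1) (evD (tameB ta tb) td q1) (evB ta tb q1).
rewrite (evM (tc _) (tameM tame_y3 (tameB tame_Bm tame_Bp)) q1) (evM tame_y3 (tameB tame_Bm tame_Bp) q1).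
rewrite (evB tame_Bm tame_Bp q1) (evM tame_Bm tame_Bp q1) (evM (tc _) (tameX 2 ty) q1) (evX 2 ty q1) (evM tB ts q1).
rewrite (ev_ss q1) !ev_const.
exact: (fricke_rel2 t _ _ _ _ _ (sqrtN3_sq R)).
Qed.

Lemma rel3_eq0 : rel3 = 0.
Proof.
have ty := @tame_ys R. have tB := @tame_Bs R.
have t1 := tame_Y 1. have t2 := tame_Y 2.
have tc c : tame (fps_const c : fps C) by apply: tame_const.
have tx i : tame (fps_X i : fps C) by apply: tame_X.
have Er : fz C rel3 = fps_const 3 * (fz C Y1 ^+ 3 - fps_X 1 * fz C Y2 ^+ 3) - B * (fz C Y1 * fz C Y2).
  by rewrite /rel3 !(fzB, fzM, fzX, fz_const, fz_X).
have ta := tameX 3 t1. have tb := tameM (tx 1%N) (tameX 3 t2). have td := tameM (tc 3) (tameB ta tb).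
have te := tameM tB (tameM t1 t2).
have tr : tame (fz C rel3) by rewrite Er; apply: tameB.
(* The identity [B3_e3] carries the factor [ee t], so the transformation law obtained is that of
   [X * rel3]. *)
suff E : fps_X 1 * fz C rel3 = 0.
  by apply: fz_inj; apply/fpsP => n; move/fpsP: E => /(_ n.+1); rewrite fps_XM /= subn1 => ->; case: n.
pose h := fps_const (81 * s3) * (y3 * (Bm * Bp)) + fps_const (- 81 * s3) * y ^+ 3.
have tf := tameM tame_y3 (tameM tame_Bm tame_Bp).
have tg := tameX 3 ty.
have th : tame h := tameD (tameM (tc _) tf) (tameM (tc _) tg).
apply: (@hecke_pair _ h 81 9 13 (tameM (tx 1%N) tr) th) => //; first by rewrite pnatr_eq0.
  by move=> n n13; rewrite fps_XM; case: ifP => // _; apply: (fz_low rel3_low); lia.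
move=> t t0; have q1 := ee_lt1 t0. have w0 := Im_fricke_gt0 t0. have w1 := ee_lt1 w0.
have n243 : (243 : C) != 0 by rewrite pnatr_eq0.
apply: (mulfI n243).
have [r0 r1 r2] := B3_fricke t0.
have E3 := solve_e3 r0 r1 r2 (fricke_Bs t0) (B3_e3 w0).
rewrite (evM (tx _) tr w1) Er (evB td te w1) (evM (tc _) (tameB ta tb) w1) (evB ta tb w1) (evM (tx _) (tameX 3 t2) w1).
rewrite (evX 3 t1 w1) (evX 3 t2 w1) (evM tB (tameM t1 t2) w1) (evM t1 t2 w1) ev_X expr1 ev_const E3.
rewrite /h (evD (tameM (tc _) tf) (tameM (tc _) tg) q1) (evM (tc _) tf q1) (evM (tc _) tg q1) (evX 3 ty q1).
rewrite (evM tame_y3 (tameM tame_Bm tame_Bp) q1) (evM tame_Bm tame_Bp q1) !ev_const.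
exact: (fricke_rel3 t _ _ _ _ (sqrtN3_sq R)).
Qed.

End CubicRelations.

(** * Modular forms as polynomials in B and y *)

Section FpsExtra.
Variable k : comNzRingType.
Implicit Types f g : fps k.

Lemma fps_scale_subst (c : k) p f : (0 < p)%N -> fps_scale c (fps_subst p f) = fps_subst p (fps_scale (c ^+ p) f).
Proof.
move=> p0; apply/fpsP => n /=; case: ifP => [/divnK E|_]; last by rewrite mulr0.
by rewrite -exprM mulnC E.
Qed.

Lemma fps_scale_comp (c d : k) f : fps_scale c (fps_scale d f) = fps_scale (c * d) f.
Proof. by apply/fpsP => n /=; rewrite exprMn mulrA. Qed.

Lemma fps_scale_X (c : k) i : fps_scale c (fps_X i) = fps_const (c ^+ i) * fps_X i.
Proof.
apply/fpsP => n; rewrite fps_constM /=; case: eqP => [->//|_]; by rewrite !mulr0.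
Qed.

Lemma fps_scaleM (c : k) f g : fps_scale c (f * g) = fps_scale c f * fps_scale c g.
Proof. exact: rmorphM. Qed.
Lemma fps_scaleXn (c : k) f n : fps_scale c (f ^+ n) = fps_scale c f ^+ n.
Proof. exact: rmorphXn. Qed.
Lemma fps_scaleD (c : k) f g : fps_scale c (f + g) = fps_scale c f + fps_scale c g.
Proof. exact: rmorphD. Qed.

Lemma fps_inv_uniq f g : f 0%N = 1 -> f * g = 1 -> g = fps_inv f.
Proof. by move=> f0 fg; rewrite -[LHS]mulr1 -(fps_invP f0) mulrA [g * f]mulrC fg mul1r. Qed.

Definition fps_tail f : fps k := fps_sec 1 1 f.

Lemma fps_tailE f : f 0%N = 0 -> f = fps_X 1 * fps_tail f.
Proof.
move=> f0; apply/fpsP => n; rewrite fps_XM; case: n => [//|n].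
by rewrite /= mul1n subn1 addn1.
Qed.

Lemma fps_subst_X1 p : (0 < p)%N -> fps_subst p (fps_X 1) = fps_X p :> fps k.
Proof.
move=> p0; apply/fpsP => n /=; case: ifP => [/divnK E|h].
  have -> : (n == p) = (n %/ p * p == 1 * p)%N by rewrite E mul1n.
  by rewrite eqn_pmul2r.
by case: eqP h => // ->; rewrite dvdnn.
Qed.

Lemma fps_X1_inj f g : fps_X 1 * f = fps_X 1 * g -> f = g.
Proof. by move/fpsP=> h; apply/fpsP => n; have := h n.+1; rewrite !fps_XM /= subn1. Qed.

Definition form n (c : nat -> k) (u w : k) : k := \sum_(j < n.+1) c j * (u ^+ (n - j) * w ^+ j).

Lemma formS n c u w : form n.+1 c u w = c 0%N * u ^+ n.+1 + w * form n (c \o S) u w.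
Proof.
rewrite /form big_ord_recl subn0 expr0 mulr1 mulr_sumr; congr (_ + _).
by apply: eq_bigr => j _; rewrite /= /bump /= add1n subSS exprS; ring.
Qed.

End FpsExtra.

Lemma fps_map_inv (k k' : comNzRingType) (phi : {rmorphism k -> k'}) (f : fps k) :
  f 0%N = 1 -> fps_map phi (fps_inv f) = fps_inv (fps_map phi f).
Proof.
move=> f0; apply: fps_inv_uniq; first by rewrite /= f0 rmorph1.
by rewrite -rmorphM fps_invP // rmorph1.
Qed.

(** * The cubic relations over the integers *)

Section IntegralRelations.

Lemma fps_nat (k : comNzRingType) n : fps_const (n%:R : k) = n%:R.
Proof. by rewrite rmorph_nat. Qed.

Lemma fps_int_reg (n : nat) (f g : fps int) : n.+1%:R * f = n.+1%:R * g -> f = g.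
Proof.
rewrite -!fps_nat => /fpsP h; apply/fpsP => i; have := h i; rewrite !fps_constM.
by apply: mulfI; rewrite pnatr_eq0.
Qed.

Lemma ys1 : ys 1%N = 1. Proof. by rewrite /ys /= big_ord_recl big_ord0 addr0 big_mkcond !big_ord_recl big_ord0. Qed.

Lemma ssE : ss = Bs + 27%:R * ys. Proof. by rewrite -fps_nat. Qed.

Lemma rel2E : fps_X 1 * (Y1 * Y2) = 3%:R * (ys * ss).
Proof. by have := rel2_eq0 Rdefinitions.R; rewrite /rel2 => /eqP; rewrite subr_eq0 => /eqP ->; rewrite -fps_nat. Qed.

Lemma rel3E : 3%:R * (Y1 ^+ 3 - fps_X 1 * Y2 ^+ 3) = Bs * (Y1 * Y2).
Proof. by have := rel3_eq0 Rdefinitions.R; rewrite /rel3 => /eqP; rewrite subr_eq0 => /eqP <-; rewrite -fps_nat. Qed.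

Lemma ss0 : ss 0%N = 1.
Proof. by rewrite ssE -fps_nat fpsDE fps_constM ys0 Bs0 mulr0 addr0. Qed.

Lemma rel23 : fps_X 1 * Y1 ^+ 3 - fps_X 1 ^+ 2 * Y2 ^+ 3 = ys * ss * Bs.
Proof.
apply: (@fps_int_reg 2).
transitivity (fps_X 1 * (3%:R * (Y1 ^+ 3 - fps_X 1 * Y2 ^+ 3))); first by ring.
rewrite rel3E; transitivity (Bs * (fps_X 1 * (Y1 * Y2))); first by ring.
by rewrite rel2E; ring.
Qed.

(** [P = X Y1^3] and [Q = X^2 Y2^3] have product [27 y^3 s^3] and difference [y s B], where
    [B = s - 27 y]. The resulting quadratic equation factors as [(P - y s^2)(P + 27 y^2 s) = 0], and
    the coefficient of [X] excludes the second factor. *)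
Lemma XY1_cube : fps_X 1 * Y1 ^+ 3 = ys * ss ^+ 2.
Proof.
have PQ : (fps_X 1 * Y1 ^+ 3) * (fps_X 1 ^+ 2 * Y2 ^+ 3) = 27%:R * ys ^+ 3 * ss ^+ 3.
  transitivity ((fps_X 1 * (Y1 * Y2)) ^+ 3); first by ring.
  by rewrite rel2E; ring.
have E : (fps_X 1 * Y1 ^+ 3 - ys * ss ^+ 2) * (fps_X 1 * Y1 ^+ 3 + 27%:R * ys ^+ 2 * ss) = 0.
  have h := rel23; move: PQ h; set P := fps_X 1 * Y1 ^+ 3; set Q := fps_X 1 ^+ 2 * _ => PQ h.
  have Q_E : Q = P - ys * ss * Bs by rewrite -h; ring.
  have B_E : Bs = ss - 27%:R * ys by rewrite ssE; ring.
  transitivity (P * Q - 27%:R * ys ^+ 3 * ss ^+ 3); last by rewrite PQ subrr.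
  by rewrite Q_E B_E; ring.
case: (fps_mul_eq0 E) => [/eqP|/fpsP/(_ 1%N)]; first by rewrite subr_eq0 => /eqP.
have z : (27%:R * ys ^+ 2 * ss) 1%N = 0.
  rewrite -fps_nat -mulrA fps_constM [_ * ss]mulrC fpsME big_ord_recl big_ord_recl big_ord0 /=.
  by rewrite !fps_order0 ?ys0 ?fpsX0 ?ys0 ?expr0n ?mulr0 ?addr0 ?mulr0.
have Y10 : Y1 0%N = 1 by exact: ys1.
have -> : (0 : fps int) 1%N = 0 by [].
by rewrite fpsDE z fps_XM subnn fpsX0 Y10 expr1n.
Qed.

Lemma ssY2 : ss * Y2 = 3%:R * Y1 ^+ 2.
Proof.
have Y1n0 : fps_X 1 * Y1 <> 0.
  have Y10 : Y1 0%N = 1 by exact: ys1.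
  by move/fpsP/(_ 1%N); rewrite fps_XM subnn Y10.
apply: (fps_mulI Y1n0).
transitivity (ss * (fps_X 1 * (Y1 * Y2))); first by ring.
rewrite rel2E; transitivity (3%:R * (fps_X 1 * Y1 ^+ 3)); last by ring.
by rewrite XY1_cube; ring.
Qed.

Lemma X2Y2_cube : fps_X 1 ^+ 2 * Y2 ^+ 3 = 27%:R * ys ^+ 2 * ss.
Proof.
have -> : fps_X 1 ^+ 2 * Y2 ^+ 3 = fps_X 1 * Y1 ^+ 3 - ys * ss * Bs by rewrite -rel23; ring.
have B_E : Bs = ss - 27%:R * ys by rewrite ssE; ring.
by rewrite XY1_cube B_E; ring.
Qed.

(** The norm of [f(x)] over series in [X = x^3], that is [f(x) f(w x) f(w^2 x)] for a primitive cube
    root of unity [w], written through the 3-sections so that it makes sense over the integers. *)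
Definition cube_norm (k : comNzRingType) (f : fps k) : fps k :=
  fps_sec 3 0 f ^+ 3 + fps_X 1 * fps_sec 3 1 f ^+ 3 + fps_X 1 ^+ 2 * fps_sec 3 2 f ^+ 3
  - 3%:R * fps_X 1 * (fps_sec 3 0 f * fps_sec 3 1 f * fps_sec 3 2 f).

Lemma cube_norm_Bs : cube_norm Bs = Bs ^+ 3.
Proof.
rewrite /cube_norm sec_Bs0 sec_Bs1 sec_Bs2 -[9]/(9%:R) !fps_nat.
transitivity (Bs ^+ 3 - 243%:R * fps_X 1 * (3%:R * (Y1 ^+ 3 - fps_X 1 * Y2 ^+ 3) - Bs * (Y1 * Y2))); first by ring.
by rewrite rel3E subrr mulr0 subr0.
Qed.

Lemma cube_norm_ys : cube_norm ys = ys * Bs ^+ 2.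
Proof.
rewrite /cube_norm sec_ys0 -[9]/(9%:R) !fps_nat -/Y1 -/Y2 XY1_cube X2Y2_cube.
have -> : 3%:R * fps_X 1 * (9%:R * ys * Y1 * Y2) = 27%:R * ys * (fps_X 1 * (Y1 * Y2)) by ring.
have B_E : Bs = ss - 27%:R * ys by rewrite ssE; ring.
by rewrite rel2E B_E; ring.
Qed.

Lemma cube_norm_fz (k : comNzRingType) (f : fps int) : cube_norm (fz k f) = fz k (cube_norm f).
Proof.
by rewrite /cube_norm -!fps_nat !(fzB, fzD, fzX, fzM, fz_X, fz_sec, fz_const).
Qed.

End IntegralRelations.

(** * Convergence of [1/B] and [X/y] in the unit disc *)

Section TameInverse.
Variable R : realType.
Local Notation C := R[i].
Local Notation om3 := (om3 R).
Local Notation B := (fz C Bs).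
Local Notation y := (fz C ys).
Local Notation s3 := (sqrtN3 R).
Implicit Types f g h : fps C.

Lemma cube_normE f : f * (fps_scale om3 f * fps_scale (om3 ^+ 2) f) = fps_subst 3 (cube_norm f).
Proof.
pose a := fps_subst 3 (fps_sec 3 0 f); pose b := fps_X 1 * fps_subst 3 (fps_sec 3 1 f).
pose c := fps_X 2 * fps_subst 3 (fps_sec 3 2 f).
have E : f = a + b + c.
  by rewrite {1}(@fps_secE _ 3 f) // !big_ord_recl big_ord0 addr0 /= fps_X0 mul1r addrA.
have o3 := om3_cube R.
have sc d g : d ^+ 3 = 1 -> fps_scale d (fps_subst 3 g) = fps_subst 3 g.
  move=> d3; rewrite fps_scale_subst // d3; congr fps_subst.
  by apply/fpsP => n /=; rewrite expr1n mul1r.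
have sE d : d ^+ 3 = 1 -> fps_scale d f = a + fps_const d * b + fps_const d ^+ 2 * c.
  move=> d3; rewrite E !fps_scaleD !fps_scaleM !fps_scale_X !sc // expr1 (rmorphXn (@fps_const C)).
  by rewrite /a /b /c !mulrA.
have o6 : (om3 ^+ 2) ^+ 3 = 1 by rewrite -exprM mulnC exprM o3 expr1n.
rewrite (sE _ o3) (sE _ o6) {1}E mulrA.
have ho : fps_const om3 ^+ 2 + fps_const om3 + 1 = 0.
  by rewrite -(rmorphXn (@fps_const C)) -rmorphD -(rmorph1 (@fps_const C)) -rmorphD /= om3_sum rmorph0.
have -> : fps_const (om3 ^+ 2) = fps_const om3 ^+ 2 by rewrite (rmorphXn (@fps_const C)).
have -> : (fps_const om3 ^+ 2) ^+ 2 = fps_const om3 ^+ 4 by rewrite -exprM.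
rewrite (omega_e3 a b c ho) /cube_norm fps_substB !fps_substD -fps_nat.
rewrite !(fps_substX, fps_substM) // fps_substC //.
have X3 : fps_subst 3 (fps_X 1) = fps_X 1 ^+ 3 :> fps C by rewrite fps_subst_X1 // fps_XX.
have X2 : fps_X 2 = fps_X 1 ^+ 2 :> fps C by rewrite fps_XX.
by rewrite /a /b /c X3 X2 fps_nat; ring.
Qed.

Lemma fps_inv_growth f : tame f -> f 0%N = 1 -> exists2 A : R, 0 < A & forall n, nc (fps_inv f n) <= A ^+ n.
Proof.
move=> tf f0; have h2 : (0 : R) <= 1 / 2 by lra.
have h21 : (1 / 2 : R) < 1 by lra.
have [M hM] := tf _ h2 h21.
have M0 : 0 <= M by apply: le_trans (hM 0%N); rewrite mulr_ge0 ?nc_ge0.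
have hf n : nc (f n) <= M * 2 ^+ n.
  have := hM n; rewrite div1r exprVn ler_pdivrMr //; by rewrite exprn_gt0.
(* The choice [A - 2 M = 2] makes the majorant of the recursion telescope to exactly [A^n - 2^n]. *)
pose A := 2 * M + 2; exists A; first by rewrite /A; lra.
have A0 : 0 <= A by rewrite /A; lra.
set g := fps_inv f.
have gS n : g n.+1 = - \sum_(i < n.+1) f i.+1 * g (n - i)%N.
  have := fps_invP f0; rewrite -/g => /fpsP /(_ n.+1); rewrite fpsME fps1E /= big_ord_recl f0 mul1r subn0.
  by move/eqP; rewrite addr_eq0 => /eqP ->; congr (- _); apply: eq_bigr => i _; rewrite /= /bump add1n subSS.
have S n : \sum_(i < n) M * 2 ^+ i.+1 * A ^+ (n.-1 - i) <= A ^+ n - 2 ^+ n.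
  elim: n => [|n IH]; first by rewrite big_ord0 !expr0 subrr.
  rewrite big_ord_recr /= subnn expr0 mulr1.
  have -> : \sum_(i < n) M * 2 ^+ i.+1 * A ^+ (n - i) = A * \sum_(i < n) M * 2 ^+ i.+1 * A ^+ (n.-1 - i).
    rewrite mulr_sumr; apply: eq_bigr => i _.
    have -> : (n - i)%N = (n.-1 - i).+1 by have := ltn_ord i; lia.
    by rewrite [A ^+ _.+1]exprS mulrCA.
  apply: le_trans (lerD (ler_wpM2l A0 IH) (lexx _)) _.
  by rewrite !exprS /A le_eqVlt; apply/orP; left; apply/eqP; ring.
elim/ltn_ind => -[|n] IH; first by rewrite fps_inv0 // nc1.
rewrite gS ncN (le_trans (nc_sum _ _ _)) //.
apply: (@le_trans _ _ (\sum_(i < n.+1) M * 2 ^+ i.+1 * A ^+ (n.+1.-1 - i))).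
  apply: ler_sum => i _; rewrite ncM ler_pM ?nc_ge0 //.
  by apply: IH; rewrite ltnS leq_subr.
by apply: le_trans (S _) _; rewrite gerBl exprn_ge0.
Qed.

(** The functional equation bootstraps the radius of convergence: if [fps_inv f] is controlled up to
    [d^3], the right-hand side is controlled up to [d]. Starting from the crude radius [1/A],
    repeated cube roots reach every radius below 1. *)
Lemma tame_fps_inv f h k e : tame f -> f 0%N = 1 -> tame h -> tame k ->
  fps_inv f = h * fps_subst 3 (k * fps_inv f ^+ e) -> tame (fps_inv f).
Proof.
move=> tf f0 th tk E; set g := fps_inv f.
have [A A0 hA] := fps_inv_growth tf f0.
pose T (d : R) := tame (fps_scale (d%:C)%C g).
have ncC (d : R) : 0 <= d -> nc ((d%:C)%C : C) = d by move=> d0; rewrite nc_real ger0_norm.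
have base : T A^-1.
  apply: (@tame_growth _ _ 0 1) => n; rewrite expr0 mulr1 /= ncM ncX ncC ?invr_ge0 ?(ltW A0) //.
  by rewrite exprVn ler_pdivrMl ?exprn_gt0 // mulr1 hA.
have step d : 0 <= d -> d <= 1 -> T (d ^+ 3) -> T d.
  move=> d0 d1 h3; rewrite /T /g E fps_scaleM fps_scale_subst // fps_scaleM fps_scaleXn -/g.
  have nd : nc ((d%:C)%C : C) <= 1 by rewrite ncC.
  apply: tameM; first exact: tame_scale.
  apply: tame_subst => //; apply: tameM; first by apply: tame_scale; rewrite // ncX exprn_ile1 ?nc_ge0.
  by apply: tameX; have -> : ((d%:C)%C ^+ 3 : C) = ((d ^+ 3)%:C)%C by rewrite rmorphXn.
have mono c d : 0 <= d -> d <= c -> 0 < c -> T c -> T d.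
  move=> d0 dc c0 Tc; rewrite /T.
  have -> : (d%:C)%C = ((d / c)%:C)%C * (c%:C)%C :> C by rewrite -rmorphM /= divfK // gt_eqF.
  rewrite -fps_scale_comp; apply: tame_scale => //.
  by rewrite ncC ?divr_ge0 ?(ltW c0) // ler_pdivrMr // mul1r.
have iterT n d : 0 <= d -> d <= 1 -> T (d ^+ (3 ^ n)) -> T d.
  elim: n d => [|n IH] d d0 d1; first by rewrite expn0 expr1.
  rewrite expnS exprM => h3; apply: (step d d0 d1); apply: (IH (d ^+ 3) _ _ h3); first exact: exprn_ge0.
  exact: exprn_ile1.
have all d : 0 <= d -> d < 1 -> T d.
  move=> d0 d1; have Ai : 0 < A^-1 by rewrite invr_gt0.
  have [N hN] := archi_small (1 - d)^-1 Ai.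
  have dN : d ^+ N <= A^-1.
    have := hN N (leqnn _); have := pow_lt1_mul N d0 d1.
    have N0 : (0 : R) < N.+1%:R by [].
    rewrite ltr_pdivrMr // => a b; rewrite -(ler_pM2l N0) (le_trans a) //.
    by rewrite mulrC ltW.
  apply: (iterT N d d0 (ltW d1)); apply: (mono A^-1 _ _ _ Ai base); first exact: exprn_ge0.
  apply: le_trans dN; apply: ler_wiXn2l => //; first exact: ltW.
  exact/ltnW/ltn_expl.
apply: tame_pos => r r0 r1; pose d := Num.sqrt r.
have d0 : 0 <= d by apply: sqrtr_ge0.
have d2 : d ^+ 2 = r by rewrite sqr_sqrtr // ltW.
have d1 : d < 1 by rewrite -(@ltr_pXn2r _ 2) ?nnegrE ?ler01 // d2 expr1n.
have [M hM] := all d d0 d1 d d0 d1; exists M => n.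
apply: le_trans (hM n); rewrite /= ncM ncX ncC // -d2 -exprM mulnC exprM expr2.
by rewrite le_eqVlt mulrA [d ^+ n * nc _]mulrC eqxx.
Qed.

Lemma B0 : B 0%N = 1. Proof. by rewrite -[LHS]/((Bs 0%N)%:~R) Bs0. Qed.

Lemma tame_invB : tame (fps_inv B).
Proof.
have tB := @tame_Bs R.
have n1 : nc om3 <= 1 by rewrite nc_om3.
have n2 : nc (om3 ^+ 2) <= 1 by rewrite ncX nc_om3 expr1n.
apply: (@tame_fps_inv B (fps_scale om3 B * fps_scale (om3 ^+ 2) B) 1 3 tB B0) => //.
- by apply: tameM; apply: tame_scale.
- exact: tame1.
have h := cube_normE B; rewrite cube_norm_fz cube_norm_Bs fzX in h.
apply/esym/fps_inv_uniq; first exact: B0.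
rewrite mulrA h mul1r -fps_substM // -exprMn fps_invP ?B0 // expr1n fps_subst1 //.
Qed.

Definition y1 : fps int := fps_tail ys.
Lemma ysE : ys = fps_X 1 * y1. Proof. exact: (fps_tailE ys0). Qed.
Lemma y10 : y1 0%N = 1. Proof. exact: ys1. Qed.
Lemma fy10 : fz C y1 0%N = 1. Proof. by rewrite -[LHS]/((y1 0%N)%:~R) y10. Qed.

Lemma tame_y1 : tame (fz C y1).
Proof. by rewrite fz_sec; apply: tame_sec => //; apply: tame_ys. Qed.

Lemma tame_invy1 : tame (fps_inv (fz C y1)).
Proof.
have n1 : nc om3 <= 1 by rewrite nc_om3.
have n2 : nc (om3 ^+ 2) <= 1 by rewrite ncX nc_om3 expr1n.
set f := fz C y1; have tf : tame f := tame_y1.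
apply: (@tame_fps_inv f (fps_scale om3 f * fps_scale (om3 ^+ 2) f) (fps_inv B ^+ 2) 1 tf fy10).
- by apply: tameM; apply: tame_scale.
- exact: (tameX 2 tame_invB).
have h : f * (fps_scale om3 f * fps_scale (om3 ^+ 2) f) = fps_subst 3 (f * B ^+ 2).
  have := cube_normE y; rewrite cube_norm_fz cube_norm_ys fzM fzX ysE fzM fz_X -/f.
  rewrite !fps_scaleM !fps_scale_X !expr1.
  have X3 : fps_subst 3 (fps_X 1) = fps_X 1 ^+ 3 :> fps C by rewrite fps_subst_X1 // fps_XX.
  have o3 : fps_const om3 * fps_const (om3 ^+ 2) = 1 by rewrite -rmorphM /= -exprS om3_cube rmorph1.
  rewrite -[fps_X 1 * f * B ^+ 2]mulrA (@fps_substM _ 3 (fps_X 1)) // X3.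
  set p := fps_scale om3 f; set q := fps_scale _ f => hh.
  do 3! apply: fps_X1_inj.
  have X4 (u : fps C) : fps_X 1 * (fps_X 1 * (fps_X 1 * u)) = fps_X 1 ^+ 3 * u by rewrite !exprS mulr1 !mulrA.
  apply: (etrans (X4 _)); apply: etrans (esym (X4 _)).
  move: hh o3; move: (fps_X 1) (fps_const om3) (fps_const (om3 ^+ 2)) (fps_subst 3 _) p q; move: (f) => f' X a b Z p q hh o3.
  transitivity (a * b * (X ^+ 3 * (f' * (p * q)))); first by rewrite o3 mul1r.
  rewrite -hh; ring.
apply/esym/fps_inv_uniq; first exact: fy10.
rewrite mulrA h -fps_substM //.
have -> : f * B ^+ 2 * (fps_inv B ^+ 2 * fps_inv f ^+ 1) = (B * fps_inv B) ^+ 2 * (f * fps_inv f) by ring.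
by rewrite !fps_invP ?B0 ?fy10 // expr1n mul1r fps_subst1.
Qed.

(** An integral form of weight [3 k]: its expansions at the two cusps, exchanged by the Fricke
    involution, both converge in the unit disc. *)
Definition modular k (g : fps int) := tame (fz C g) /\ exists2 h, tame h &
  forall t, 0 < Im t -> ev (fz C g) (ee (fricke t)) = t ^+ (3 * k) * ev h (ee t).

(** Induction on the weight. Subtracting [g(0) B^(k+1)] kills the constant coefficient; dividing by
    [y = X + ...] then stays integral and lowers [k] by one. On the Fricke side [y] becomes a
    multiple of [t^3 B], whence [1/B] in the new expansion. For [k = 0] the vanishing criterion
    leaves only constants. *)
Lemma modular_form k (g : fps int) : modular k g -> exists c : nat -> int, g = form k (fun j => fps_const (c j)) Bs ys.
Proof.
elim: k g => [|k IH] g [tg [h th E]].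
  exists (fun=> g 0%N); rewrite /form big_ord_recl big_ord0 addr0 !expr0 !mulr1.
  suff /fz_inj/eqP : fz C (g - fps_const (g 0%N)) = 0 by rewrite subr_eq0 => /eqP.
  have tc c : tame (fps_const c : fps C) by apply: tame_const.
  rewrite fzB fz_const.
  apply: (@hecke_pair _ _ (h - fps_const (g 0%N)%:~R) 1 0 1 (tameB tg (tc _)) (tameB th (tc _))) => //.
  - exact: oner_neq0.
  - by case=> // _; rewrite fpsBE /= subrr.
  move=> t t0; rewrite (evB tg (tc _) (ee_lt1 (Im_fricke_gt0 t0))) (evB th (tc _) (ee_lt1 t0)) !ev_const.
  by rewrite (E _ t0) !expr0 !mul1r.
have tB := @tame_Bs R. have ty := @tame_ys R.
pose c0 := g 0%N; pose d := g - fps_const c0 * Bs ^+ k.+1.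
have d0 : d 0%N = 0 by rewrite fpsBE fps_constM fpsX0 Bs0 expr1n mulr1 subrr.
pose g' := fps_tail d * fps_inv y1.
have dE : d = ys * g'.
  rewrite /g' ysE {1}(fps_tailE d0).
  have -> : fps_X 1 * y1 * (fps_tail d * fps_inv y1) = fps_X 1 * fps_tail d * (y1 * fps_inv y1) by ring.
  by rewrite fps_invP ?y10 // mulr1.
have tc c : tame (fps_const c : fps C) by apply: tame_const.
have tcB := tameM (tc c0%:~R) (tameX k.+1 tB).
have fd : fz C d = fz C g - fps_const c0%:~R * B ^+ k.+1 by rewrite fzB fzM fzX fz_const.
have td : tame (fz C d) by rewrite fd; apply: tameB.
have tg' : tame (fz C g').
  rewrite fzM; apply: tameM; first by rewrite fz_sec; apply: tame_sec.
  by rewrite /fz fps_map_inv ?y10 //; exact: tame_invy1.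
have fdE : fz C d = y * fz C g' := etrans (congr1 (@fz C) dE) (fzM C ys g').
have gE : g = fps_const c0 * Bs ^+ k.+1 + d by rewrite /d; ring.
clearbody g' d.
have [|c hc] := IH g'.
  split=> //; pose h1 := h - fps_const (c0%:~R * (81 * s3) ^+ k.+1) * y ^+ k.+1.
  have tcy := tameM (tc (c0%:~R * (81 * s3) ^+ k.+1)) (tameX k.+1 ty).
  have th1 : tame h1 by apply: tameB.
  have eh1 t : 0 < Im t -> ev h1 (ee t) = ev h (ee t) - c0%:~R * (81 * s3) ^+ k.+1 * ev y (ee t) ^+ k.+1.
    move=> t0; have q1 := ee_lt1 t0.
    have e1 := evM (tc (c0%:~R * (81 * s3) ^+ k.+1)) (tameX k.+1 ty) q1.
    by rewrite /h1 (evB th tcy q1) e1 (evX k.+1 ty q1) (ev_const (c0%:~R * (81 * s3) ^+ k.+1)).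
  clearbody h1.
  exists (fps_const (9 / s3) * (h1 * fps_inv B)).
    by apply: tameM => //; apply: tameM => //; exact: tame_invB.
  move=> t t0; have q1 := ee_lt1 t0. have w0 := Im_fricke_gt0 t0. have w1 := ee_lt1 w0.
  have Ed : ev (fz C d) (ee (fricke t)) = t ^+ (3 * k.+1) * ev h1 (ee t).
    have e1 := evB tg tcB w1; have e2 := evM (tc c0%:~R) (tameX k.+1 tB) w1.
    have e3 := evX k.+1 tB w1; have e4 := ev_const (c0%:~R : C) (ee (fricke t)).
    rewrite fd e1 e2 e3 e4 (E _ t0) (fricke_Bs t0) (eh1 _ t0) exprM !exprMn.
    by ring.
  have Bi : ev B (ee t) * ev (fps_inv B) (ee t) = 1.
    by rewrite -(evM tB tame_invB q1) fps_invP ?B0 // ev1.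
  have e1 := evM (tc (9 / s3)) (tameM th1 tame_invB) q1; have e2 := evM th1 tame_invB q1.
  rewrite e1 e2 (ev_const (9 / s3)).
  have Ey : ev (fz C d) (ee (fricke t)) = s3 / 9 * t ^+ 3 * ev B (ee t) * ev (fz C g') (ee (fricke t)).
    have e3 : ev (fz C d) (ee (fricke t)) = ev (y * fz C g') (ee (fricke t)) := congr1 (fun f => ev f (ee (fricke t))) fdE.
    exact: etrans e3 (etrans (evM ty tg' w1) (congr1 (fun a => a * _) (fricke_ys t0))).
  have s0 := sqrtN3_neq0 R. have tn := Im_gt0_neq0 t0.
  have t3 : t ^+ 3 != 0 by rewrite expf_neq0.
  move: Ey; rewrite Ed mulnS exprD; move: (ev (fz C g') _) (ev B _) (ev (fps_inv B) _) (ev h1 _) Bi (t ^+ 3) t3 (t ^+ (3 * k)).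
  move=> G b b' H bb T T0 U Ey; apply: (mulfI T0).
  transitivity (9 / s3 * b' * (s3 / 9 * T * b * G)).
    by transitivity (T * G * (b * b')); [rewrite bb mulr1|field].
  by rewrite -Ey; ring.
exists (fun j => if j is j'.+1 then c j' else c0).
by rewrite formS -hc -dE gE.
Qed.

End TameInverse.

(** * The polynomial of the p-isogenies *)

Section PolyCoefficients.
Variable R : realType.
Local Notation C := R[i].

Lemma coef_linM (K : comNzRingType) (a : K) (P : {poly K}) i :
  (('X - a%:P) * P)`_i = (if i is i'.+1 then P`_i' else 0) - a * P`_i.
Proof. by rewrite mulrBl coefB coefXM coefCM; case: i. Qed.

Lemma tame_prod_lin (I : Type) (s : seq I) (a : I -> fps C) : (forall x, tame (a x)) ->
  forall i, tame (\prod_(x <- s) ('X - (a x)%:P))`_i.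
Proof.
move=> ta; elim: s => [|x s IH] i.
  by rewrite big_nil coef1; case: eqP => _; [exact: tame1|exact: tame0].
rewrite big_cons coef_linM; apply: tameB; last exact: tameM.
by case: i => // ; exact: tame0.
Qed.

Lemma ev_prod_lin (I : Type) (s : seq I) (a : I -> fps C) q : nc q < 1 -> (forall x, tame (a x)) ->
  forall i, ev (\prod_(x <- s) ('X - (a x)%:P))`_i q = (\prod_(x <- s) ('X - (ev (a x) q)%:P))`_i.
Proof.
move=> q1 ta; elim: s => [|x s IH] i.
  by rewrite !big_nil !coef1; case: eqP => _; [exact: ev1|exact: ev0].
have tp := tame_prod_lin s ta.
rewrite !big_cons !coef_linM.
have t0 : tame (if i is i'.+1 then (\prod_(y <- s) ('X - (a y)%:P))`_i' else 0) by case: i => // ; exact: tame0.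
rewrite (evB t0 (tameM (ta x) (tp i)) q1) (evM (ta x) (tp i) q1) IH; congr (_ - _).
by case: i {t0} => //; exact: ev0.
Qed.

Lemma coef_prod_lin_scale (K : comNzRingType) (I : Type) (s : seq I) (a : I -> K) (c : K) i :
  (i <= size s)%N -> (\prod_(x <- s) ('X - (c * a x)%:P))`_i = c ^+ (size s - i) * (\prod_(x <- s) ('X - (a x)%:P))`_i.
Proof.
have sz (b : I -> K) r j : (size r < j)%N -> (\prod_(x <- r) ('X - (b x)%:P))`_j = 0.
  by move=> h; rewrite nth_default // size_prod_XsubC.
elim: s i => [|x s IH] i; first by rewrite !big_nil leqn0 => /eqP ->; rewrite expr0 mul1r.
move=> hi; rewrite !big_cons !coef_linM /=.
have [E|h] := eqVneq i (size s).+1.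
  rewrite E /= subnn expr0 mul1r (sz (fun x => c * a x) s _ (ltnSn _)) (sz a s _ (ltnSn _)) IH //.
  by rewrite subnn expr0 mul1r !mulr0.
have {}hi : (i <= size s)%N by rewrite -ltnS ltn_neqAle h.
rewrite IH // subSn // exprS.
case: i h hi => [|i] h hi; first by ring.
rewrite IH ?(ltnW hi) // -(subnSK hi) !exprS; ring.
Qed.

End PolyCoefficients.

(** * Characteristic polynomial of multiplication by a series *)

Section MultiplicationMatrix.
Variable n : nat.
Local Notation p := n.+1.

Section OverRing.
Variable k : comNzRingType.

Definition substp : fps k -> fps k := fps_subst p.
HB.instance Definition _ := GRing.isZmodMorphism.Build (fps k) (fps k) substp (fps_subst_is_zmod p).
Lemma substp_monoid : monoid_morphism substp.
Proof. by split=> [|f g]; [exact: fps_subst1|exact: fps_substM]. Qed.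
HB.instance Definition _ := GRing.isMonoidMorphism.Build (fps k) (fps k) substp substp_monoid.

(* Multiplication by [F] on the power series in [X], in the basis [1, X, .., X^(p-1)]
   over the power series in [X^p]; over C its eigenvalues are the [F(zeta^j X)]. *)
Definition mulmat (F : fps k) : 'M[fps k]_p := \matrix_(i, j) fps_sec p i (F * fps_X j).

Definition powers : 'rV[fps k]_p := \row_i fps_X i.

Lemma powers_mulmat F : powers *m map_mx substp (mulmat F) = F *: powers.
Proof.
apply/rowP => j; rewrite !mxE [RHS](@fps_secE _ p) //.
by apply: eq_bigr => i _; rewrite !mxE.
Qed.

Lemma powers_inj (A A' : 'M[fps k]_p) : powers *m map_mx substp A = powers *m map_mx substp A' -> A = A'.
Proof.
move=> E; apply/matrixP => i j.
have := congr1 (fun M : 'rV__ => M 0 j) E; rewrite !mxE => Ej.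
have := @fps_sec_uniq _ p (fun i => A i j) (fun i => A' i j); apply.
have Q (M : 'M[fps k]_p) : \sum_i0 powers 0 i0 * map_mx substp M i0 j = \sum_(i0 < p) fps_X i0 * fps_subst p (M i0 j).
  by apply: eq_bigr => i0 _; rewrite !mxE.
by rewrite -!Q.
Qed.

(* The factor [X + p^3 F(X^p)] is the remaining isogeny; its sign is the value of the
   character at [p = 2 mod 3]. *)
Definition isopoly (F : fps k) : {poly fps k} :=
  ('X + ((p ^ 3)%:R * fps_subst p F)%:P) * char_poly (mulmat F).

End OverRing.

Lemma map_mulmat (k k' : comNzRingType) (phi : {rmorphism k -> k'}) F :
  map_mx (fps_map phi) (mulmat F) = mulmat (fps_map phi F).
Proof. by apply/matrixP => i j; rewrite !mxE fps_map_sec rmorphM /= fps_map_X. Qed.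

Lemma map_isopoly (k k' : comNzRingType) (phi : {rmorphism k -> k'}) F :
  map_poly (fps_map phi) (isopoly F) = isopoly (fps_map phi F).
Proof.
rewrite /isopoly rmorphM rmorphD /= map_polyX map_polyC /= rmorphM rmorph_nat /= fps_map_subst.
by rewrite map_char_poly map_mulmat.
Qed.

Section OverComplex.
Variable R : realType.
Local Notation C := R[i].
Variable F : fps C.
Hypothesis tF : tame F.

Definition zet (j : nat) : C := ee (j%:R / p%:R).

Lemma zet_p j : zet j ^+ p = 1.
Proof. by rewrite -ee_mul mulrC divfK ?pnatr_eq0 // ee_nat. Qed.

Lemma nc_zet j : nc (zet j) = 1.
Proof. exact: nc_ee_frac. Qed.

Lemma zet_inj (i j : 'I_p) : (i < j)%N -> zet j != zet i.
Proof.
move=> ij; have h : zet j = zet i * ee ((j - i)%:R / p%:R).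
  by rewrite -eeD -mulrDl -natrD subnKC // ltnW.
rewrite h -{2}[zet i]mulr1; apply/eqP => /(mulfI (ee_neq0 _)) /eqP.
by apply/negP; apply: ee_frac_neq1; rewrite ?subn_gt0 // (leq_ltn_trans (leq_subr _ _)).
Qed.

Definition vander : 'M[fps C]_p := \matrix_(j, i) fps_scale (zet j) (fps_X i).

Lemma scale_substp j (f : fps C) : fps_scale (zet j) (substp f) = substp f.
Proof.
rewrite /substp fps_scale_subst // zet_p; congr fps_subst.
by apply/fpsP => m /=; rewrite expr1n mul1r.
Qed.

Lemma vander_mulmat : vander *m map_mx (@substp C) (mulmat F) =
  diag_mx (\row_j fps_scale (zet j) F) *m vander.
Proof.
apply/matrixP => j l; rewrite mul_diag_mx !mxE -fps_scaleM.
have := congr1 (fun M : 'rV__ => fps_scale (zet j) (M 0 l)) (powers_mulmat F).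
rewrite !mxE => <-; rewrite raddf_sum; apply: eq_bigr => i _ /=.
by rewrite !mxE [RHS]fps_scaleM scale_substp.
Qed.

Lemma det_vander : \det vander <> 0.
Proof.
have -> : vander = (Vandermonde p (\row_j (fps_const (zet j) * fps_X 1)))^T.
  apply/matrixP => j i; rewrite !mxE fps_scale_X exprMn fps_XX mul1n.
  by rewrite (rmorphXn (@fps_const C)).
rewrite det_tr det_Vandermonde.
have nz (f g : fps C) : f <> 0 -> g <> 0 -> f * g <> 0 by move=> hf hg /fps_mul_eq0[].
apply: (big_ind (fun f : fps C => f <> 0)) => //; first exact/eqP/oner_neq0.
move=> i _; apply: (big_ind (fun f : fps C => f <> 0)) => //; first exact/eqP/oner_neq0.
move=> j ij; rewrite !mxE => /fpsP/(_ 1%N); rewrite fpsBE !fps_constM /= !mulr1 => /eqP.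
by rewrite subr_eq0; apply/negP; apply: zet_inj.
Qed.

(** The Vandermonde matrix diagonalizes multiplication by [F]. Its determinant is nonzero but not
    invertible among power series, so the conjugation is written without inverses and the
    determinant is cancelled in a domain. *)
Lemma char_poly_mulmat : map_poly (@substp C) (char_poly (mulmat F)) =
  \prod_(j < p) ('X - (fps_scale (zet j) F)%:P).
Proof.
rewrite map_char_poly; set M := map_mx _ _; pose D : 'M[fps C]_p := diag_mx (\row_j fps_scale (zet j) F).
have E : map_mx polyC vander *m char_poly_mx M = char_poly_mx D *m map_mx polyC vander.
  rewrite /char_poly_mx mulmxBr mulmxBl scalar_mxC; congr (_ - _).
  by rewrite -!map_mxM vander_mulmat.
have := congr1 determinant E; rewrite !det_mulmx !det_map_mx mulrC => h.
have -> : \prod_(j < p) ('X - (fps_scale (zet j) F)%:P) = char_poly D.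
  rewrite char_poly_trig; first by apply: eq_bigr => j _; rewrite !mxE eqxx mulr1n.
  by apply/is_trig_mxP => i j ij; rewrite !mxE; case: eqP ij => // ->; rewrite ltnn.
apply/polyP => i; apply: (fps_mulI det_vander).
have h' : char_poly M * (\det vander)%:P = char_poly D * (\det vander)%:P := h.
have := congr1 (fun P : {poly fps C} => P`_i) h'; rewrite !coefMC => hc.
exact: etrans (mulrC _ _) (etrans hc (mulrC _ _)).
Qed.

(** The roots after the substitution of [X^p] for [X], which gives a meaning to [F(zeta^j X)];
    [None] is the isogeny [t -> p t]. *)
Definition rootA (l : option 'I_p) : fps C :=
  if l is Some j then fps_scale (zet j) F else - ((p ^ 3)%:R * fps_subst p (fps_subst p F)).

Lemma tame_rootA l : tame (rootA l).
Proof.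
case: l => [j|]; first by apply: tame_scale; rewrite ?nc_zet.
rewrite /rootA -fps_nat; apply: tameN; apply: tameM; first exact: tame_const.
by do 2! apply: tame_subst => //.
Qed.

Lemma big_option (K : comNzRingType) (f : option 'I_p -> K) :
  \prod_(l : option 'I_p) f l = f None * \prod_(j < p) f (Some j).
Proof.
rewrite (bigD1 None) //=; congr (_ * _).
rewrite (reindex_omap Some id) /=; last by case.
by apply: eq_bigl => j; rewrite eqxx.
Qed.

Lemma isopoly_prod : map_poly (@substp C) (isopoly F) = \prod_(l : option 'I_p) ('X - (rootA l)%:P).
Proof.
rewrite big_option -char_poly_mulmat /isopoly rmorphM rmorphD /= map_polyX map_polyC /= polyCN opprK.
by rewrite rmorphM rmorph_nat.
Qed.

Lemma isopoly_tame i : tame (isopoly F)`_i.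
Proof.
have -> : (isopoly F)`_i = fps_sec p 0 (map_poly (@substp C) (isopoly F))`_i.
  apply/fpsP => m; rewrite coef_map; change ((isopoly F)`_i m = fps_subst p (isopoly F)`_i (p * m + 0)%N).
  by rewrite addn0 /= dvdn_mulr // mulKn.
rewrite isopoly_prod; apply: tame_sec => //.
exact: tame_prod_lin tame_rootA _.
Qed.

Definition rt (l : option 'I_p) (t : C) : C :=
  if l is Some j then ev F (ee ((t + j%:R) / p%:R)) else - ((p ^ 3)%:R * ev F (ee (p%:R * t))).

Lemma isopoly_ev t i : 0 < Im t -> ev (isopoly F)`_i (ee t) = (\prod_(l : option 'I_p) ('X - (rt l t)%:P))`_i.
Proof.
move=> t0; pose x := ee (t / p%:R); have t1 : 0 < Im (t / p%:R) by rewrite Im_divn divr_gt0.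
have x1 := ee_lt1 t1; rewrite -/x in x1.
have xp : ee t = x ^+ p by rewrite -ee_mul mulrC divfK ?pnatr_eq0.
rewrite xp -(ev_subst (isT : (0 < p)%N) (isopoly_tame i) x1).
have -> : fps_subst p (isopoly F)`_i = (map_poly (@substp C) (isopoly F))`_i by rewrite coef_map.
have E l : ev (rootA l) x = rt l t.
  case: l => [j|]; first by rewrite /rootA ev_scale /rt mulrDl eeD mulrC.
  have ts := tame_subst (isT : (0 < p)%N) tF.
  have ts2 := tame_subst (isT : (0 < p)%N) ts.
  have tc : tame (fps_const (p ^ 3)%:R : fps C) by exact: tame_const.
  rewrite /rootA -fps_nat (evN (tameM tc ts2) x1) (evM tc ts2 x1) ev_const.
  have xp1 : nc (x ^+ p) < 1 by rewrite ncX pow_lt1 ?nc_ge0.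
  have e1 := ev_subst (isT : (0 < p)%N) ts x1; have e2 := ev_subst (isT : (0 < p)%N) tF xp1.
  have e3 : ee (p%:R * t) = (x ^+ p) ^+ p by rewrite ee_mul xp.
  by rewrite /rt e3; exact: (congr1 (fun z => - ((p ^ 3)%:R * z)) (etrans e1 e2)).
rewrite isopoly_prod (ev_prod_lin _ x1 tame_rootA).
rewrite (eq_bigr (fun l => 'X - (rt l t)%:P)) // => l _.
by rewrite E.
Qed.

End OverComplex.

End MultiplicationMatrix.

(** * The p+1 isogenies as sublattices, and the Fricke involution on them *)

Section IsogenyRoots.
Variable n : nat.
Local Notation p := n.+1.
Hypothesis p_prime : prime p.
Hypothesis p_mod3 : (p %% 3 = 2)%N.
Variable R : realType.
Local Notation C := R[i].
Local Notation B := (fz C Bs).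
Local Notation y := (fz C ys).
Local Notation s3 := (sqrtN3 R).
Implicit Types (t : C) (l : option 'I_p).

Lemma chi_p : chi p = -1.
Proof. by rewrite /chi modz_nat p_mod3. Qed.

Lemma p_neq0 : (p%:R : C) != 0. Proof. by rewrite pnatr_eq0. Qed.

(* [l] stands for a line of [F_p^2], with [None] the line at infinity. *)
Definition inl_ l (M N : int) : bool :=
  if l is Some j then (p %| N - j%:Z * M)%Z else (p %| M)%Z.

(** The coefficients of the lattice sums of [y] and, in [phiB], of [B], restricted to the sublattice
    of index [p] attached to [l]. *)
Definition phiy l (M N : int) : C := if inl_ l M N then (chi M)%:~R else 0.
Definition phiB l (M N : int) : C := if inl_ l M N && (3 %| M)%Z then (chi N)%:~R else 0.

Lemma nc_phiy l M N : nc (phiy l M N) <= 1.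
Proof. by rewrite /phiy; case: ifP => _; rewrite ?nc_chi // nc0 ler01. Qed.
Lemma nc_phiB l M N : nc (phiB l M N) <= 1.
Proof. by rewrite /phiB; case: ifP => _; rewrite ?nc_chi // nc0 ler01. Qed.

Lemma latN f t : 0 < Im t -> (forall m n, nc (f m n) <= 1) -> lat (fun m n => - f m n) t = - lat f t.
Proof.
move=> t0 f1; apply: csumP; rewrite -mulN1r.
by apply: eq_has_sum (has_sumZ (-1) (lat_has t0 f1)) => z /=; rewrite mulN1r mulNr.
Qed.

Lemma Im_shift t (j : nat) : 0 < Im t -> 0 < Im ((t + j%:R) / p%:R).
Proof. by move=> t0; rewrite Im_divn divr_gt0 // -[j%:R]/(j%:Z%:~R) Im_Dint. Qed.

Lemma Im_pmul t : 0 < Im t -> 0 < Im (p%:R * t).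
Proof. by move=> t0; rewrite Im_natM mulr_gt0. Qed.

Lemma lat_line (j : 'I_p) (f g : int -> int -> C) t : 0 < Im t ->
  (forall m n, nc (f m n) <= 1) -> (forall m n, nc (g m n) <= 1) ->
  (forall m n, g m (m * j + p%:Z * n) = f m n) ->
  (forall m n, g m n != 0 -> (p %| n - j%:Z * m)%Z) ->
  lat f ((t + j%:R) / p%:R) = p%:R ^+ 3 * lat g t.
Proof.
move=> t0 f1 g1 fg gs; pose h (z : int * int) : int * int := (z.1, z.1 * j + p%:Z * z.2).
apply: (@lat_push _ f g t _ h p%:R) => //; first exact: Im_shift.
- exact: p_neq0.
- move=> [a b] [c d] [-> /addrI]; rewrite -/p%:Z => /(mulfI (_ : p%:Z != 0)) -> //.
- by move=> [a b]; apply: fg.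
- move=> m k /gs /divzK E; exists (m, ((k - j%:Z * m) %/ p)%Z); rewrite /h /=; congr pair.
  by rewrite [p%:Z * _]mulrC E; ring.
- move=> [a b]; rewrite /h /= rmorphD !rmorphM /= -!pmulrn; move: p_neq0.
  move: (p%:R : C) (j%:R : C) (a%:~R : C) (b%:~R : C) => P J A' B' P0; field.
  exact: P0.
Qed.

Lemma lat_vert (f g : int -> int -> C) t : 0 < Im t ->
  (forall m n, nc (f m n) <= 1) -> (forall m n, nc (g m n) <= 1) ->
  (forall m n, g (p%:Z * m) n = f m n) ->
  (forall m n, g m n != 0 -> (p %| m)%Z) ->
  lat f (p%:R * t) = lat g t.
Proof.
move=> t0 f1 g1 fg gs; pose h (z : int * int) : int * int := (p%:Z * z.1, z.2).
suff : lat f (p%:R * t) = 1 ^+ 3 * lat g t by rewrite expr1n mul1r.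
apply: (@lat_push _ f g t _ h 1) => //; first exact: Im_pmul.
- exact: oner_neq0.
- move=> [a b] [c d] [/(mulfI (_ : p%:Z != 0)) -> //  ->] //.
- by move=> [a b]; apply: fg.
- by move=> m k /gs /divzK E; exists ((m %/ p)%Z, k); rewrite /h /= mulrC E.
- by move=> [a b]; rewrite /h /= rmorphM /= -!pmulrn; ring.
Qed.

Lemma dvdz_pmul (m : int) : (p %| p%:Z * m)%Z. Proof. exact: dvdz_mulr. Qed.

Lemma inl_line (j : 'I_p) (m k : int) : inl_ (Some j) m (m * j + p%:Z * k).
Proof. by rewrite /inl_ [m * j]mulrC addrAC subrr add0r dvdz_mulr. Qed.

Lemma lat_phiy l t : 0 < Im t -> lat (phiy l) t = 2 * kap R / p%:R ^+ 3 * rt y l t.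
Proof.
move=> t0; have p0 := p_neq0; have p3 : (p%:R ^+ 3 : C) != 0 by rewrite expf_neq0.
apply: (mulfI p3); case: l => [j|].
  rewrite -(@lat_line j (fun m _ => (chi m)%:~R) (phiy (Some j)) t t0).
  - by rewrite (lat_ys (Im_shift j t0)) /rt; move: (ev _ _) (p%:R ^+ 3) p3 (kap R) => e P P0 k; field.
  - by move=> m k; apply: nc_chi.
  - exact: nc_phiy.
  - by move=> m k; rewrite /phiy inl_line.
  - by move=> m k; rewrite /phiy; case: ifP => //; rewrite eqxx.
rewrite -(@lat_vert (fun m _ => - (chi m)%:~R) (phiy None) t t0).
- rewrite latN ?Im_pmul //; last by move=> m k; apply: nc_chi.
  by rewrite (lat_ys (Im_pmul t0)) /rt natrX; move: (ev _ _) (p%:R ^+ 3) p3 (kap R) => e P P0 k; field.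
- by move=> m k; rewrite ncN nc_chi.
- exact: nc_phiy.
- by move=> m k; rewrite /phiy /inl_ dvdz_pmul chiM chi_p mulN1r rmorphN.
- by move=> m k; rewrite /phiy /inl_; case: ifP => //; rewrite eqxx.
Qed.

(** For [y] the sign [chi p = -1] falls on the line at infinity, as in [rt]. For [B] it falls on the
    other lines instead, so that the common constant is the opposite of the one in [lat_Bs]. *)
Lemma lat_phiB l t : 0 < Im t -> lat (phiB l) t = 2 * kap R * s3 / 243 / p%:R ^+ 3 * rt B l t.
Proof.
move=> t0; have p0 := p_neq0; have p3 : (p%:R ^+ 3 : C) != 0 by rewrite expf_neq0.
have f1 (m k : int) : nc (if (3 %| m)%Z then (chi k)%:~R else 0 : C) <= 1.
  by case: ifP => _; rewrite ?nc_chi // nc0 ler01.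
apply: (mulfI p3); case: l => [j|].
  rewrite -(@lat_line j (fun m k => - if (3 %| m)%Z then (chi k)%:~R else 0) (phiB (Some j)) t t0).
  - by rewrite latN ?Im_shift // (lat_Bs (Im_shift j t0)) /rt; move: (ev _ _) (p%:R ^+ 3) p3 (kap R) s3 => e P P0 k s; field.
  - by move=> m k; rewrite ncN.
  - exact: nc_phiB.
  - move=> m k; rewrite /phiB inl_line /=; case: ifP => [/dvdzP[a ->]|_]; last by rewrite oppr0.
    rewrite -rmorphN; congr (_%:~R).
    have -> : a * 3 * j + p%:Z * k = p%:Z * k + 3 * (a * j) by ring.
    by rewrite chi_Dmul chiM chi_p mulN1r.
  - by move=> m k; rewrite /phiB; case: ifP => [/andP[]//|]; rewrite eqxx.
rewrite -(@lat_vert (fun m k => if (3 %| m)%Z then (chi k)%:~R else 0) (phiB None) t t0) //.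
- by rewrite (lat_Bs (Im_pmul t0)) /rt natrX; move: (ev _ _) (p%:R ^+ 3) p3 (kap R) s3 => e P P0 k s; field.
- exact: nc_phiB.
- move=> m k; rewrite /phiB /inl_ dvdz_pmul /= Gauss_dvdzr // coprimezE /= prime_coprime //.
  by lia.
- by move=> m k; rewrite /phiB /inl_; case: ifP => [/andP[]//|]; rewrite eqxx.
Qed.

(** The relation [3 j k = -1] modulo [p], coming from [fricke t = -1/(3 t)]. *)
Definition partner (j k : 'I_p) := (p %| 3 * j * k + 1)%N.
(* The action of the Fricke involution on the lines. *)
Definition sig l : option 'I_p :=
  match l with
  | None => Some ord0
  | Some j => if j == ord0 then None else [pick k | partner j k]
  end.

Lemma coprime_p3 : coprime p 3.
Proof. by rewrite coprime_sym prime_coprime //; lia. Qed.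

Lemma sig_partner j : j != ord0 -> exists2 k, sig (Some j) = Some k & partner j k.
Proof.
move=> j0; rewrite /sig (negPf j0); case: pickP => [k hk|none]; first by exists k.
have cop : coprime p (3 * j).
  rewrite coprimeMr coprime_p3 /= prime_coprime // gtnNdvd // ?ltn_ord // lt0n.
  by apply: contra j0 => /eqP E; apply/eqP/val_inj.
have c0 : (0 < 3 * j)%N by rewrite muln_gt0 /= lt0n; apply: contra j0 => /eqP E; apply/eqP/val_inj.
(* Here [u] inverts [3 j] modulo [p], and the factor [p.-1] of the witness stands for -1. *)
have [u v E _] := egcdnP p c0.
have g1 : gcdn (3 * j) p = 1%N by rewrite gcdnC; apply/eqP.
have hk : ((u * p.-1) %% p < p)%N by rewrite ltn_mod.
have := none (Ordinal hk); rewrite /partner /= => /negP; case.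
rewrite /dvdn -modnDml modnMmr modnDml mulnA [(3 * j * u)%N]mulnC E g1 -/(dvdn _ _).
have -> : ((v * p + 1) * n + 1 = (v * n + 1) * p)%N by ring.
exact: dvdn_mull.
Qed.

Lemma partner_sym j k : partner j k = partner k j.
Proof. by rewrite /partner mulnAC. Qed.

Lemma partner_uniq j k k' : partner j k -> partner j k' -> k = k'.
Proof.
wlog kk : k k' / (k <= k')%N.
  by move=> H hk hk'; case/orP: (leq_total k k') => h; [apply: H|apply/esym/H].
move=> h h'; apply/val_inj/eqP; rewrite eqn_leq kk /= leqNgt; apply/negP => lt.
have d : (p %| 3 * j * (k' - k))%N.
  have -> : (3 * j * (k' - k) = (3 * j * k' + 1) - (3 * j * k + 1))%N by rewrite mulnBr; lia.
  exact: dvdn_sub.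
have jp : (p %| 3 * j)%N.
  move: d; rewrite Euclid_dvdM // => /orP[//|]; rewrite gtnNdvd ?subn_gt0 //.
  exact: leq_ltn_trans (leq_subr _ _) (ltn_ord k').
by move: h; rewrite /partner (dvdn_addr _ (dvdn_mulr _ jp)) dvdn1 => /eqP E; move: p_prime; rewrite E.
Qed.

Lemma sigK : involutive sig.
Proof.
case=> [j|] //; have [->//|j0] := eqVneq j ord0.
have [k -> jk] := sig_partner j0.
have k0 : k != ord0.
  apply: contraTneq jk => ->; rewrite /partner muln0 add0n dvdn1.
  by apply: contraTneq p_prime => ->.
have [j' -> kj] := sig_partner k0.
by congr Some; apply/esym; apply: (@partner_uniq k) => //; rewrite partner_sym.
Qed.

Lemma p3z (a : int) : (p %| 3 * a)%Z = (p %| a)%Z.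
Proof. by rewrite Gauss_dvdzr // /coprimez /gcdz /=; exact: coprime_p3. Qed.

Lemma inl_sig l (M N : int) : inl_ l (- N) M = inl_ (sig l) (3 * M) N.
Proof.
case: l => [j|]; last by rewrite /= mul0r subr0 rpredN.
have [->|j0] := eqVneq j ord0; first by rewrite /= mul0r subr0 p3z.
have [k -> jk] := sig_partner j0; rewrite /inl_.
have cj : coprimez p j.
  rewrite coprimezE /= prime_coprime // gtnNdvd // ?ltn_ord // lt0n.
  by apply: contra j0 => /eqP E; apply/eqP/val_inj.
rewrite -(Gauss_dvdzr (N - k%:Z * (3 * M)) cj).
have -> : j%:Z * (N - k%:Z * (3 * M)) = (M - j%:Z * - N) - (3 * j * k + 1)%N%:Z * M.
  by rewrite PoszD !PoszM; ring.
have d : (p %| (3 * j * k + 1)%N%:Z * M)%Z by apply: dvdz_mulr.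
apply/idP/idP => h; first exact: rpredB.
by rewrite -[X in (p %| X)%Z](subrK ((3 * j * k + 1)%N%:Z * M)); apply: rpredD.
Qed.

Lemma rt_y_fricke l t : 0 < Im t -> rt y l (fricke t) = - (s3 / 9) * t ^+ 3 * rt B (sig l) t.
Proof.
move=> t0; have h := lat_phiy l (Im_fricke_gt0 t0).
have E : lat (fun m n => if (3 %| m)%Z then phiy l (- n) (m %/ 3)%Z else 0) t = - lat (phiB (sig l)) t.
  rewrite -(latN t0 (nc_phiB _)); congr (lat _ t); apply: funext => m; apply: funext => k.
  rewrite /phiB /phiy andbC; case: ifP => [/divzK M|_]; last by rewrite oppr0.
  have -> : inl_ (sig l) m k = inl_ l (- k) (m %/ 3)%Z by rewrite inl_sig mulrC M.
  by case: ifP => _; rewrite ?oppr0 // chiN rmorphN.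
have h1 := lat_fricke t0 (nc_phiy l).
have h2 := lat_phiB (sig l) t0.
have p3 : (p%:R ^+ 3 : C) != 0 by rewrite expf_neq0 // p_neq0.
have k0 := kap_neq0 R.
have e : (3 * t) ^+ 3 * - (2 * kap R * s3 / 243 / p%:R ^+ 3 * rt B (sig l) t) = 2 * kap R / p%:R ^+ 3 * rt y l (fricke t).
  by rewrite -h -h2 h1 E.
move: e; move: (rt y _ _) (rt B _ _) (p%:R ^+ 3) p3 (kap R) k0 => a b P P0 k k0 e.
have k2 : 2 * k / P != 0 by rewrite !mulf_neq0 ?invr_eq0 // pnatr_eq0.
apply: (mulfI k2); rewrite -e; field.
exact: P0.
Qed.

Lemma rt_B_fricke l t : 0 < Im t -> rt B l (fricke t) = - (81 * s3) * t ^+ 3 * rt y (sig l) t.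
Proof.
move=> t0; have h := rt_y_fricke (sig l) (Im_fricke_gt0 t0).
have tn := Im_gt0_neq0 t0. have s0 := sqrtN3_neq0 R.
rewrite frickeK sigK in h; rewrite h; move: (rt B l (fricke t)) => b; rewrite /fricke.
move: (sqrtN3_sq R) s0; move: s3 => s hs s0.
have -> : - (81 * s) * t ^+ 3 * (- (s / 9) * (- (3 * t)^-1) ^+ 3 * b) = - (s ^+ 2 / 3) * b.
  by field.
by rewrite hs; field.
Qed.

Lemma coef_prod_sig (K : comNzRingType) (a b : option 'I_p -> K) (c : K) i : (i <= p.+1)%N ->
  (forall l, a l = c * b (sig l)) ->
  (\prod_(l : option 'I_p) ('X - (a l)%:P))`_i = c ^+ (p.+1 - i) * (\prod_(l : option 'I_p) ('X - (b l)%:P))`_i.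
Proof.
move=> hi E; have sz : size (index_enum (option 'I_p)) = p.+1 by rewrite [index_enum _]unlock -enumT -cardT card_option card_ord.
rewrite -[in RHS]sz -coef_prod_lin_scale ?sz //; apply: (congr1 (fun P : {poly K} => P`_i)).
rewrite [RHS](reindex_inj (can_inj sigK)); apply: eq_bigr => l _.
by rewrite E.
Qed.

Lemma fz_isopoly F i : fz C (isopoly n F)`_i = (isopoly n (fz C F))`_i.
Proof. by rewrite -[RHS](congr1 (fun P : {poly _} => P`_i) (map_isopoly n _ F)) coef_map. Qed.

(** The coefficient of [Z^i] is a symmetric function of degree [p + 1 - i] in the roots. The Fricke
    involution permutes the lines and contributes [c t^3] for each root. *)
Lemma isopoly_fricke (F G : fps int) (c : C) : tame (fz C F) -> tame (fz C G) ->
  (forall l t, 0 < Im t -> rt (fz C F) l (fricke t) = c * t ^+ 3 * rt (fz C G) (sig l) t) ->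
  forall i, (i <= p.+1)%N -> modular R (p.+1 - i) (isopoly n F)`_i.
Proof.
move=> tF tG E i hi; split; first by rewrite fz_isopoly; apply: isopoly_tame.
exists (fps_const (c ^+ (p.+1 - i)) * fz C (isopoly n G)`_i).
  by rewrite fz_isopoly; apply: tameM; [exact: tame_const|exact: isopoly_tame].
move=> t t0; have tGi : tame (isopoly n (fz C G))`_i by apply: isopoly_tame.
rewrite !fz_isopoly (evM (tame_const _) tGi (ee_lt1 t0)) (ev_const (c ^+ (p.+1 - i))).
have e1 := isopoly_ev n tF i (Im_fricke_gt0 t0); have e2 := isopoly_ev n tG i t0.
have e3 := @coef_prod_sig C (fun l => rt (fz C F) l (fricke t)) (fun l => rt (fz C G) l t) (c * t ^+ 3) i hi (fun l => E l t t0).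
have e := etrans e1 (etrans e3 (congr1 ( *%R _) (esym e2))).
rewrite {}e; move: (ev _ _) => z; rewrite exprMn -exprM; ring.
Qed.

Lemma isopoly_Bs_modular i : (i <= p.+1)%N -> modular R (p.+1 - i) (isopoly n Bs)`_i.
Proof. by apply: (@isopoly_fricke _ ys (- (81 * s3))); [exact: tame_Bs|exact: tame_ys|exact: rt_B_fricke]. Qed.

Lemma isopoly_ys_modular i : (i <= p.+1)%N -> modular R (p.+1 - i) (isopoly n ys)`_i.
Proof. by apply: (@isopoly_fricke _ Bs (- (s3 / 9))); [exact: tame_ys|exact: tame_Bs|exact: rt_y_fricke]. Qed.

End IsogenyRoots.

(** * Reduction modulo p *)

Section FormLemmas.
Variable k : comNzRingType.
Implicit Types (c d : nat -> k) (u w : k).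

Lemma formB n c u w : form n.+1 c u w = u * form n c u w + c n.+1 * w ^+ n.+1.
Proof.
rewrite /form big_ord_recr /= subnn expr0 mul1r mulr_sumr; congr (_ + _).
apply: eq_bigr => j _; have jn : (j <= n)%N by rewrite -ltnS.
by rewrite (subSn jn) exprS; move: (c j) (u ^+ _) (w ^+ j) => a b d; ring.
Qed.

Lemma eq_form n c d u w : (forall j, (j <= n)%N -> c j = d j) -> form n c u w = form n d u w.
Proof. by move=> h; apply: eq_bigr => j _; rewrite h // -ltnS. Qed.

Lemma form_sub n c d u w : form n c u w - form n d u w = form n (fun j => c j - d j) u w.
Proof. by rewrite /form -sumrB; apply: eq_bigr => j _; rewrite mulrBl. Qed.

Lemma form_scale n c u w x : form n c (x * u) (x * w) = x ^+ n * form n c u w.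
Proof.
rewrite /form mulr_sumr; apply: eq_bigr => j _.
have jn : (j <= n)%N by rewrite -ltnS.
have xn : x ^+ n = x ^+ (n - j) * x ^+ j by rewrite -exprD subnK.
by rewrite xn !exprMn; move: (c j) (u ^+ _) (w ^+ j) (x ^+ (n - j)) (x ^+ j) => a b d e f; ring.
Qed.

Lemma form_w0 n c u : form n c u 0 = c 0%N * u ^+ n.
Proof. by case: n => [|n]; rewrite ?formS ?mul0r ?addr0 // /form big_ord_recl big_ord0 addr0 !expr0 !mulr1. Qed.

Lemma form_u0 n c w : form n c 0 w = c n * w ^+ n.
Proof. by case: n => [|n]; rewrite ?formB ?mul0r ?add0r // /form big_ord_recl big_ord0 addr0 !expr0 mul1r. Qed.
End FormLemmas.

Lemma form_map (k k' : comNzRingType) (phi : {rmorphism k -> k'}) n c u w :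
  phi (form n c u w) = form n (phi \o c) (phi u) (phi w).
Proof. by rewrite /form rmorph_sum; apply: eq_bigr => j _; rewrite !rmorphM !rmorphXn. Qed.

Section FormIndependence.
Variable F : idomainType.

(** Orders of vanishing separate the monomials: [u] has order 0 and [w] positive order, so the
    coefficients are removed one at a time, cancelling [w] in between. *)
Lemma form_eq0 n (a : nat -> F) (u w : fps F) : u 0%N = 1 -> w 0%N = 0 -> w <> 0 ->
  form n (fun j => fps_const (a j)) u w = 0 -> forall j, (j <= n)%N -> a j = 0.
Proof.
move=> u0 w0 wn; elim: n a => [|n IH] a h.
  move=> j; rewrite leqn0 => /eqP ->; move/fpsP/(_ 0%N): h.
  by rewrite /form big_ord_recl big_ord0 addr0 !expr0 !mulr1.
have a0 : a 0%N = 0.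
  move/fpsP/(_ 0%N): (h); rewrite formS fpsDE fps_constM fpsX0 u0 expr1n mulr1 fpsM0 w0 mul0r addr0.
  by move=> ->.
move: h; rewrite formS a0 rmorph0 mul0r add0r => /fps_mul_eq0[//|h] [//|j]; rewrite ltnS.
exact: (IH (a \o S)).
Qed.
End FormIndependence.

Section ModP.
Variable n : nat.
Local Notation p := n.+1.
Variable F : finFieldType.
Hypothesis p_prime : prime p.
Hypothesis F_card : #|F| = p.

Lemma pcharF : p \in [pchar F].
Proof. by apply: (@card_finPcharP F p 1); rewrite ?expn1. Qed.

Lemma pchar_fps : p \in [pchar (fps F)].
Proof.
rewrite inE p_prime /=; apply/eqP; rewrite -fps_nat.
by have /andP[_ /eqP ->] := pcharF; rewrite rmorph0.
Qed.

Lemma mulmat_exp (G : fps F) j : powers n F *m map_mx (@substp n F) (mulmat n G ^+ j) = G ^+ j *: powers n F.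
Proof.
elim: j => [|j IH]; first by rewrite !expr0 scale1r map_mx1 mulmx1.
rewrite exprSr map_mxM mulmxA IH -scalemxAl powers_mulmat scalerA; congr (_ *: _).
by rewrite exprSr.
Qed.

(** By Frobenius [G^p = G(X^p)], and a series in [X^p] acts as a scalar in this basis. *)
Lemma mulmat_expp (G : fps F) : mulmat n G ^+ p = G%:M.
Proof.
apply: powers_inj; rewrite mulmat_exp map_scalar_mx mul_mx_scalar /substp.
by rewrite (fps_Frobenius _ p_prime F_card).
Qed.

Lemma poly_fps_exp_eq0 (c : {poly fps F}) j : c ^+ j = 0 -> c = 0.
Proof.
have nz i : c != 0 -> lead_coef c ^+ i != 0.
  move=> c0; have l0 : lead_coef c <> 0 by apply/eqP; rewrite lead_coef_eq0.
  elim: i => [|i IH]; first by rewrite expr0 oner_neq0.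
  by rewrite exprS; apply/eqP => /fps_mul_eq0[//|/eqP]; apply/negP.
move=> h; apply/eqP; apply/negPn/negP => c0.
have lc i : lead_coef (c ^+ i) = lead_coef c ^+ i.
  elim: i => [|i IH]; first by rewrite !expr0 lead_coef1.
  by rewrite !exprS lead_coef_proper_mul IH // -exprS nz.
by have := nz j c0; rewrite -lc h lead_coef0 eqxx.
Qed.

Lemma det_exp (K : comNzRingType) (A : 'M[K]_p) j : \det (A ^+ j) = \det A ^+ j.
Proof. by elim: j => [|j IH]; rewrite ?expr0 ?det1 // !exprS det_mulmx IH. Qed.

Lemma map_polyC_exp (K : comNzRingType) (A : 'M[K]_p) j : map_mx polyC (A ^+ j) = map_mx polyC A ^+ j.
Proof. by elim: j => [|j IH]; rewrite ?expr0 ?map_mx1 // !exprS map_mxM IH. Qed.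

(* Raising to the [p]-th power is additive on commuting matrices in characteristic
   [p], and [fps F] is a domain. *)
Lemma char_poly_modp (G : fps F) : char_poly (mulmat n G) = 'X^p - G%:P.
Proof.
have pP : p \in [pchar {poly fps F}] by rewrite pchar_poly pchar_fps.
have pM : p \in [pchar 'M[{poly fps F}]_p].
  rewrite inE p_prime /=; apply/eqP; rewrite -[1]/(1%:M) -scalemx1 -scaler_nat.
  by have /andP[_ /eqP ->] := pP; rewrite scale0r.
suff h : (char_poly (mulmat n G) - ('X^p - G%:P)) ^+ p = 0.
  by have /eqP := poly_fps_exp_eq0 h; rewrite subr_eq0 => /eqP.
rewrite -(pFrobenius_autE pP) (pFrobenius_autB_comm pP (mulrC _ _)) !pFrobenius_autE.
rewrite /char_poly -det_exp /char_poly_mx -(pFrobenius_autE pM) (pFrobenius_autB_comm pM); last first.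
  exact: (esym (scalar_mxC _ _)).
rewrite !pFrobenius_autE.
have -> : ('X%:M : 'M[{poly fps F}]_p) ^+ p = ('X^p)%:M.
  by rewrite -[LHS](rmorphXn (@scalar_mx {poly fps F} p)).
have -> : (map_mx polyC (mulmat n G)) ^+ p = (G%:P)%:M.
  by rewrite -map_polyC_exp mulmat_expp map_scalar_mx.
by rewrite -raddfB det_scalar subrr.
Qed.

Lemma isopoly_modp (G : fps F) i : (isopoly n G)`_i =
  (i == p.+1)%:R - (if i == 1%N then G else 0).
Proof.
have p0 : (p%:R : fps F) = 0 by have /andP[_ /eqP] := pchar_fps.
rewrite /isopoly natrX p0 expr0n mul0r polyC0 addr0 char_poly_modp coefXM.
case: i => [|i] /=; first by rewrite subr0.
by rewrite coefB coefXn coefC eqSS -[X in _ - X = _]/(if i == 0%N then G else 0); case: i.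
Qed.

Lemma fzys_neq0 : fz F ys <> 0.
Proof. by move/fpsP/(_ 1%N); rewrite -[LHS]/((ys 1%N)%:~R) ys1 /= => /eqP; rewrite oner_eq0. Qed.
Lemma fzBs_neq0 : fz F Bs <> 0.
Proof. by move/fpsP/(_ 0%N); rewrite -[LHS]/((Bs 0%N)%:~R) Bs0 /= => /eqP; rewrite oner_eq0. Qed.
Lemma fzBs0 : fz F Bs 0%N = 1. Proof. by rewrite -[LHS]/((Bs 0%N)%:~R) Bs0. Qed.
Lemma fzys0 : fz F ys 0%N = 0. Proof. by rewrite -[LHS]/((ys 0%N)%:~R) ys0. Qed.

Definition form_coefs (G : fps int) (c : nat -> nat -> int) :=
  forall i, (i <= p.+1)%N -> (isopoly n G)`_i = form (p.+1 - i) (fun j => fps_const (c i j)) Bs ys.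

Lemma form_coefs_modp G c : form_coefs G c -> forall i, (i <= p.+1)%N ->
  form (p.+1 - i) (fun j => fps_const (c i j)%:~R) (fz F Bs) (fz F ys) = (i == p.+1)%:R - (if i == 1%N then fz F G else 0).
Proof.
move=> h i hi; rewrite -isopoly_modp -(map_isopoly n (intmul 1 : {rmorphism int -> F})) coef_map.
change (form (p.+1 - i) (fun j => fps_const (c i j)%:~R) (fz F Bs) (fz F ys) = fz F (isopoly n G)`_i).
rewrite h // (form_map (fz F)); apply: eq_form => j _ /=.
by rewrite fz_const.
Qed.

Lemma form_inj k (a b : nat -> F) :
  form k (fun j => fps_const (a j)) (fz F Bs) (fz F ys) = form k (fun j => fps_const (b j)) (fz F Bs) (fz F ys) ->
  forall j, (j <= k)%N -> a j = b j.
Proof.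
move=> /eqP; rewrite -subr_eq0 form_sub => /eqP h j jk; apply/eqP; rewrite -subr_eq0; apply/eqP.
apply: (@form_eq0 F k (fun j => a j - b j) _ _ fzBs0 fzys0 fzys_neq0) => //.
by rewrite -[RHS]h; apply: eq_form => i _; rewrite rmorphB.
Qed.

(** Modulo [p] the coefficient of [Z] is [-G]; its opposite is thus a form of degree [p] in [B] and
    [y] whose value is [G] itself. *)
Definition alpha (c : nat -> nat -> int) (j : nat) : F := - (c 1%N j)%:~R.

(** The product [B y] is both [B] times the form giving [y] and [y] times the form giving [B].
    Independence of the monomials of degree [p + 1] shows that the latter has no [y^p] term;
    dividing it by [B] leaves a form of degree [p - 1] with value 1, an analogue of the Hasse
    invariant. *)
Lemma alpha_spec cB cy : form_coefs Bs cB -> form_coefs ys cy ->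
  [/\ alpha cB p = 0, alpha cy 0 = 0, forall j, (j < p)%N -> alpha cy j.+1 = alpha cB j,
    form n (fun j => fps_const (alpha cB j)) (fz F Bs) (fz F ys) = 1 & alpha cB 0 = 1].
Proof.
move=> hB hy.
have aE c G : form_coefs G c -> form p (fun j => fps_const (alpha c j)) (fz F Bs) (fz F ys) = fz F G.
  move=> h; have := form_coefs_modp h (isT : (1 <= p.+1)%N); rewrite subn1 /= sub0r => e.
  rewrite -[RHS]opprK -e -sub0r -[X in X - _](_ : form p (fun=> 0) (fz F Bs) (fz F ys) = 0); last first.
    by rewrite /form big1 // => j _; rewrite mul0r.
  by rewrite form_sub; apply: eq_form => j _; rewrite /alpha rmorphN sub0r.
have eB := aE _ _ hB; have ey := aE _ _ hy.
pose b j := if (j <= p)%N then alpha cy j else 0.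
pose g j := if j is j'.+1 then alpha cB j' else 0.
have e : form p.+1 (fun j => fps_const (b j)) (fz F Bs) (fz F ys) = form p.+1 (fun j => fps_const (g j)) (fz F Bs) (fz F ys).
  rewrite formB [fps_const (b p.+1)](_ : _ = 0); last by rewrite /b ltnn.
  rewrite mul0r addr0 [RHS]formS [fps_const (g 0%N)](_ : _ = 0) // mul0r add0r.
  rewrite -[RHS]/(fz F ys * form p (fun j => fps_const (alpha cB j)) (fz F Bs) (fz F ys)) eB mulrC; congr (_ * _).
  by rewrite -[RHS]ey; apply: eq_form => j jp; rewrite /b jp.
have h := form_inj e.
have ap : alpha cB p = 0 by have := h p.+1 (leqnn _); rewrite /b ltnn => ->.
have f1 : form n (fun j => fps_const (alpha cB j)) (fz F Bs) (fz F ys) = 1.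
  apply: (fps_mulI fzBs_neq0); rewrite mulr1 -[RHS]eB formB [fps_const (alpha cB p)](_ : _ = 0); last by rewrite ap.
  by rewrite mul0r addr0.
split=> //.
- by have := h 0%N isT.
- by move=> j jp; have := h j.+1 (ltnW jp); rewrite /b jp.
have pp := prime_gt0 p_prime.
have := congr1 (fun f : fps F => f 0%N) f1; rewrite fps1E /=.
case: (n) => [|m]; first by rewrite /form big_ord_recl big_ord0 addr0 !expr0 !mulr1.
by rewrite formS fpsDE fps_constM fpsX0 fzBs0 expr1n mulr1 fpsM0 fzys0 mul0r addr0.
Qed.

End ModP.

(** * Parametrization of one AGM step by power series *)

Section AGMParametrization.

(** With [u = s_ + 2 rr] and [v = s_ - rr], the AGM step gives [u' = s_] and [v'^3 = s_^3 - rr^3].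
    The identities [agm_u], [agm_w] and their primed versions say that, up to the factor [s_^2], the
    pair [(v^3, u^3 - v^3)] is [(B, 27 y)] at [X], and that of [(u', v')] is the same at [X^3]. *)
Definition rr : fps int := 3%:R * fps_X 1 * fps_subst 3 Y1.
Definition s_ : fps int := fps_subst 3 ss.

Lemma fps_subst_nat (k : comNzRingType) m : fps_subst 3 m%:R = m%:R :> fps k.
Proof. by rewrite -fps_nat fps_substC. Qed.

Lemma sBs : s_ = fps_subst 3 Bs + 27%:R * fps_subst 3 ys.
Proof. by rewrite /s_ ssE fps_substD fps_substM // fps_subst_nat. Qed.

Lemma X3E : fps_X 3 = fps_X 1 ^+ 3 :> fps int. Proof. by rewrite fps_XX. Qed.

Lemma agm_w' : s_ ^+ 2 * (27%:R * fps_subst 3 ys) = rr ^+ 3.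
Proof.
have := congr1 (fps_subst 3) XY1_cube; rewrite !(fps_substX, fps_substM) // fps_subst_X1 // X3E -/s_ => h.
by rewrite /rr; transitivity (27%:R * (fps_subst 3 ys * s_ ^+ 2)); [ring|rewrite -h; ring].
Qed.

Lemma agm_u' : s_ ^+ 2 * fps_subst 3 Bs = s_ ^+ 3 - rr ^+ 3.
Proof.
have -> : fps_subst 3 Bs = s_ - 27%:R * fps_subst 3 ys by rewrite sBs; ring.
by rewrite -agm_w'; ring.
Qed.

Lemma agm_Y2 : s_ * (9%:R * fps_X 1 ^+ 2 * fps_subst 3 Y2) = 3%:R * rr ^+ 2.
Proof.
have := congr1 (fps_subst 3) ssY2; rewrite !(fps_substX, fps_substM) // fps_subst_nat -/s_ => h.
transitivity (9%:R * fps_X 1 ^+ 2 * (s_ * fps_subst 3 Y2)); first by ring.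
by rewrite h /rr; ring.
Qed.

Lemma sec3E (f : fps int) : f = fps_subst 3 (fps_sec 3 0 f) + fps_X 1 * fps_subst 3 (fps_sec 3 1 f)
  + fps_X 1 ^+ 2 * fps_subst 3 (fps_sec 3 2 f).
Proof. by rewrite {1}(@fps_secE _ 3 f) // !big_ord_recl big_ord0 addr0 /= fps_X0 mul1r addrA fps_XX. Qed.

Lemma agm_u : s_ ^+ 2 * Bs = (s_ - rr) ^+ 3.
Proof.
have -> : Bs = fps_subst 3 Bs - 3%:R * rr + 9%:R * fps_X 1 ^+ 2 * fps_subst 3 Y2.
  rewrite {1}(sec3E Bs) sec_Bs0 sec_Bs1 sec_Bs2 -[9]/(9%:R) fps_nat fps_substN !fps_substM // fps_subst_nat /rr.
  by ring.
transitivity (s_ ^+ 2 * fps_subst 3 Bs - 3%:R * rr * s_ ^+ 2 + s_ * (s_ * (9%:R * fps_X 1 ^+ 2 * fps_subst 3 Y2))); first by ring.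
by rewrite agm_Y2 agm_u'; ring.
Qed.

Lemma agm_w : s_ ^+ 2 * (27%:R * ys) = (s_ + 2%:R * rr) ^+ 3 - (s_ - rr) ^+ 3.
Proof.
have E : 27%:R * ys = 9%:R * (27%:R * fps_subst 3 ys) + 9%:R * rr + 3%:R * (9%:R * fps_X 1 ^+ 2 * fps_subst 3 Y2).
  rewrite {1}(sec3E ys) sec_ys0 -[9]/(9%:R) fps_nat !fps_substM // fps_subst_nat -/Y1 -/Y2 /rr.
  by ring.
rewrite E; transitivity (9%:R * (s_ ^+ 2 * (27%:R * fps_subst 3 ys)) + 9%:R * rr * s_ ^+ 2
  + 3%:R * s_ * (s_ * (9%:R * fps_X 1 ^+ 2 * fps_subst 3 Y2))); first by ring.
by rewrite agm_Y2 agm_w'; ring.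
Qed.

Lemma s_0 : s_ 0%N = 1. Proof. exact: ss0. Qed.
Lemma rr_0 : rr 0%N = 0.
Proof. by rewrite /rr -mulrA -fps_nat fps_constM fps_XM mulr0. Qed.
Lemma rr_1 : rr 1%N = 3.
Proof.
rewrite /rr -mulrA -fps_nat fps_constM fps_XM subnn.
have -> : fps_subst 3 Y1 0%N = 1 by exact: ys1.
by rewrite mulr1.
Qed.

End AGMParametrization.

(** * Invariance along the AGM *)

Section AGMInvariant.
Variable n : nat.
Local Notation p := n.+1.
Variable F : finFieldType.
Hypothesis p_prime : prime p.
Hypothesis F_card : #|F| = p.
Hypothesis p_mod3 : (p %% 3 = 2)%N.
Hypothesis p_ge5 : (5 <= p)%N.
Variable al : nat -> F.
Hypothesis al_one : form n (fun j => fps_const (al j)) (fz F Bs) (fz F ys) = 1.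
Hypothesis al_0 : al 0%N = 1.

Lemma natF_neq0 m : (0 < m)%N -> coprime p m -> (m%:R : F) != 0.
Proof.
move=> m0 cm; rewrite -(dvdn_pcharf (pcharF p_prime F_card)).
by rewrite -prime_coprime.
Qed.

Lemma three_neq0 : (3 : F) != 0.
Proof. by apply: natF_neq0 => //; rewrite prime_coprime // gtnNdvd //; lia. Qed.

Lemma F27_neq0 : (27 : F) != 0.
Proof. by have h := expf_neq0 3 three_neq0; rewrite -natrX in h; exact: h. Qed.

Definition c27 : F := 27^-1.

(** The difference of the invariant before and after a step, in the parameters [s = u'] and
    [r = (u - v) / 3]. The map [a] embeds the scalars, so the same expression serves over power
    series, polynomials and fields. *)
Definition Psi (K : comNzRingType) (a : F -> K) (s r : K) : K :=
  form n (a \o al) ((s - r) ^+ 3) (a c27 * ((s + 2%:R * r) ^+ 3 - (s - r) ^+ 3))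
  - form n (a \o al) (s ^+ 3 - r ^+ 3) (a c27 * r ^+ 3).

Lemma Psi_map (K L : comNzRingType) (phi : {rmorphism K -> L}) (a : F -> K) s r :
  phi (Psi a s r) = Psi (phi \o a) (phi s) (phi r).
Proof.
have e1 : phi ((s - r) ^+ 3) = (phi s - phi r) ^+ 3 by rewrite rmorphXn rmorphB.
have e2 : phi ((s + 2%:R * r) ^+ 3) = (phi s + 2%:R * phi r) ^+ 3 by rewrite rmorphXn rmorphD rmorphM rmorph_nat.
have e3 : phi (a c27 * ((s + 2%:R * r) ^+ 3 - (s - r) ^+ 3)) =
    phi (a c27) * ((phi s + 2%:R * phi r) ^+ 3 - (phi s - phi r) ^+ 3).
  by rewrite rmorphM rmorphB e1 e2.
have e4 : phi (s ^+ 3 - r ^+ 3) = phi s ^+ 3 - phi r ^+ 3 by rewrite rmorphB !rmorphXn.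
have e5 : phi (a c27 * r ^+ 3) = phi (a c27) * phi r ^+ 3 by rewrite rmorphM rmorphXn.
by rewrite /Psi rmorphB !form_map e1 e3 e4 e5.
Qed.

Lemma Psi_scale (K : comNzRingType) (a : F -> K) x s r : Psi a (x * s) (x * r) = (x ^+ 3) ^+ n * Psi a s r.
Proof.
rewrite /Psi [RHS]mulrBr -!form_scale; congr (_ - _); congr (form n _ _ _); by ring.
Qed.

Lemma Psi_fps : Psi (@fps_const F) (fz F s_) (fz F rr) = 0.
Proof.
have c27E : fps_const c27 * 27%:R = 1.
  by rewrite -fps_nat -rmorphM /= /c27 mulVf ?F27_neq0 // rmorph1.
have f27 (f : fps int) : fz F (27%:R * f) = 27%:R * fz F f by rewrite fzM -fps_nat fz_const fps_nat.
have f2 (f : fps int) : fz F (2%:R * f) = 2%:R * fz F f by rewrite fzM -fps_nat fz_const fps_nat.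
have u1 : fz F s_ ^+ 2 * fz F Bs = (fz F s_ - fz F rr) ^+ 3 by rewrite -fzB -!fzX -fzM agm_u.
have u2 : fz F s_ ^+ 2 * fz F (fps_subst 3 Bs) = fz F s_ ^+ 3 - fz F rr ^+ 3.
  by rewrite -!fzX -fzB -fzM agm_u'.
have w1 : fz F s_ ^+ 2 * (27%:R * fz F ys) = (fz F s_ + 2%:R * fz F rr) ^+ 3 - (fz F s_ - fz F rr) ^+ 3.
  by rewrite -f2 -f27 -fzB -fzD -!fzX -fzM -fzB agm_w.
have w2 : fz F s_ ^+ 2 * (27%:R * fz F (fps_subst 3 ys)) = fz F rr ^+ 3 by rewrite -f27 -!fzX -fzM agm_w'.
have E1 : fps_const c27 * ((fz F s_ + 2%:R * fz F rr) ^+ 3 - (fz F s_ - fz F rr) ^+ 3) = fz F s_ ^+ 2 * fz F ys.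
  rewrite -w1; transitivity (fps_const c27 * 27%:R * (fz F s_ ^+ 2 * fz F ys)); first by ring.
  by rewrite c27E mul1r.
have E2 : fps_const c27 * fz F rr ^+ 3 = fz F s_ ^+ 2 * fps_subst 3 (fz F ys).
  rewrite -w2 fz_subst; transitivity (fps_const c27 * 27%:R * (fz F s_ ^+ 2 * fps_subst 3 (fz F ys))); first by ring.
  by rewrite c27E mul1r.
rewrite /Psi E1 E2 -u1 -u2 fz_subst !form_scale -mulrBr.
have -> : form n (@fps_const F \o al) (fz F Bs) (fz F ys) = 1 := al_one.
have -> : form n (@fps_const F \o al) (fps_subst 3 (fz F Bs)) (fps_subst 3 (fz F ys)) = 1.
  have := form_map (@substp 2 F) n (@fps_const F \o al) (fz F Bs) (fz F ys).
  have -> : form n (@fps_const F \o al) (fz F Bs) (fz F ys) = 1 := al_one.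
  rewrite rmorph1 => ->; apply: eq_form => j _ /=.
  by rewrite /substp fps_substC.
by rewrite subrr mulr0.
Qed.

(** The quotient [rho] of [rr] by [s_] is a nonzero series without constant term, hence
    transcendental over [F]; a polynomial vanishing at it is zero. *)
Lemma Psi_poly : Psi polyC 1 ('X : {poly F}) = 0.
Proof.
set P := Psi _ _ _.
have s0 : fz F s_ 0%N = 1 by rewrite -[LHS]/((s_ 0%N)%:~R) s_0.
pose rho := fps_inv (fz F s_) * fz F rr.
have si := fps_invP s0.
have h1 : Psi (@fps_const F) 1 rho = 0.
  have := Psi_fps; rewrite -[fz F s_]mulr1 -[fz F rr]mul1r -[X in Psi _ _ (X * _)]si -mulrA -/rho Psi_scale.
  case/fps_mul_eq0 => // /fpsP/(_ 0%N); rewrite -exprM fpsX0 s0 expr1n /= => /eqP.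
  by rewrite oner_eq0.
have h2 : (map_poly (@fps_const F) P).[rho] = 0.
  rewrite -[LHS]/(horner_eval rho (map_poly (@fps_const F) P)) /P Psi_map Psi_map /= rmorph1 map_polyX.
  rewrite -[RHS]h1 /Psi /= !rmorph1 /horner_eval hornerX map_polyC /= hornerC.
  by congr (_ - _); apply: eq_form => j _ /=; rewrite map_polyC /= hornerC.
have rho0 : rho 0%N = 0.
  by rewrite /rho fpsM0 -[fz F rr 0%N]/((rr 0%N)%:~R) rr_0 mulr0.
have rhon : rho <> 0.
  move=> e; have : fz F s_ * rho = 0 by rewrite e mulr0.
  rewrite /rho mulrA si mul1r => /fpsP/(_ 1%N); rewrite -[LHS]/((rr 1%N)%:~R) rr_1 /= => /eqP.
  by apply/negP; rewrite -[3%:~R]/(3 : F) three_neq0.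
apply/polyP => j; rewrite coef0.
have := @form_eq0 F (size P) (fun i => P`_i) 1 rho (erefl _) rho0 rhon.
have -> : form (size P) (fun i => fps_const P`_i) 1 rho = 0.
  rewrite -[RHS]h2 (@horner_coef_wide _ (size P).+1); last first.
    by rewrite (leq_trans (size_poly _ _)).
  by apply: eq_bigr => i _; rewrite expr1n mul1r coef_map.
move=> /(_ (erefl _)) h; have [|sj] := leqP j (size P); first exact: h.
by rewrite nth_default // ltnW.
Qed.

Lemma Psi_field1 (K : fieldType) (a : {rmorphism F -> K}) z : Psi a 1 z = 0.
Proof.
have := congr1 (fun P => horner_eval z (map_poly a P)) Psi_poly.
rewrite !rmorph0 Psi_map Psi_map /= !rmorph1 map_polyX /horner_eval hornerX => h.
rewrite -[RHS]h /Psi /= map_polyC /= hornerC.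
by congr (_ - _); apply: eq_form => j _ /=; rewrite map_polyC /= hornerC.
Qed.

Lemma Psi_field (K : fieldType) (a : {rmorphism F -> K}) s r : s != 0 -> Psi a s r = 0.
Proof.
move=> s0; rewrite -[s]mulr1 -[r](mulfVK s0) [r / s * s]mulrC Psi_scale.
by rewrite Psi_field1 mulr0.
Qed.

(** Homogeneity only treats [s] nonzero. The value [s = 0] is included by replacing [s] with [X + s]
    in the rational function field and specializing [X] to 0. *)
Lemma Psi_eq0 (s r : F) : Psi id s r = 0.
Proof.
pose a : {rmorphism F -> {fraction {poly F}}} := (@tofrac {poly F}) \o polyC.
have x0 : tofrac ('X + s%:P) != 0 :> {fraction {poly F}}.
  by rewrite tofrac_eq0 -size_poly_eq0 size_XaddC.
have := @Psi_field _ a _ (tofrac r%:P) x0.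
have := Psi_map (@tofrac {poly F}) polyC ('X + s%:P) r%:P => <- /eqP.
rewrite tofrac_eq0 => /eqP/(congr1 (horner_eval 0)).
rewrite rmorph0 Psi_map /= /horner_eval hornerD hornerX !hornerC add0r => h.
rewrite -[RHS]h /Psi /= hornerC.
by congr (_ - _); apply: eq_form => j _ /=; rewrite hornerC.
Qed.

(** Evaluation at [s = 1], [r = w] with [w] a primitive cube root of unity in the closure: [w^3 = 1]
    and [(1 + 2 w)^3 = (1 - w)^3] leave one extreme coefficient on each side. As [p = 2] modulo 3,
    [(1 - w)^p = 1 - w^2], so [(1 - w)^(p-1) = 1 + w = -w^2], whose cube is -1. *)
Lemma al_top : al n = -1.
Proof.
have [K [a _]] := countable_algebraic_closure F.
have [w hw] : exists w : K, w ^+ 2 + w + 1 = 0.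
  have [w] := @solve_monicpoly K 2 (fun i => -1) isT.
  rewrite !big_ord_recl big_ord0 /= expr0 expr1 => h; exists w; rewrite h; ring.
have w3 : w ^+ 3 = 1.
  by have -> : w ^+ 3 = (w - 1) * (w ^+ 2 + w + 1) + 1; [ring|rewrite hw mulr0 add0r].
have w2 : w ^+ 2 = - w - 1 by apply/eqP; rewrite -subr_eq0 -hw; apply/eqP; ring.
have pK : p \in [pchar K].
  by have := pcharF p_prime F_card; rewrite !inE => /andP[-> /eqP h]; rewrite -(rmorph_nat a) h rmorph0 eqxx.
have z1 : 1 - w != 0.
  rewrite subr_eq0; apply/eqP => e; have : (3 : K) = 0 by rewrite -hw -e; ring.
  rewrite -(rmorph_nat a 3) => /eqP; rewrite fmorph_eq0; apply/negP; exact: three_neq0.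
have zp : (1 - w) ^+ n = 1 + w.
  apply: (mulfI z1); rewrite -exprS -(pFrobenius_autE pK) (pFrobenius_autB_comm pK (mulrC _ _)) !pFrobenius_autE expr1n.
  rewrite (divn_eq p 3) p_mod3 exprD mulnC exprM w3 expr1n mul1r; ring.
have := Psi_field1 a w; rewrite /Psi.
have -> : (1 + 2%:R * w) ^+ 3 - (1 - w) ^+ 3 = 0.
  transitivity ((w ^+ 2 + w + 1) * (9 * w)); [by ring|by rewrite hw mul0r].
rewrite w3 expr1n subrr !mulr0 mulr1 form_w0 form_u0 /= al_0 rmorph1 mul1r exprAC zp => /eqP.
rewrite subr_eq0 -rmorphXn -rmorphM /= => /eqP e.
have c1 : c27 ^+ n = 1.
  have c0 : c27 != 0 by rewrite invr_eq0 F27_neq0.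
  by apply: (mulfI c0); rewrite -exprS -F_card expf_card mulr1.
have : a (al n * c27 ^+ n) = a (-1).
  rewrite -e rmorphN rmorph1.
  have -> : (1 + w) ^+ 3 = (- w ^+ 2) ^+ 3 by rewrite w2; congr (_ ^+ 3); ring.
  have -> : (- w ^+ 2) ^+ 3 = - (w ^+ 3) ^+ 2 by ring.
  by rewrite w3 expr1n.
by rewrite c1 mulr1; apply: fmorph_inj.
Qed.

Definition inv_agm (x : F * F) : F := form n al (x.2 ^+ 3) ((x.1 ^+ 3 - x.2 ^+ 3) / 27).

Lemma inv_agm_step (x y : F * F) : y.1 = (x.1 + 2 * x.2) / 3 ->
  y.2 ^+ 3 = x.2 * (x.1 ^+ 2 + x.1 * x.2 + x.2 ^+ 2) / 3 -> inv_agm x = inv_agm y.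
Proof.
case: x => u v; case: y => u' v' /= hu hv; have t3 := three_neq0.
pose s := u'; pose r := (u - v) / 3.
have := Psi_eq0 s r; rewrite /Psi => /eqP; rewrite subr_eq0 => /eqP e.
rewrite /inv_agm /=.
have e1 : s - r = v by rewrite /s hu /r; field.
have e2 : s + 2 * r = u by rewrite /s hu /r; field.
have e3 : s ^+ 3 - r ^+ 3 = v' ^+ 3 by rewrite hv /s hu /r; field.
rewrite e1 -[2%:R]/(2 : F) e2 e3 in e.
rewrite mulrC -[27^-1]/c27; etransitivity; first exact: e.
congr (form n _ _ _); rewrite -e3 /c27 /s mulrC; congr (_ / _); ring.
Qed.

End AGMInvariant.

(** * Complex multiplication points *)

Section CMPoint.
Variable n : nat.
Local Notation p := n.+1.
Hypothesis p_prime : prime p.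
Hypothesis p_mod3 : (p %% 3 = 2)%N.
Variable R : realType.
Local Notation C := R[i].
Local Notation B := (fz C Bs).
Local Notation y := (fz C ys).
Local Notation s3 := (sqrtN3 R).
Variable tr : int.
Hypothesis tr3 : (3 %| tr)%Z.
Hypothesis tr_lt : tr ^+ 2 < 4 * p%:Z.

(** The integer for which [lam tau = (tr - 1) tau - cc]; the division is exact since 3 divides
    [p + 1] and [tr]. *)
Definition cc : int := ((p%:Z + 1 - tr) %/ 3)%Z.

Lemma ccE : cc * 3 = p%:Z + 1 - tr.
Proof.
have d1 : (3 %| (p + 1)%N%:Z)%Z by rewrite dvdzE /=; lia.
rewrite divzK // -[p%:Z + 1]/((p + 1)%N%:Z); exact: rpredB.
Qed.

Definition disc : R := Num.sqrt (4 * p%:R - tr%:~R ^+ 2).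

Lemma disc_pos : 0 < 4 * p%:R - tr%:~R ^+ 2 :> R.
Proof.
rewrite subr_gt0; have -> : (tr%:~R : R) ^+ 2 = (tr ^+ 2)%:~R by rewrite rmorphXn.
by have -> : 4 * p%:R = (4 * p%:Z)%:~R :> R; [rewrite rmorphM|rewrite ltr_int].
Qed.

(** [lam] and its conjugate [lamb_] are the roots of [Z^2 - tr Z + p]. *)
Definition lam : C := ((tr%:~R / 2) +i* (disc / 2))%C.
Definition lamb_ : C := ((tr%:~R / 2) -i* (disc / 2))%C.

Lemma lam_norm : lam * lamb_ = p%:R.
Proof.
have d2 : disc ^+ 2 = 4 * p%:R - tr%:~R ^+ 2 by rewrite sqr_sqrtr // ltW // disc_pos.
rewrite natC; apply/eqP; rewrite eq_complex /=; apply/andP; split; apply/eqP; last by ring.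
transitivity ((tr%:~R ^+ 2 + disc ^+ 2) / 4); first by field.
by rewrite d2; field.
Qed.

Lemma lam_sum : lam + lamb_ = tr%:~R.
Proof.
rewrite -(rmorph_int (real_complex R)); apply/eqP; rewrite eq_complex /=; apply/andP; split; apply/eqP; last by ring.
by field.
Qed.

Lemma lamb_eq : lamb_ ^+ 2 - tr%:~R * lamb_ + p%:R = 0.
Proof. by rewrite -lam_norm -lam_sum; ring. Qed.

Definition tau : C := (lam - 1) / 3.

Lemma tau_gt0 : 0 < Im tau.
Proof.
rewrite /tau (Im_divn _ 2) divr_gt0 //= subr0 divr_gt0 // sqrtr_gt0; exact: disc_pos.
Qed.

Lemma lam_neq0 : lam != 0.
Proof. by apply/eqP => h; have := lam_norm; rewrite h mul0r => /esym/eqP; rewrite pnatr_eq0. Qed.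

Lemma lam_tau : lam * tau = (tr%:~R - 1) * tau - cc%:~R.
Proof.
have c3 : cc%:~R * 3 = p%:R + 1 - tr%:~R :> C.
  transitivity ((cc * 3)%:~R : C); first by rewrite rmorphM.
  by rewrite ccE rmorphB rmorphD.
have t3 : (3 : C) != 0 by rewrite pnatr_eq0.
by apply: (mulIf t3); rewrite mulrBl c3 /tau -lam_norm -lam_sum; field.
Qed.

Lemma lat_cm (f g : int -> int -> C) :
  (forall m k, nc (f m k) <= 1) -> (forall m k, nc (g m k) <= 1) ->
  (forall m k, g (m * (tr - 1) + 3 * k) (k - cc * m) = f m k) ->
  (forall M N, g M N != 0 -> (p %| M - 3 * N)%Z) ->
  lat f tau = lam ^+ 3 * lat g tau.
Proof.
move=> f1 g1 fg gs; pose h (z : int * int) : int * int := (z.1 * (tr - 1) + 3 * z.2, z.2 - cc * z.1).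
have key (m k : int) : (m * (tr - 1) + 3 * k) - 3 * (k - cc * m) = p%:Z * m.
  by transitivity (m * (tr - 1 + cc * 3)); [ring|rewrite ccE; ring].
have p0 : p%:Z != 0 by [].
apply: (@lat_push _ f g tau tau h lam) => //; try exact: tau_gt0.
- exact: lam_neq0.
- move=> [a b] [c d] [e1 e2]; have ea : a = c.
    by apply: (mulfI p0); rewrite -(key a b) -(key c d) e1 e2.
  by move: e2; rewrite ea => /addIr ->.
- by move=> [a b]; apply: fg.
- move=> M N /gs /divzK E; set m := ((M - 3 * N) %/ p)%Z in E.
  exists (m, N + cc * m); rewrite /h /=; congr pair; last by ring.
  transitivity (m * (tr - 1 + cc * 3) + 3 * N); first by ring.
  by rewrite ccE; transitivity (m * p%:Z + 3 * N); [ring|rewrite E; ring].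
- move=> [a b]; rewrite /h /=; transitivity (a%:~R * (lam * tau) + lam * b%:~R); last by ring.
  rewrite lam_tau !(rmorphD, rmorphB, rmorphM) /= rmorph1.
  have -> : lam = 3 * tau + 1 by rewrite /tau; field.
  ring.
Qed.

Lemma exists_line : exists j : 'I_p, (p %| 3 * j%:Z - 1)%Z.
Proof.
have c3 : coprime 3 p by rewrite coprime_sym; apply: coprime_p3.
have [u v E _] := egcdnP p (isT : (0 < 3)%N).
have hk : (u %% p < p)%N by rewrite ltn_mod.
exists (Ordinal hk); rewrite /=.
have -> : 3 * (u %% p)%N%:Z - 1 = (v%:Z - 3 * (u %/ p)%N%:Z) * p%:Z.
  have e1 := divn_eq u p; move: c3; rewrite /coprime => /eqP g1; rewrite g1 in E.
  have : u%:Z = (u %/ p)%N%:Z * p%:Z + (u %% p)%N%:Z by rewrite {1}e1 PoszD PoszM.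
  have : u%:Z * 3 = v%:Z * p%:Z + 1 by rewrite -!PoszM -PoszD E.
  set U := u%:Z; set Q := (u %/ p)%N%:Z; set r := (u %% p)%N%:Z; set P := p%:Z; set V := v%:Z.
  move=> h1 h2; have -> : r = U - Q * P by rewrite h2; ring.
  by transitivity (U * 3 - 3 * Q * P - 1); [ring|rewrite h1; ring].
exact: dvdz_mull.
Qed.

(** Multiplication by [lam] identifies the lattice of [tau] with its sublattice [p | M - 3 N], the
    line of slope [1/3] modulo [p]. The two lattice sums differ by [lam^3], and [p^3 / lam^3] is
    [lamb_^3]. *)
Lemma cm_roots : exists l : option 'I_p, rt y l tau = - (lamb_ ^+ 3) * ev y (ee tau) /\ rt B l tau = - (lamb_ ^+ 3) * ev B (ee tau).
Proof.
have [j hj] := exists_line; exists (Some j).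
have t0 := tau_gt0; have l0 := lam_neq0.
have p0 := p_neq0 n R; have p3 : (p%:R ^+ 3 : C) != 0 by rewrite expf_neq0.
have lp : lamb_ = p%:R / lam by rewrite -lam_norm mulrAC divff // mul1r.
have inE (M N : int) : inl_ (Some j) M N = (p %| M - 3 * N)%Z.
  rewrite /inl_ -(p3z p_prime p_mod3).
  have -> : 3 * (N - j%:Z * M) = - (M - 3 * N) - (3 * j%:Z - 1) * M by ring.
  have d : (p %| (3 * j%:Z - 1) * M)%Z by apply: dvdz_mulr.
  apply/idP/idP => h; last by apply: rpredB => //; rewrite rpredN.
  by rewrite -rpredN -[X in (p %| X)%Z](subrK ((3 * j%:Z - 1) * M)); apply: rpredD.
have inh (m k : int) : inl_ (Some j) (m * (tr - 1) + 3 * k) (k - cc * m).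
  rewrite inE (_ : _ - _ = p%:Z * m) ?dvdz_mulr //.
  by transitivity (m * (tr - 1 + cc * 3)); [ring|rewrite ccE; ring].
have k0 : 2 * kap R != 0 by apply: mulf_neq0 (kap_neq0 R); rewrite pnatr_eq0.
have l3 : lam ^+ 3 != 0 by rewrite expf_neq0.
have /dvdzP[q tq] := tr3.
split.
- have f1 (m k : int) : nc (- (chi m)%:~R : C) <= 1 by rewrite ncN nc_chi.
  have := @lat_cm (fun m _ => - (chi m)%:~R) (phiy R (Some j)) f1 (nc_phiy _ _).
  rewrite (latN t0); last by move=> m k; apply: nc_chi.
  have hl : lat (phiy R (Some j)) tau = 2 * kap R / p%:R ^+ 3 * rt y (Some j) tau by apply: lat_phiy.
  rewrite (lat_ys t0) hl => h.
  have e : - (2 * kap R * ev y (ee tau)) = lam ^+ 3 * (2 * kap R / p%:R ^+ 3 * rt y (Some j) tau).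
    apply: h => [m k|M N]; last first.
      by rewrite /phiy; case: ifP => [|_]; [rewrite inE|rewrite eqxx].
    rewrite /phiy inh -rmorphN; congr (_%:~R).
    have -> : m * (tr - 1) + 3 * k = - m + 3 * (q * m + k) by rewrite tq; ring.
    by rewrite chi_Dmul chiN.
  rewrite lp expr_div_n; move: e; move: (rt _ _ _) (ev _ _) (p%:R ^+ 3) p3 (lam ^+ 3) l3 (2 * kap R) k0.
  move=> r Y P P0 L L0 K K0 e; apply: (mulfI K0); apply: (mulfI L0); apply: (mulIf (invr_neq0 P0)).
  transitivity (L * (K / P * r)); first by field.
  by rewrite -e; field; rewrite L0 P0.
- have f1 (m k : int) : nc (if (3 %| m)%Z then (chi k)%:~R else 0 : C) <= 1.
    by case: ifP => _; rewrite ?nc_chi // nc0 ler01.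
  have := @lat_cm (fun m k => if (3 %| m)%Z then (chi k)%:~R else 0) (phiB R (Some j)) f1 (nc_phiB _ _).
  have hl : lat (phiB R (Some j)) tau = 2 * kap R * s3 / 243 / p%:R ^+ 3 * rt B (Some j) tau by apply: lat_phiB.
  rewrite (lat_Bs t0) hl => h.
  have e : - (2 * kap R * s3 / 243) * ev B (ee tau) = lam ^+ 3 * (2 * kap R * s3 / 243 / p%:R ^+ 3 * rt B (Some j) tau).
    apply: h => [m k|M N]; last first.
      by rewrite /phiB; case: ifP => [/andP[+ _]|_]; [rewrite inE|rewrite eqxx].
    rewrite /phiB inh /=.
    have -> : m * (tr - 1) + 3 * k = - m + 3 * (q * m + k) by rewrite tq; ring.
    rewrite rpredDr ?dvdz_mulr // rpredN; case: ifP => // /dvdzP[a ->].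
    have -> : k - cc * (a * 3) = k + 3 * (- (cc * a)) by ring.
    by rewrite chi_Dmul.
  have ks : 2 * kap R * s3 / 243 != 0.
    by rewrite mulf_neq0 ?invr_eq0 ?pnatr_eq0 // mulf_neq0 // sqrtN3_neq0.
  rewrite lp expr_div_n; move: e; move: (rt _ _ _) (ev _ _) (p%:R ^+ 3) p3 (lam ^+ 3) l3 (2 * kap R * s3 / 243) ks.
  move=> r Y P P0 L L0 K K0 e; apply: (mulfI K0); apply: (mulfI L0); apply: (mulIf (invr_neq0 P0)).
  transitivity (L * (K / P * r)); first by field.
  by rewrite -e; field; rewrite L0 P0.
Qed.

Lemma ev_form k (c : nat -> int) q : nc q < 1 ->
  ev (fz C (form k (fun j => fps_const (c j)) Bs ys)) q = form k (fun j => (c j)%:~R) (ev B q) (ev y q).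
Proof.
move=> q1; have tB := @tame_Bs R; have ty := @tame_ys R.
have tc z : tame (fps_const z : fps C) by apply: tame_const.
rewrite (form_map (fz C)).
have tt j : tame ((fps_const (c j)%:~R : fps C) * (B ^+ (k - j) * y ^+ j)).
  by apply: tameM => //; apply: tameM; apply: tameX.
have -> : form k (fz C \o (fun j => fps_const (c j))) B y = \sum_(j < k.+1) fps_const (c j)%:~R * (B ^+ (k - j) * y ^+ j).
  by apply: eq_bigr => j _ /=; rewrite fz_const.
rewrite (ev_sum _ _ q1) //; apply: eq_bigr => j _.
by rewrite (evM (tc _) (tameM (tameX _ tB) (tameX _ ty)) q1) (evM (tameX _ tB) (tameX _ ty) q1) (evX _ tB q1) (evX _ ty q1) (ev_const (c j)%:~R).
Qed.

(** The isogeny polynomial at [B = 1], [y = X], [Z = mu X^e]: [e = 0] for [B] and [e = 1] for [y],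
    because the root at the CM point is [mu] times the form itself. *)
Definition Hpoly (K : comNzRingType) (c : nat -> nat -> int) (e : nat) (mu : K) : {poly K} :=
  \sum_(i < p.+2) \sum_(j < p.+2 - i) ((c i j)%:~R * mu ^+ i) *: 'X^(j + e * i).

Lemma root_relation (G : fps int) c (b0 y0 x : C) : tame (fz C G) -> form_coefs n G c ->
  b0 = ev B (ee tau) -> y0 = ev y (ee tau) ->
  (exists l : option 'I_p, rt (fz C G) l tau = x) ->
  \sum_(i < p.+2) form (p.+1 - i) (fun j => (c i j)%:~R) b0 y0 * x ^+ i = 0.
Proof.
move=> tG h -> -> [l hl]; pose P : {poly C} := \prod_(l : option 'I_p) ('X - (rt (fz C G) l tau)%:P).
have px : P.[x] = 0.
  rewrite /P horner_prod (bigD1 l) //= hornerXsubC hl subrr mul0r //.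
have sz : (size P <= p.+2)%N.
  by rewrite /P size_prod_XsubC [index_enum _]unlock -enumT -cardT card_option card_ord.
rewrite -[RHS]px (horner_coef_wide _ sz); apply: eq_bigr => i _; congr (_ * _).
rewrite -(isopoly_ev n tG i tau_gt0) -fz_isopoly h; last by rewrite -ltnS.
by rewrite ev_form // ee_lt1 // tau_gt0.
Qed.

Lemma cm_common_root (cB cy : nat -> nat -> int) : form_coefs n Bs cB -> form_coefs n ys cy ->
  exists x0 : C, (Hpoly cB 0 (- (lamb_ ^+ 3))).[x0] = 0 /\ (Hpoly cy 1 (- (lamb_ ^+ 3))).[x0] = 0.
Proof.
move=> hB hy; have [l [ly lB]] := cm_roots.
set b0 := ev B (ee tau); set y0 := ev y (ee tau); set mu := - (lamb_ ^+ 3).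
(* [B] has no zero in the disc because [1/B] converges there; this allows the common root [y/B]. *)
have b0n : b0 != 0.
  have q1 := ee_lt1 tau_gt0.
  have : b0 * ev (fps_inv B) (ee tau) = 1.
    have e := evM (@tame_Bs R) (@tame_invB R) q1.
    by apply: (etrans (esym e)); rewrite fps_invP ?ev1 //; apply: B0.
  by move=> h; apply/eqP => z; move: h; rewrite z mul0r => /esym/eqP; rewrite oner_eq0.
have rB := root_relation (@tame_Bs R) hB (erefl b0) (erefl y0) (ex_intro _ l lB).
have ry := root_relation (@tame_ys R) hy (erefl b0) (erefl y0) (ex_intro _ l ly).
have {}rB : \sum_(i < p.+2) form (p.+1 - i) (fun j => (cB i j)%:~R) b0 y0 * (mu * b0) ^+ i = 0 := rB.
have {}ry : \sum_(i < p.+2) form (p.+1 - i) (fun j => (cy i j)%:~R) b0 y0 * (mu * y0) ^+ i = 0 := ry.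
exists (y0 / b0).
have hH (c : nat -> nat -> int) e (z : C) : (Hpoly c e mu).[z] =
    \sum_(i < p.+2) form (p.+1 - i) (fun j => (c i j)%:~R) 1 z * (mu * z ^+ e) ^+ i.
  rewrite /Hpoly horner_sum; apply: eq_bigr => i _; rewrite horner_sum /form mulr_suml.
  have ip : (i <= p.+1)%N by rewrite -ltnS.
  rewrite subSn //; apply: eq_bigr => j _; rewrite hornerZ hornerXn expr1n mul1r exprD exprM exprMn.
  by move: ((c i j)%:~R) (mu ^+ i) (z ^+ j) ((z ^+ e) ^+ i) => a1 a2 a3 a4; ring.
have fs (c : nat -> int) k : form k (fun j => (c j)%:~R) b0 y0 = b0 ^+ k * form k (fun j => (c j)%:~R) 1 (y0 / b0).
  by rewrite -form_scale mulr1 mulrC divfK.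
have bn : b0 ^+ p.+1 != 0 by rewrite expf_neq0.
split; rewrite hH; apply: (mulfI bn); rewrite mulr0.
- rewrite -[RHS]rB mulr_sumr; apply: eq_bigr => i _; have ip : (i <= p.+1)%N by rewrite -ltnS.
  have e : b0 ^+ p.+1 = b0 ^+ (p.+1 - i) * b0 ^+ i by rewrite -exprD subnK.
  by rewrite fs e expr0 mulr1 exprMn; move: (form _ _ _ _) (b0 ^+ _) (b0 ^+ i) (mu ^+ i) => a1 a2 a3 a4; ring.
- rewrite -[RHS]ry mulr_sumr; apply: eq_bigr => i _; have ip : (i <= p.+1)%N by rewrite -ltnS.
  have e : b0 ^+ p.+1 = b0 ^+ (p.+1 - i) * b0 ^+ i by rewrite -exprD subnK.
  have ye : y0 ^+ i = b0 ^+ i * (y0 / b0) ^+ i by rewrite -exprMn mulrC divfK.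
  by rewrite fs e expr1 (exprMn_comm _ (mulrC mu y0)) (exprMn_comm _ (mulrC mu (y0 / b0))) ye; move: (form _ _ _ _) (b0 ^+ _) (b0 ^+ i) (mu ^+ i) ((y0 / b0) ^+ i) => a1 a2 a3 a4 a5; ring.
Qed.

Lemma reduce_quadratic (P : {poly int}) : exists Q (a b : int),
  P = Q * ('X^2 - tr%:P * 'X + (p%:Z)%:P) + a%:P + b%:P * 'X.
Proof.
elim/poly_ind: P => [|P c [Q [a [b ->]]]]; first by exists 0, 0, 0; rewrite !polyC0; ring.
exists (Q * 'X + b%:P), (c - b * p%:Z), (a + b * tr).
by rewrite !(polyCB, polyCD, polyCM); ring.
Qed.

(** Division by [X^2 - tr X + p] leaves a remainder [a + b X] with integer coefficients that
    vanishes at the nonreal [lamb_], so it is zero. In characteristic [p] the divisor vanishes at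
    [tr]. *)
Lemma cm_int_root (P : {poly int}) (F : comNzRingType) : (p%:R : F) = 0 ->
  (map_poly (intmul 1) P).[lamb_] = 0 -> (map_poly (intmul 1) P).[tr%:~R : F] = 0.
Proof.
move=> pF; have [Q [a [b ->]]] := reduce_quadratic P.
have E (K : comNzRingType) (z : K) : (map_poly (intmul 1) (Q * ('X^2 - tr%:P * 'X + (p%:Z)%:P) + a%:P + b%:P * 'X)).[z]
    = (map_poly (intmul 1) Q).[z] * (z ^+ 2 - tr%:~R * z + p%:R) + a%:~R + b%:~R * z.
  by rewrite !(rmorphD, rmorphN, rmorphXn, rmorphM) /= !map_polyX !map_polyC /= !(hornerE, hornerXn).
rewrite !E lamb_eq mulr0 add0r => h.
have di : disc != 0 by rewrite sqrtr_eq0 -ltNge; exact: disc_pos.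
have [b0 a0] : b = 0 /\ a = 0.
  have h' : (a%:~R : R)%:C%C + (b%:~R : R)%:C%C * lamb_ = 0 by rewrite !rmorph_int.
  have := congr1 (@complex.Im R) h'; rewrite /= mul0r addr0 add0r mulrN => /eqP.
  rewrite oppr_eq0 !mulf_eq0 (negPf di) invr_eq0 pnatr_eq0 /= orbF intr_eq0 => /eqP b0.
  split=> //; move: h'; rewrite b0 rmorph0 mul0r addr0 => /(congr1 (@complex.Re R)) /= /eqP.
  by rewrite intr_eq0 => /eqP.
by rewrite b0 a0 !rmorph0 mul0r !addr0 pF addr0 -expr2 subrr mulr0.
Qed.

End CMPoint.

(** * Cube roots in a field with q = 2 modulo 3 *)

Section CubeRoots.
Variable F : finFieldType.
Hypothesis F_mod3 : (#|F| %% 3 = 2)%N.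

(** The exponent inverts 3 modulo [q - 1]: for [q = 3 k + 2], [3 (2 k + 1) = 2 (q - 1) + 1]. *)
Definition croot (z : F) : F := z ^+ (2 * (#|F| %/ 3) + 1).

Lemma crootK z : croot z ^+ 3 = z.
Proof.
rewrite /croot -exprM.
have -> : ((2 * (#|F| %/ 3) + 1) * 3 = #|F| + (#|F|).-1)%N.
  by have := divn_eq #|F| 3; rewrite F_mod3; lia.
have [->|z0] := eqVneq z 0; first by rewrite exprD expf_card mul0r.
rewrite exprD expf_card -exprS prednK ?expf_card //.
by apply/card_gt0P; exists 0.
Qed.

Lemma cube_inj (x y : F) : x ^+ 3 = y ^+ 3 -> x = y.
Proof.
have e (z : F) : croot (z ^+ 3) = z.
  rewrite /croot -exprM mulnC exprM -/(croot z) -[RHS]crootK /croot.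
  by rewrite -!exprM.
by move=> h; rewrite -(e x) h e.
Qed.

End CubeRoots.

(** * Vertices with a prescribed invariant *)

Section ModularValue.
Variable n : nat.
Local Notation p := n.+1.
Variable F : finFieldType.
Hypothesis p_prime : prime p.
Hypothesis F_card : #|F| = p.
Hypothesis p_mod3 : (p %% 3 = 2)%N.
Hypothesis p_ge5 : (5 <= p)%N.
Variables cB cy : nat -> nat -> int.
Hypothesis hB : form_coefs n Bs cB.
Hypothesis hy : form_coefs n ys cy.
Variable tr : int.
Hypothesis tr3 : (3 %| tr)%Z.
Hypothesis tr_lt : tr ^+ 2 < 4 * p%:Z.
Hypothesis tr0 : tr != 0.
Local Notation al := (alpha F cB).

Lemma intF_eq0 (z : int) : (z%:~R : F) = 0 -> exists k : int, z = k * p%:Z.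
Proof.
move=> h; apply/dvdzP; have pc := pcharF p_prime F_card.
have : ((`|z|%N)%:R : F) == 0.
  by case: (z) h => m; rewrite ?NegzE ?rmorphN /= => /eqP; rewrite ?oppr_eq0.
by rewrite -(dvdn_pcharf pc) dvdzE.
Qed.

(** A congruence with [tr != e] forces [|tr| >= p - 1], against [tr^2 < 4 p] once [p >= 6]. For
    [p = 5] the conditions leave only [tr = 3] and [tr = -3]. Equality is excluded since [tr] is a
    nonzero multiple of 3. *)
Lemma tr_neq (e : int) : e = 1 \/ e = -1 \/ e = 0 -> (tr%:~R : F) != e%:~R.
Proof.
move=> he; apply/eqP => h; have [k hk] : exists k, tr - e = k * p%:Z.
  by apply: intF_eq0; rewrite rmorphB /= h subrr.
have /dvdzP[s hs] := tr3.
have := tr_lt; have := tr0; have := p_ge5; have := p_mod3.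
have -> : tr = e + k * p%:Z by rewrite -hk; ring.
have e3 : e + k * p%:Z = s * 3 by rewrite -hs -hk; ring.
move: e3; set P : int := p%:Z => e3 hm h5 hn hl.
have P5 : 5 <= P by [].
have k0 : k != 0.
  by apply/eqP => k0; move: hn e3; rewrite k0 mul0r addr0 => hn e3; case: he => [|[]] h'; subst e; lia.
have P6 : P = 5 \/ 6 <= P by lia.
have kk : 1 <= k \/ k <= -1 by lia.
have e1 : -1 <= e /\ e <= 1 by case: he => [|[]] ->.
case: P6 => P6.
  rewrite P6 in hl e3; rewrite expr2 in hl.
  have : -1 <= k /\ k <= 1 by nia.
  by case: he => [|[]] h'; subst e; lia.
have P0 : 0 <= P by lia.
rewrite expr2 in hl; case: kk => kk.
  have h1 : P <= k * P by rewrite -{1}[P]mul1r ler_wpM2r.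
  move: (k * P) h1 hl => w h1 hl; have hw : P - 1 <= e + w by lia.
  by clear -hw hl P6; move: (e + w) hw hl => z hw hl; nia.
have h1 : k * P <= - P by rewrite -[- P]mulN1r ler_wpM2r.
move: (k * P) h1 hl => w h1 hl; have hw : e + w <= 1 - P by lia.
by clear -hw hl P6; move: (e + w) hw hl => z hw hl; nia.
Qed.

(** The reduction of [- lamb_^3]: modulo [p] the equation of [lamb_] becomes [Z (Z - tr) = 0], and
    the root [tr] is chosen. *)
Definition mu : F := - (tr%:~R) ^+ 3.

Lemma F3 : (#|F| %% 3 = 2)%N. Proof. by rewrite F_card. Qed.

Lemma mu_neq0 : mu != 0.
Proof. by rewrite oppr_eq0 expf_neq0 // (tr_neq (e := 0)) //; right; right. Qed.

Lemma mu_neqN1 : mu != -1.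
Proof.
rewrite eqr_opp; apply/eqP => h; have := tr_neq (or_introl (erefl 1)).
by rewrite rmorph1 => /eqP; apply; apply: (cube_inj F3); rewrite h expr1n.
Qed.

Lemma mu_neq1 : mu != 1.
Proof.
rewrite eqr_oppLR; apply/eqP => h; have := tr_neq (or_intror (or_introl (erefl (-1)))).
rewrite rmorphN rmorph1 => /eqP; apply; apply: (cube_inj F3); rewrite h; ring.
Qed.

Lemma mu_p : mu ^+ p.+1 = mu ^+ 2.
Proof. by rewrite exprS -F_card expf_card expr2. Qed.

Lemma coefs_modp G c i j : form_coefs n G c -> (i <= p.+1)%N -> i != 1%N -> (j <= p.+1 - i)%N ->
  ((c i j)%:~R : F) = (i == p.+1)%:R.
Proof.
move=> h hi i1 hj; have e := form_coefs_modp p_prime F_card h hi.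
rewrite (negPf i1) subr0 in e.
apply: (@form_inj F (p.+1 - i) (fun j => (c i j)%:~R) (fun=> (i == p.+1)%:R)) => //.
rewrite e; have [->|_] := eqVneq i p.+1.
  by rewrite subnn /form big_ord_recl big_ord0 addr0 !expr0 !mulr1.
by rewrite /form big1 // => k _; rewrite mul0r.
Qed.

Definition Apoly : {poly F} := \sum_(j < p) al j *: 'X^j.

(** Only [Z^(p+1)] and [Z] survive in the isogeny polynomial modulo [p], and [mu^(p+1) = mu^2]. *)
Lemma Hpoly_modp G c e : form_coefs n G c ->
  Hpoly n c e mu = (mu ^+ 2) *: 'X^(e * p.+1) + \sum_(j < p.+1) ((c 1%N j)%:~R * mu) *: 'X^(j + e).
Proof.
move=> h; rewrite /Hpoly (bigD1 ord_max) //=; congr (_ + _).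
  rewrite subSnn big_ord_recl big_ord0 addr0 (coefs_modp h) ?subnn // eqxx mul1r mu_p; congr (_ *: 'X^_).
have h1 : (1 < p.+2)%N by [].
rewrite (bigD1 (Ordinal h1)) //=; rewrite [X in _ + X]big1 ?addr0; first by rewrite expr1 muln1 subn1.
move=> i /andP[i1 i2].
have i2' : (i : nat) != 1%N by apply: contra i2 => /eqP E; apply/eqP/val_inj.
rewrite big1 // => j _.
have ip : (i <= p.+1)%N by rewrite -ltnS.
have hj : (j <= p.+1 - i)%N by rewrite -ltnS -subSn.
rewrite (coefs_modp h) //.
have -> : (i == p.+1 :> nat) = false by apply: negbTE; apply: contra i1 => /eqP E; apply/eqP/val_inj.
by rewrite mul0r scale0r.
Qed.

Lemma HB_modp : Hpoly n cB 0 mu = (mu ^+ 2)%:P - mu *: Apoly.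
Proof.
have [ap _ _ _ _] := alpha_spec p_prime F_card hB hy.
rewrite (Hpoly_modp 0 hB) mul0n expr0 alg_polyC; congr (_ + _).
have cE j : ((cB 1%N j)%:~R : F) = - al j by rewrite /alpha opprK.
rewrite big_ord_recr /= cE ap oppr0 mul0r scale0r addr0 -scaleNr /Apoly scaler_sumr.
apply: eq_bigr => j _; rewrite cE addn0 scalerA; congr (_ *: _); ring.
Qed.

Lemma Hy_modp : Hpoly n cy 1 mu = (mu ^+ 2) *: 'X^(p.+1) - mu *: ('X^2 * Apoly).
Proof.
have [_ a0 aS _ _] := alpha_spec p_prime F_card hB hy.
rewrite (Hpoly_modp 1 hy) mul1n; congr (_ + _).
have cE j : ((cy 1%N j)%:~R : F) = - alpha F cy j by rewrite /alpha opprK.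
rewrite big_ord_recl /= cE a0 oppr0 mul0r scale0r add0r -scaleNr /Apoly mulr_sumr scaler_sumr.
apply: eq_bigr => j _; rewrite /= /bump /= add1n cE aS // -scalerAr scalerA -exprD addn1 add2n.
congr (_ *: _); ring.
Qed.

Lemma Hpoly_size (K : comNzRingType) c e (m : K) : (e <= 1)%N -> (size (Hpoly n c e m) <= p.+2)%N.
Proof.
move=> e1; apply/leq_sizeP => k hk; rewrite /Hpoly coef_sum big1 // => i _; rewrite coef_sum big1 // => j _.
rewrite coefZ coefXn; case: eqP => [E|_]; last by rewrite mulr0.
have := ltn_ord j; have := ltn_ord i; case: e e1 E => [|[|//]] _; rewrite ?mul0n ?mul1n; lia.
Qed.

Lemma Hpoly_map (K L : comNzRingType) (phi : {rmorphism K -> L}) c e m :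
  map_poly phi (Hpoly n c e m) = Hpoly n c e (phi m).
Proof.
rewrite /Hpoly rmorph_sum; apply: eq_bigr => i _; rewrite rmorph_sum; apply: eq_bigr => j _ /=.
by rewrite map_polyZ map_polyXn rmorphM rmorphXn rmorph_int.
Qed.

Lemma Acoef j : Apoly`_j = if (j < p)%N then al j else 0.
Proof.
rewrite /Apoly coef_sum; case: ltnP => hj.
  rewrite (bigD1 (Ordinal hj)) //= coefZ coefXn eqxx mulr1 big1 ?addr0 // => i ij.
  rewrite coefZ coefXn; case: eqP => [E|]; last by rewrite mulr0.
  by case/eqP: ij; apply/val_inj.
rewrite big1 // => i _; rewrite coefZ coefXn; case: eqP => [E|]; last by rewrite mulr0.
by move: hj; rewrite E leqNgt ltn_ord.
Qed.

Lemma p_fact : (p%:R : F) = 0.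
Proof. by have /andP[_ /eqP] := pcharF p_prime F_card. Qed.

Lemma alpha_value : exists2 a : F, form n al 1 a = mu & a != 0.
Proof.
have [ap a0 aS al1 al0] := alpha_spec p_prime F_card hB hy.
have top := al_top p_prime F_card p_mod3 p_ge5 al1 al0.
(* The indeterminate specializes to [lamb_] over [C] and to [tr] over [F]. Modulo [p], the
   polynomial for [B] falls below its formal degree [p + 1]; adding the one for [y] gives [G1] the
   same leading coefficient as [G2], which reduces to [mu^2 + mu], so the resultant commutes with
   reduction. *)
pose Mu : {poly int} := - 'X^3.
pose G2 := Hpoly n cy 1 Mu; pose G1 := Hpoly n cB 0 Mu + G2.
pose phi (K : comNzRingType) (z : K) : {rmorphism {poly int} -> K} := horner_eval z \o map_poly (intmul 1).
have phiMu (K : comNzRingType) (z : K) : phi K z Mu = - z ^+ 3.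
  by rewrite /= /horner_eval /Mu rmorphN rmorphXn /= map_polyX hornerN hornerXn.
have G2F : map_poly (phi F tr%:~R) G2 = (mu ^+ 2) *: 'X^(p.+1) - mu *: ('X^2 * Apoly).
  by rewrite /G2 Hpoly_map phiMu Hy_modp.
have G1F : map_poly (phi F tr%:~R) G1 = (mu ^+ 2)%:P - mu *: Apoly + ((mu ^+ 2) *: 'X^(p.+1) - mu *: ('X^2 * Apoly)).
  by rewrite /G1 rmorphD /= G2F Hpoly_map phiMu HB_modp.
have c2 : phi F tr%:~R G2`_(p.+1) = mu ^+ 2 + mu.
  rewrite -coef_map G2F coefB !coefZ coefXn eqxx mulr1 coefXnM /= subSS subSS subn0 Acoef ltnSn top.
  by ring.
have c1 : phi F tr%:~R G1`_(p.+1) = mu ^+ 2 + mu.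
  have cB0 : phi F tr%:~R (Hpoly n cB 0 Mu)`_(p.+1) = 0.
    by rewrite -coef_map Hpoly_map phiMu HB_modp coefB coefC coefZ Acoef ltnNge leqnSn mulr0 subr0.
  by rewrite /G1 coefD rmorphD cB0 c2 add0r.
have cn0 : mu ^+ 2 + mu != 0.
  rewrite (_ : mu ^+ 2 + mu = mu * (mu + 1)); last by ring.
  by rewrite mulf_neq0 ?mu_neq0 // addr_eq0 mu_neqN1.
have szG (G : {poly {poly int}}) : (size G <= p.+2)%N -> phi F tr%:~R G`_(p.+1) = mu ^+ 2 + mu -> size G = p.+2.
  move=> s1 c; apply/eqP; rewrite eqn_leq s1 /= ltnNge; apply/negP => s2.
  by case/eqP: cn0; rewrite -c nth_default // rmorph0.
have s2 : size G2 = p.+2 by apply: szG => //; apply: Hpoly_size.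
have s1 : size G1 = p.+2.
  apply: szG => //; rewrite (leq_trans (size_polyD _ _)) // geq_max s2 leqnn andbT; exact: Hpoly_size.
have g1 : (1 < size G1)%N by rewrite s1.
have g2 : (1 < size G2)%N by rewrite s2.
have [[U V] /= _ res] := @resultant_in_ideal _ G1 G2 g1 g2.
pose R0 : realType := Rdefinitions.R.
have [x0 [x1 x2]] := @cm_common_root n p_prime p_mod3 R0 tr tr3 tr_lt cB cy hB hy.
have resC : phi _ (lamb_ n R0 tr) (resultant G1 G2) = 0.
  have := congr1 (fun P => (map_poly (phi _ (lamb_ n R0 tr)) P).[x0]) res.
  rewrite map_polyC hornerC => ->.
  rewrite rmorphD !rmorphM /= hornerD !hornerM /G1 rmorphD /= hornerD /G2 !Hpoly_map !phiMu x1 x2.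
  by rewrite addr0 !mulr0 addr0.
have resF : phi F tr%:~R (resultant G1 G2) = 0 .
  by apply: (@cm_int_root _ R0 _ tr_lt _ F p_fact resC).
have gsz : (1 < size (gcdp (map_poly (phi F tr%:~R) G1) (map_poly (phi F tr%:~R) G2)))%N.
  have l1 : phi F tr%:~R (lead_coef G1) != 0 by rewrite lead_coefE s1 -[p.+2.-1]/(p.+1) c1.
  have l2 : phi F tr%:~R (lead_coef G2) != 0 by rewrite lead_coefE s2 -[p.+2.-1]/(p.+1) c2.
  by rewrite -resultant_eq0 -(map_resultant l1 l2) resF.
set g := gcdp _ _ in gsz.
have gy : g %| (mu ^+ 2) *: 'X^(p.+1) - mu *: ('X^2 * Apoly) by rewrite -G2F dvdp_gcdr.
have gB : g %| (mu ^+ 2)%:P - mu *: Apoly.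
  have : g %| map_poly (phi F tr%:~R) G1 by apply: dvdp_gcdl.
  by rewrite G1F dvdp_addl.
(* [D] is [X (X^p - X)], and [mu^2 D] is the reduction of the polynomial for [y] minus [X^2] times
   that for [B]. As [D] splits over [F], the common factor [g] has a root in [F]. *)
pose D : {poly F} := 'X^1 * \prod_(x : F) ('X - x%:P).
have gD : g %| (mu ^+ 2) *: D.
  have -> : (mu ^+ 2) *: D = (mu ^+ 2) *: 'X^(p.+1) - mu *: ('X^2 * Apoly) - 'X^2 * ((mu ^+ 2)%:P - mu *: Apoly).
    rewrite /D -finField_genPoly F_card -!mul_polyC !polyCM; rewrite [in 'X^(p.+1)]exprS; ring.
  by rewrite dvdp_sub // dvdp_mull.
have [a ra] : exists a, root g a.
  have [/existsP[a ra]|/existsPn none] := boolP [exists a, root g a]; first by exists a.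
  have cop : coprimep g D.
    rewrite /D expr1 coprimepMr; apply/andP; split.
      by rewrite -['X]subr0 -polyC0 coprimep_XsubC.
    by apply: (big_ind (fun P => coprimep g P)) => [|P Q hP hQ|x _]; rewrite ?coprimep1 ?coprimepMr ?hP // coprimep_XsubC.
  have : g %| gcdp g D by rewrite dvdp_gcd dvdpp -(dvdpZr _ _ (_ : mu ^+ 2 != 0)) // expf_neq0 // mu_neq0.
  move/dvdp_leq => /(_ _); move: cop; rewrite coprimep_def => /eqP cop; rewrite cop => h.
  have : (size g <= 1)%N by apply: h; rewrite -size_poly_eq0 cop.
  by rewrite leqNgt gsz.
have HBa : mu ^+ 2 - mu * Apoly.[a] = 0.
  have := dvdp_trans (_ : 'X - a%:P %| g) gB; rewrite dvdp_XsubCl => /(_ ra); rewrite dvdp_XsubCl => /rootP.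
  by rewrite hornerD hornerN hornerZ hornerC.
have Aa : Apoly.[a] = form n al 1 a.
  rewrite /Apoly horner_sum /form; apply: eq_bigr => j _.
  by rewrite hornerZ hornerXn expr1n mul1r.
have e : form n al 1 a = mu.
  apply: (mulfI mu_neq0); rewrite -Aa; apply/eqP; rewrite eq_sym -subr_eq0 -expr2 HBa.
  by [].
(* The form takes the value [al 0 = 1] at [(1, 0)], while [mu] is not 1. A nonzero [a] is what makes
   [u^3 != v^3] at the vertex built from it. *)
exists a => //; apply/eqP => za; move: e; rewrite za form_w0 al0 expr1n mulr1 => /esym/eqP.
by apply/negP; exact: mu_neq1.
Qed.

Lemma inv_agm_value : exists x : F * F, is_agm_vertex x /\ inv_agm n al x = mu.
Proof.
have [a ha a0] := alpha_value.
have f27 := F27_neq0 p_prime F_card p_mod3 p_ge5.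
exists (croot (27 * a + 1), 1); rewrite /is_agm_vertex /inv_agm /= oner_neq0 expr1n (crootK F3) /=.
split; first by rewrite -subr_eq0 addrK mulf_neq0.
by rewrite addrK mulrC mulKf.
Qed.

End ModularValue.

(** * Counting cycles *)

Section CyclesOfInjection.
Variables (T W : finType) (f : T -> T) (e : rel T) (I : T -> W) (S : {set T}).
Hypothesis f_inj : injective f.
Hypothesis ef : forall x y, e x y = (f x == y).
Hypothesis S_closed : forall x, x \in S -> f x \in S.
Hypothesis I_inv : forall x, x \in S -> I (f x) = I x.

Lemma orbit_invariant x y : x \in S -> y \in orbit f x -> I y = I x.
Proof.
move=> xS; rewrite -fconnect_orbit => /iter_findex <-.
have : iter (findex f x y) f x \in S /\ I (iter (findex f x y) f x) = I x.
  elim: (findex f x y) => [|k [IS IH]] //=; by split; [exact: S_closed|rewrite I_inv].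
by case.
Qed.

Definition rep (v : W) : option T := [pick x in S | I x == v].
(** The orbit length of a chosen vertex of invariant [v]; the default 0 is the length of no counted
    cycle. *)
Definition period (v : W) : nat := if rep v is Some x then order f x else 0.

Lemma repP v : v \in I @: S -> exists2 x, rep v = Some x & x \in S /\ I x = v.
Proof.
case/imsetP => x xS ->; rewrite /rep; case: pickP => [y /andP[yS /eqP yx]|/(_ x)]; first by exists y.
by rewrite xS eqxx.
Qed.

Lemma period_bound v : v \in I @: S -> (0 < period v <= #|T|)%N.
Proof.
by case/repP => x hx _; rewrite /period hx order_gt0 -size_orbit -(card_uniqP (orbit_uniq f x)) max_card.
Qed.

(** A value [v] of period [m] is sent to the rotation class of the orbit of its representative;
    since [I] is constant on that orbit, the class determines [v]. *)
Lemma card_period m : (0 < m)%N ->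
  (#|[set v in I @: S | period v == m]| <= #|equivalence_partition (same_cycle (n := m)) (simple_cycles e m)|)%N.
Proof.
move=> m0; pose D := simple_cycles e m.
pose blk v : {set m.-tuple T} := [set d in D | [exists k : 'I_m, rot k (oapp (orbit f) [::] (rep v)) == d :> seq T]].
have main v : v \in [set v in I @: S | period v == m] ->
    exists2 x, rep v = Some x & [/\ x \in S, I x = v & exists2 c : m.-tuple T, c \in D & val c = orbit f x].
  rewrite inE => /andP[/repP[x hx [xS xv]] /eqP pm]; exists x => //; split=> //.
  have sz : size (orbit f x) == m by rewrite size_orbit -pm /period hx.
  exists (Tuple sz) => //; rewrite inE /ucycleb /= orbit_uniq andbT.
  rewrite (eq_cycle (e' := frel f)) ?cycle_orbit // => a b; exact: ef.
have blk_inj : {in [set v in I @: S | period v == m] &, injective blk}.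
  move=> v v' /main[x hx [xS xv [c cD cx]]] /main[x' hx' [xS' xv' [c' cD' cx']]] E.
  have : c' \in blk v'.
    by rewrite inE cD' hx' /=; apply/existsP; exists (Ordinal m0); rewrite rot0 -cx'.
  rewrite -E inE cD' hx /= => /existsP[k /eqP hk].
  rewrite -xv -xv'; apply/esym/orbit_invariant => //.
  by rewrite -(mem_rot k) hk -/(val c') cx' in_orbit.
rewrite -(card_in_imset blk_inj); apply: subset_leq_card; apply/fintype.subsetP => _ /imsetP[v hv ->].
have [x hx [xS xv [c cD cx]]] := main v hv.
apply/imsetP; exists c => //; apply/setP => d; rewrite !inE /blk hx /=; congr (_ && _).
by apply: eq_existsb => k; rewrite -cx.
Qed.

Lemma num_cycles_ge : (#|I @: S| <= num_simple_cycles e)%N.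
Proof.
pose A := I @: S; rewrite /num_simple_cycles.
have E : #|A| = (\sum_(1 <= m < #|T|.+1) #|[set v in A | period v == m]|)%N.
  transitivity (\sum_(1 <= m < #|T|.+1) \sum_(v in A) (period v == m))%N; last first.
    apply: eq_bigr => m _; rewrite -sum1_card big_mkcond [RHS]big_mkcond /=.
    by apply: eq_bigr => v _; rewrite inE; case: (v \in A) => //=; case: eqP.
  rewrite exchange_big /= -sum1_card; apply: eq_bigr => v vA.
  have /andP[p1 p2] := period_bound vA.
  rewrite (bigD1_seq (period v)) ?iota_uniq //=; last by rewrite mem_index_iota p1 ltnS.
  by rewrite eqxx big1 // => i; rewrite eq_sym => /negPf ->.
rewrite -/A E big_seq [X in (_ <= X)%N]big_seq; apply: leq_sum => m.
by rewrite mem_index_iota => /andP[m0 _]; apply: card_period.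
Qed.

End CyclesOfInjection.

(** * The AGM step as a permutation of the vertices *)

Section AGMMap.
Variable F : finFieldType.
Hypothesis F_mod3 : (#|F| %% 3 = 2)%N.
Hypothesis three : (3 : F) != 0.

Definition agm_next (x : F * F) : F * F :=
  ((x.1 + 2 * x.2) / 3, croot (x.2 * (x.1 ^+ 2 + x.1 * x.2 + x.2 ^+ 2) / 3)).

(** Recovers [u - v] from the image, since cubing is injective; together with [u'] this inverts the
    step. *)
Lemma agm_next_cube x : (agm_next x).1 ^+ 3 - (agm_next x).2 ^+ 3 = ((x.1 - x.2) / 3) ^+ 3.
Proof. by rewrite /= (crootK F_mod3); field. Qed.

Lemma agm_next_vertex x : is_agm_vertex x -> is_agm_vertex (agm_next x).
Proof.
case/andP => v0 uv; apply/andP; split.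
  apply/eqP => h; have := crootK F_mod3 (x.2 * (x.1 ^+ 2 + x.1 * x.2 + x.2 ^+ 2) / 3).
  rewrite -[croot _]/((agm_next x).2) h expr0n /= => /esym/eqP.
  rewrite !mulf_eq0 (negPf v0) invr_eq0 (negPf three) orbF /= => /eqP z.
  case/eqP: uv; apply/eqP; rewrite -subr_eq0.
  have -> : x.1 ^+ 3 - x.2 ^+ 3 = (x.1 - x.2) * (x.1 ^+ 2 + x.1 * x.2 + x.2 ^+ 2) by ring.
  by rewrite z mulr0.
rewrite -subr_eq0 agm_next_cube expf_neq0 // mulf_neq0 ?invr_eq0 // subr_eq0.
by apply: contra uv => /eqP ->.
Qed.

Definition agm_map (x : agm_vertex F) : agm_vertex F :=
  exist _ (agm_next (val x)) (agm_next_vertex (valP x)).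

Lemma agm_edgeE (x y : agm_vertex F) : agm_edge x y = (agm_map x == y).
Proof.
rewrite -val_eqE /agm_edge /=; case: x => [[u v] /= hx]; case: y => [[u' v'] /= hy].
rewrite -[RHS]/((_, _) == (u', v')) xpair_eqE eq_sym; congr (_ && _).
apply/eqP/eqP => [h|<-]; last exact: (crootK F_mod3).
by apply: (cube_inj F_mod3); rewrite (crootK F_mod3) h.
Qed.

Lemma agm_map_inj : injective agm_map.
Proof.
move=> x y h; apply/val_inj; have {}h : agm_next (val x) = agm_next (val y) by have := congr1 val h.
have r : ((val x).1 - (val x).2) / 3 = ((val y).1 - (val y).2) / 3.
  by apply: (cube_inj F_mod3); rewrite -!agm_next_cube h.
have s : (agm_next (val x)).1 = (agm_next (val y)).1 by rewrite h.
have v (z : F * F) : z.2 = (agm_next z).1 - (z.1 - z.2) / 3 by rewrite /=; field.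
have u (z : F * F) : z.1 = (agm_next z).1 + 2 * ((z.1 - z.2) / 3) by rewrite /=; field.
rewrite [val x]surjective_pairing [val y]surjective_pairing; congr pair.
  by rewrite (u (val x)) (u (val y)) r s.
by rewrite (v (val x)) (v (val y)) r s.
Qed.

End AGMMap.

(** * The case of a prime field *)

Section PrimeField.
Variables (n : nat) (F : finFieldType).
Local Notation p := n.+1.
Hypothesis p_prime : prime p.
Hypothesis F_card : #|F| = p.
Hypothesis p_mod3 : (p %% 3 = 2)%N.
Hypothesis p_ge5 : (5 <= p)%N.

Lemma exists_form_coefs : exists cB cy, form_coefs n Bs cB /\ form_coefs n ys cy.
Proof.
pose R0 : realType := Rdefinitions.R.
have ex (G : fps int) : (forall i, (i <= p.+1)%N -> modular R0 (p.+1 - i) (isopoly n G)`_i) ->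
    exists c, form_coefs n G c.
  move=> h; have h' i : exists c : nat -> int, (i <= p.+1)%N ->
      (isopoly n G)`_i = form (p.+1 - i) (fun j => fps_const (c j)) Bs ys.
    case: (leqP i p.+1) => [hi|_]; last by exists (fun=> 0).
    by have [c hc] := modular_form (h i hi); exists c.
  by have [c hc] := boolp.choice h'; exists c.
have [cB hB] := ex _ (isopoly_Bs_modular p_prime p_mod3 R0).
have [cy hy] := ex _ (isopoly_ys_modular p_prime p_mod3 R0).
by exists cB, cy.
Qed.

Lemma prime_cycles s : (9 * s ^ 2 < 4 * p)%N -> (2 * s <= d3 F)%N.
Proof.
move=> hs; have [cB [cy [hB hy]]] := exists_form_coefs.
have F3' : (#|F| %% 3 = 2)%N by rewrite F_card.
have t3 := three_neq0 p_prime F_card p_mod3 p_ge5.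
have [_ _ _ al1 _] := alpha_spec p_prime F_card hB hy.
pose T := agm_vertex F.
pose I (x : T) : F := inv_agm n (alpha F cB) (val x).
have hI (x : T) : I (agm_map F3' t3 x) = I x.
  by apply/esym/(inv_agm_step p_prime F_card p_mod3 p_ge5 al1) => //; rewrite /= (crootK F3').
have : (#|I @: [set: T]| <= num_simple_cycles (@agm_edge F))%N.
  apply: (@num_cycles_ge T _ (agm_map F3' t3)) => [|x y|x _|x _].
  - exact: agm_map_inj.
  - exact: agm_edgeE.
  - by rewrite inE.
  - exact: hI.
apply: leq_trans.
(* The [2 s] traces [3 k] and [-3 k] with [1 <= k <= s]; the shift [z.2.+1] keeps the trace 0
   out. *)
pose tr (z : bool * 'I_s) : int := (-1) ^+ z.1 * (3 * z.2.+1%:Z).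
have trP z : [/\ (3 %| tr z)%Z, tr z ^+ 2 < 4 * p%:Z & tr z != 0].
  case: z => b [k hk]; rewrite /tr /=; split.
  - by rewrite dvdz_mull // dvdz_mulr.
  - rewrite exprMn sqrr_sign mul1r.
    have : (9 * k.+1 ^ 2 < 4 * p)%N by apply: leq_ltn_trans hs; rewrite leq_mul2l leq_exp2r.
    by nia.
  - by rewrite mulf_neq0 ?signr_eq0.
pose g z : F := mu F (tr z).
have g_inj : injective g.
  move=> z z' /oppr_inj /(cube_inj F3') h.
  have [k hk] : exists k, tr z - tr z' = k * p%:Z by apply: (intF_eq0 p_prime F_card); rewrite rmorphB /= h subrr.
  move: z z' h hk => [b [i hi]] [b' [j hj]] _; rewrite /tr /= => hk.
  (* Both traces are multiples of 3, hence so is [k]. After division by 3 their difference is at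
     most [2 s < p] in absolute value and cannot be a nonzero multiple of [p]. *)
  have k3 : (3 %| k)%Z.
    have c3 : coprimez 3 p by rewrite coprimezE /= prime_coprime //; lia.
    rewrite -(Gauss_dvdzl _ c3) -hk; apply: rpredB; by rewrite dvdz_mull // dvdz_mulr.
  have /dvdzP[k' hk'] := k3.
  have {}hk : (-1) ^+ b * i.+1%:Z - (-1) ^+ b' * j.+1%:Z = k' * p%:Z.
    by move: hk; rewrite hk'; case: b; case: b'; rewrite ?expr0 ?expr1 ?mul1r ?mulN1r; lia.
  have [b1 b2] : - (2 * s%:Z) <= k' * p%:Z /\ k' * p%:Z <= 2 * s%:Z.
    by rewrite -hk; case: (b); case: (b'); rewrite ?expr0 ?expr1 ?mul1r ?mulN1r; split; lia.
  have k0 : k' = 0.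
    have ps : 2 * s%:Z < p%:Z.
      move: hs p_ge5; clear; case: s => [|s'] hs h5; first by lia.
      have : (9 * s'.+1 <= 9 * s'.+1 ^ 2)%N by rewrite leq_mul2l (@leq_pexp2l s'.+1 1 2).
      by lia.
    by move: b1 b2 ps; clear; move: k' (s%:Z) (p%:Z) => k' S P h1 h2 h3; nia.
  move: hk; rewrite k0 mul0r => hk.
  by move: hk; case: b; case: b'; rewrite ?expr0 ?expr1 ?mul1r ?mulN1r => hk; congr pair; try (apply/val_inj => /=; lia); exfalso; lia.
have -> : (2 * s = #|g @: [set: bool * 'I_s]|)%N by rewrite card_imset // cardsT card_prod card_bool card_ord.
apply: subset_leq_card; apply/fintype.subsetP => _ /imsetP[z _ ->].
have [z3 zlt z0] := trP z.
have [x [hx Ix]] := inv_agm_value p_prime F_card p_mod3 p_ge5 hB hy z3 zlt z0.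
by apply/imsetP; exists (exist _ x hx : T).
Qed.

End PrimeField.

(** * Counting by a Frobenius invariant over proper powers of p *)

Section PrimePower.
Variables (p m : nat) (F : finFieldType).
Hypothesis p_prime : prime p.
Hypothesis p_ge5 : (5 <= p)%N.
Hypothesis F_card : #|F| = (p ^ m)%N.
Hypothesis F_mod3 : (#|F| %% 3 = 2)%N.

Lemma pcharFm : p \in [pchar F].
Proof. exact: (card_finPcharP F_card p_prime). Qed.

Lemma three_neq0' : (3 : F) != 0.
Proof.
rewrite -(dvdn_pcharf pcharFm) gtnNdvd //.
exact: leq_trans p_ge5.
Qed.

Lemma card_power_image : (#|F|.-1 <= p.-1 * #|(fun v : F => v ^+ p.-1) @: [set~ 0%R]|)%N.
Proof.
set A := [set~ 0%R]; set h := fun v : F => v ^+ p.-1.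
have p1 : (0 < p.-1)%N by case: p p_ge5 => [|[|]].
have -> : #|F|.-1 = #|A| by rewrite cardsC1.
rewrite -sum1_card (partition_big_imset h) /= mulnC -sum_nat_const; apply: leq_sum => c _.
rewrite sum1dep_card.
have sz := @size_XnsubC F _ c p1.
have nz : 'X^(p.-1) - c%:P != 0 by rewrite -size_poly_eq0 sz.
have := @max_poly_roots F ('X^(p.-1) - c%:P) (enum [set x in A | h x == c]) nz _ (enum_uniq _).
rewrite sz ltnS -cardE; apply.
by apply/allP => x; rewrite mem_enum inE => /andP[_ /eqP hx]; rewrite /root hornerD hornerN hornerXn hornerC -/(h x) hx subrr.
Qed.

(** The equation defining [S] says that [c = u / v] lies in [F_p]. There [v' = k v] with
    [k^3 = (c^2 + c + 1) / 3] in [F_p]; uniqueness of cube roots puts [k] in [F_p], so [v^(p-1)] is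
    unchanged and the new ratio is again in [F_p]. *)
Lemma power_cycles : (p ^ m.-1 <= d3 F)%N.
Proof.
have t3 := three_neq0'.
pose T := agm_vertex F.
pose S := [set x : T | (val x).1 ^+ p * (val x).2 == (val x).1 * (val x).2 ^+ p].
pose I (x : T) : F := (val x).2 ^+ p.-1.
pose phi : {rmorphism F -> F} := pFrobenius_aut pcharFm.
have fr (z : F) : z ^+ p = phi z by [].
have pp : p = p.-1.+1 by rewrite prednK // (leq_trans _ p_ge5).
have closed (x : T) : x \in S -> agm_map F_mod3 t3 x \in S /\ I (agm_map F_mod3 t3 x) = I x.
  rewrite !inE => /eqP hx; case: x hx => [[u v] /= hv]; have /andP[/= v0 uv] := hv => hx.
  have v'0 : (agm_next (u, v)).2 != 0 by have /andP[] := agm_next_vertex F_mod3 t3 hv.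
  pose c := u / v; have cp : c ^+ p = c.
    have vp : v ^+ p != 0 by rewrite expf_neq0.
    by rewrite /c expr_div_n; apply: (mulIf vp); apply: (mulIf v0); rewrite divfK // hx; field.
  have uE : u = c * v by rewrite /c divfK.
  pose k := (agm_next (u, v)).2 / v.
  have v'E : (agm_next (u, v)).2 = k * v by rewrite /k divfK.
  have k3 : k ^+ 3 = (c ^+ 2 + c + 1) / 3.
    by rewrite /k expr_div_n /= (crootK F_mod3) uE; field; rewrite v0 t3.
  have p3 : (3 : F) ^+ p = 3 by rewrite fr rmorph_nat.
  have kp : k ^+ p = k.
    apply: (cube_inj F_mod3); rewrite -exprM mulnC exprM k3 fr.
    by rewrite rmorphM !rmorphD rmorphXn fmorphV rmorph_nat rmorph1 -fr cp.
  have kn : k != 0 by rewrite /k mulf_neq0 ?invr_eq0.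
  have kp1 : k ^+ p.-1 = 1 by apply: (mulfI kn); rewrite -exprS -pp kp mulr1.
  split; last by rewrite /I /= -[croot _]/((agm_next (u, v)).2) v'E exprMn kp1 mul1r.
  have dp : ((c + 2) / 3) ^+ p = (c + 2) / 3.
    by rewrite fr rmorphM rmorphD fmorphV !rmorph_nat -fr cp.
  have u'E : (agm_next (u, v)).1 = (c + 2) / 3 * v by rewrite /= uE; field.
  rewrite -[croot _]/((agm_next (u, v)).2) -[(u + 2 * v) / 3]/((agm_next (u, v)).1) u'E v'E [((c + 2) / 3 * v) ^+ p]exprMn [(k * v) ^+ p]exprMn dp kp.
  by apply/eqP; move: (v ^+ p) => V; ring.
have : (#|I @: S| <= num_simple_cycles (@agm_edge F))%N.
  apply: (@num_cycles_ge T _ (agm_map F_mod3 t3)) => [|x y|x /closed[]|x /closed[]] //.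
  - exact: agm_map_inj.
  - exact: agm_edgeE.
apply: leq_trans.
(* Every nonzero [v] occurs, through the vertex [(0, v)] of ratio 0. *)
have sub : (#|(fun v : F => v ^+ p.-1) @: [set~ 0%R]| <= #|I @: S|)%N.
  apply: subset_leq_card; apply/fintype.subsetP => _ /imsetP[v v0 ->]; rewrite !inE in v0.
  have hv : is_agm_vertex ((0, v) : F * F).
    by rewrite /is_agm_vertex /= v0 expr0n /= eq_sym expf_neq0.
  apply/imsetP; exists (exist _ (0, v) hv : T) => //.
  by rewrite inE /= expr0n pp /= !mul0r.
have := card_power_image; rewrite F_card => h.
have m0 : (0 < m)%N.
  rewrite lt0n; apply/eqP => m0; have := F_mod3; by rewrite F_card m0 expn0.
have {}h : ((p ^ m).-1 <= p.-1 * #|I @: S|)%N by apply: leq_trans h _; rewrite leq_mul2l sub orbT.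
move: h; rewrite -{1}(prednK m0) expnS; set N := #|_|; set Q := (p ^ m.-1)%N => h.
have Q0 : (0 < Q)%N by rewrite expn_gt0 (leq_trans _ p_ge5).
(* If [N < Q], then [(p - 1) N <= (p - 1)(Q - 1) < p Q - 1], against [h]. *)
rewrite leqNgt; apply/negP => NQ; have := p_ge5; nia.
Qed.

End PrimePower.

Lemma ler_of_sqr (R : realDomainType) (a b : R) : 0 <= b -> a ^+ 2 <= b ^+ 2 -> a <= b.
Proof. by move=> b0 h; nra. Qed.

Theorem theorem6p3 (R : rcfType) (p m q : nat) (F : finFieldType)
    (p_prime : prime p) (p_ge5 : (5 <= p)%N) (m_ge1 : (1 <= m)%N)
    (q_def : q = (p ^ m)%N) (q_mod3 : (q = 2 %[mod 3])%N)
    (F_card : #|F| = q) :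
  16 / 15 * Num.sqrt (q%:R : R) - 1 <= (d3 F)%:R.
Proof.
have F_mod3 : (#|F| %% 3 = 2)%N by rewrite F_card q_mod3.
set x := Num.sqrt _; have x0 : 0 <= x by apply: sqrtr_ge0.
have x2 : x ^+ 2 = q%:R by rewrite sqr_sqrtr.
clearbody x.
(* The exponent 2 is excluded because a square is 0 or 1 modulo 3. *)
have [m1|m3] : m = 1%N \/ (3 <= m)%N.
  case: m q_def m_ge1 => [|[|[|k]]] // E _; [by left| |by right].
  exfalso; move: q_mod3; rewrite E -modnXm.
  have : (p %% 3 < 3)%N by rewrite ltn_mod.
  by case: (p %% 3)%N => [|[|[|]]].
- have qp : q = p by rewrite q_def m1 expn1.
  have pE : p = p.-1.+1 by rewrite prednK // (leq_trans _ p_ge5).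
  have p3 : (p.-1.+1 %% 3 = 2)%N by rewrite -pE -qp -F_card.
  have [s s1 s2] : exists2 s, (9 * s ^ 2 < 4 * p)%N & (4 * p <= 9 * s.+1 ^ 2)%N.
    have ex : exists s, (9 * s ^ 2 < 4 * p)%N by exists 0%N; lia.
    have bd s : (9 * s ^ 2 < 4 * p)%N -> (s <= 4 * p)%N by nia.
    by case: (ex_maxnP ex bd) => s hs mx; exists s => //; rewrite leqNgt; apply/negP => /mx; rewrite ltnn.
  have h : (2 * s <= d3 F)%N.
    by apply: (@prime_cycles p.-1 F) => //; rewrite -?pE // F_card qp.
  have {}h : (2 * s)%:R <= (d3 F)%:R :> R by rewrite ler_nat.
  apply: le_trans h; rewrite natrM.
  have s1' : (1 <= s)%N by rewrite lt0n; apply/eqP => s0; move: s2; rewrite s0; lia.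
  (* From [x <= 3 (s + 1) / 2] follows [16/15 x - 1 <= (8 s + 3) / 5], which is at most [2 s] once
     [s >= 2]. If [s = 1], then [4 p <= 36] leaves only [p = 5]. *)
  have [s2'|s1''] := leqP 2 s.
    have hx : x <= 3 / 2 * s.+1%:R.
      apply: ler_of_sqr; first by have := ler0n R s.+1; lra.
      rewrite x2 qp exprMn.
      have : (4 * p)%:R <= (9 * s.+1 ^ 2)%:R :> R by rewrite ler_nat.
      by rewrite [_%:R]natrM [(9 * _)%:R]natrM natrX; move: (s.+1%:R ^+ 2) (p%:R) => a b; lra.
    have : (2 : R) <= s%:R by rewrite ler_nat.
    by move: hx; rewrite -[s.+1%:R]natr1; move: (s%:R) => a; lra.
  have s_1 : s = 1%N by lia.
  have p5 : p = 5%N.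
    move: s2 p_prime p3; rewrite s_1 -pE => s2 pr p3.
    have p89 : p = 5%N \/ p = 8%N by lia.
    by case: p89 pr => -> //.
  (* [45/16] solves [16/15 x - 1 = 2], and its square exceeds 5. *)
  have hx : x <= 45 / 16 by apply: ler_of_sqr; rewrite ?x2 ?qp ?p5; lra.
  by rewrite s_1 mulr1n; lra.
have h : (p ^ m.-1 <= d3 F)%N by apply: power_cycles => //; rewrite F_card.
have {}h : (p ^ m.-1)%:R <= (d3 F)%:R :> R by rewrite ler_nat.
apply: le_trans h; set y := (p ^ m.-1)%:R.
(* [y^2 = p^(2m-2) = q p^(m-2)], and [p^(m-2) >= p >= 5] as [m >= 3]. *)
have hy : 4 * x ^+ 2 <= y ^+ 2.
  rewrite x2 /y q_def -natrX -(natrM _ 4) ler_nat -expnM.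
  have -> : (m.-1 * 2 = m + (m - 2))%N by lia.
  rewrite expnD mulnC leq_mul2l; apply/orP; right.
  have : (p ^ 1 <= p ^ (m - 2))%N by rewrite leq_pexp2l //; lia.
  by rewrite expn1; lia.
have y0 : 0 <= y by [].
have : 2 * x <= y by apply: ler_of_sqr => //; rewrite exprMn; move: (x ^+ 2) hy => z; lra.
by move: x0; lra.
Qed.
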